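(* Let $\Phi$ be a point-stationary point process in $\mathbb R^k$ and assume the metric on $\Phi$ is equivalent to the Euclidean metric. Then, for all equivariant weight functions $\boldsymbol w$ such that $\boldsymbol w_\Phi(0)>0$ a.s., one has $$\overline{\mathrm{udim}}_M(\Phi)=\overline{\mathrm{decay}}\Big(\mathbb E\Big[\tfrac{\boldsymbol w(0)}{\boldsymbol w(C_r+\boldsymbol U_r)}\Big]\Big)\le\overline{\mathrm{decay}}\Big(\mathbb E\Big[\tfrac{\boldsymbol w(0)}{\boldsymbol w(N_r(0))}\Big]\Big)\le\overline{\mathrm{growth}}\big(\mathbb E[\boldsymbol w(N_r(0))]\big),$$ $$\underline{\mathrm{udim}}_M(\Phi)=\underline{\mathrm{decay}}\Big(\mathbb E\Big[\tfrac{\boldsymbol w(0)}{\boldsymbol w(C_r+\boldsymbol U_r)}\Big]\Big)\le\underline{\mathrm{decay}}\Big(\mathbb E\Big[\tfrac{\boldsymbol w(0)}{\boldsymbol w(N_r(0))}\Big]\Big)\le\underline{\mathrm{growth}}\big(\mathbb E[\boldsymbol w(N_r(0))]\big),$$ where $C_r:=[0,r)^k$ and $\boldsymbol U_r$ is a uniformly random point of $-C_r$ independent of $\Phi$ and $\boldsymbol w$.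
   Context: Growth and decay. For a nonnegative function $f$, $\overline{\mathrm{growth}}(f)=\limsup_{r\to\infty}\frac{\log f(r)}{\log r}$, $\underline{\mathrm{growth}}(f)=\liminf_{r\to\infty}\frac{\log f(r)}{\log r}$, $\overline{\mathrm{decay}}(f)=-\underline{\mathrm{growth}}(f)$, $\underline{\mathrm{decay}}(f)=-\overline{\mathrm{growth}}(f)$. Point processes. A point process in $\mathbb R^k$ is a random locally finite subset $\Phi\subseteq\mathbb R^k$. It is point-stationary if $0\in\Phi$ a.s. and $\mathbb E[\sum_{x\in\Phi}g(\Phi,0,x)]=\mathbb E[\sum_{x\in\Phi}g(\Phi,x,0)]$ for all measurable $g(\varphi,x,y)\ge0$ ($\varphi\subseteq\mathbb R^k$ discrete, $x,y\in\varphi$) invariant under joint translations. ''Equivalent to the Euclidean metric'' means bounded above and below by positive constant multiples of it. Equivariant processes. An equivariant process with values in a complete separable metric space $\Xi$ on $\Phi$ assigns to (almost) every realization $\varphi$ a random marking $\boldsymbol Z_\varphi\in\Xi^{\varphi\times\varphi}$ (extra randomness allowed; the mark of a point $x$ is that of $(x,x)$), depending measurably on $\varphi$, such that for every translation $\rho$, $\boldsymbol Z_\varphi\circ\rho^{-1}$ has the same distribution as $\boldsymbol Z_{\rho(\varphi)}$. An equivariant subset is the set of points with mark 1 in a $\{0,1\}$-valued equivariant process; its intensity is $\mathbb P[0\in\boldsymbol S_\Phi]$. An equivariant weight function is an equivariant process with values in $[0,\infty)$ (marks on points); $\boldsymbol w(A):=\sum_{v\in\Phi\cap A}\boldsymbol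 w(v)$. Dimension. $N_r(v)$ is the closed ball in $\Phi$ of radius $r$ centered at $v$. An equivariant $r$-covering is an equivariant subset $\boldsymbol R$ of $\Phi$ such that the balls $N_r(v)$, $v\in\boldsymbol R_\Phi$, cover $\Phi$ a.s.; $\lambda_r$ is the infimum of the intensities of equivariant $r$-coverings; $\overline{\mathrm{udim}}_M(\Phi):=\overline{\mathrm{decay}}(\lambda_r)$ and $\underline{\mathrm{udim}}_M(\Phi):=\underline{\mathrm{decay}}(\lambda_r)$ as $r\to\infty$. *)

(* Defs.v *)
From HB Require Import structures.
From mathcomp Require Import all_boot all_order all_algebra.
From mathcomp Require Import all_classical all_reals all_analysis.
From mathcomp Require Import measurable_realfun.

Set Implicit Arguments.
Unset Strict Implicit.
Unset Printing Implicit Defensive.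

Import Order.TTheory GRing.Theory Num.Theory.
Import numFieldNormedType.Exports.

Local Open Scope classical_set_scope.
Local Open Scope card_scope.
Local Open Scope ring_scope.

(* The Borel sigma-algebra of R^k = 'rV[R]_k, generated by the coordinates. *)
Section borel_row.
Context {R : realType} {k : nat}.

Definition coordinate_sets : set (set 'rV[R]_k) :=
  [set E | exists (i : 'I_k) (B : set R),
     measurable B /\ E = [set x : 'rV[R]_k | B (x ord0 i)]].

Let setC_row (A : set 'rV[R]_k) :
  <<s coordinate_sets >> A -> <<s coordinate_sets >> (~` A).
Proof. by move=> sGA; rewrite -setTD; exact: sigma_algebraCD. Qed.

HB.instance Definition _ := @isMeasurable.Build (sigma_display coordinate_sets)
  'rV[R]_k <<s coordinate_sets >> (@sigma_algebra0 _ setT coordinate_sets)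
  setC_row (@sigma_algebra_bigcup _ setT coordinate_sets).

Definition enorm (x : 'rV[R]_k) : R := Num.sqrt (\sum_i x ord0 i ^+ 2).

End borel_row.

Section configurations.
Context {R : realType} {k : nat}.
Implicit Types (t : 'rV[R]_k) (A : set 'rV[R]_k).

Definition locally_finite A :=
  forall B : set 'rV[R]_k, bounded_set B -> finite_set (A `&` B).

Record config := Config {
  points :> set 'rV[R]_k ;
  points_locally_finite : locally_finite points }.

Lemma locally_finite0 : locally_finite set0.
Proof. by move=> B _; rewrite set0I. Qed.

HB.instance Definition _ := gen_eqMixin config.
HB.instance Definition _ := gen_choiceMixin config.
HB.instance Definition _ := isPointed.Build config (Config locally_finite0).

(* The usual sigma-algebra, generated by the numbers of points in Borel sets *)
Definition counting_sets : set (set config) :=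
  [set E | exists (B : set 'rV[R]_k) (n : nat),
     measurable B /\ E = [set phi : config | phi `&` B #= `I_n]].

Let setC_config (A : set config) :
  <<s counting_sets >> A -> <<s counting_sets >> (~` A).
Proof. by move=> sGA; rewrite -setTD; exact: sigma_algebraCD. Qed.

HB.instance Definition _ := @isMeasurable.Build (sigma_display counting_sets)
  config <<s counting_sets >> (@sigma_algebra0 _ setT counting_sets)
  setC_config (@sigma_algebra_bigcup _ setT counting_sets).

Lemma locally_finite_shift t A :
  locally_finite A -> locally_finite [set x | A (x - t)].
Proof.
move=> lfA B bB.
have : finite_set (A `&` [set y | B (y + t)]).
  apply: lfA; case: bB => M [Mreal hM].
  exists (M + `|t|); split; first by rewrite realD// normr_real.
  move=> N MN y /= By.
  have /hM/(_ (y + t) By) /= h : M < N - `|t| by rewrite ltrBrDr.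
  rewrite -[y](addrK t); apply: (le_trans (ler_normB _ _)).
  by rewrite -lerBrDr.
move=> /(finite_image (fun y => y + t)); apply: sub_finite_set => x [/= Ax Bx].
by exists (x - t); rewrite /= ?subrK.
Qed.

Definition shift_config t (phi : config) : config :=
  Config (locally_finite_shift t (@points_locally_finite phi)).

End configurations.
Arguments config : clear implicits.

(* A configuration phi with marks on phi * phi. The values of [mark] outside
   phi * phi are junk: they are invisible to the sigma-algebra below.
   The mark of a point x is [mark x x]. *)
Section marked_configurations.
Context {R : realType} {k : nat} {d : measure_display} {Xi : measurableType d}.

Record mconfig := MConfig {
  base : config R k ;
  mark : 'rV[R]_k -> 'rV[R]_k -> Xi }.

HB.instance Definition _ := gen_eqMixin mconfig.
HB.instance Definition _ := gen_choiceMixin mconfig.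
HB.instance Definition _ := isPointed.Build mconfig
  (MConfig point (fun _ _ => point)).

Definition marked_counting_sets : set (set mconfig) :=
  [set E | exists (B : set ('rV[R]_k * 'rV[R]_k * Xi)) (n : nat),
     measurable B /\
     E = [set m : mconfig |
       [set p : 'rV[R]_k * 'rV[R]_k |
         [/\ points (base m) p.1, points (base m) p.2 & B (p, mark m p.1 p.2)]] #= `I_n]].

Let setC_mconfig (A : set mconfig) :
  <<s marked_counting_sets >> A -> <<s marked_counting_sets >> (~` A).
Proof. by move=> sGA; rewrite -setTD; exact: sigma_algebraCD. Qed.

HB.instance Definition _ :=
  @isMeasurable.Build (sigma_display marked_counting_sets)
  mconfig <<s marked_counting_sets >>
  (@sigma_algebra0 _ setT marked_counting_sets)
  setC_mconfig (@sigma_algebra_bigcup _ setT marked_counting_sets).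

Definition shift_mconfig (t : 'rV[R]_k) (m : mconfig) : mconfig :=
  MConfig (shift_config t (base m)) (fun x y => mark m (x - t) (y - t)).

Definition pmark (m : mconfig) (x : 'rV[R]_k) : Xi := mark m x x.

End marked_configurations.
Arguments mconfig R k {d} Xi.

(* Measurable, jointly translation-invariant functions g(phi, x, y),
   x, y in phi. *)
Definition invariant_pair_function {R : realType} {k : nat}
    (g : config R k -> 'rV[R]_k -> 'rV[R]_k -> R) :=
  measurable_fun
    [set p : config R k * 'rV[R]_k * 'rV[R]_k | points p.1.1 p.1.2 /\
      points p.1.1 p.2]
    (fun p => g p.1.1 p.1.2 p.2) /\
  forall (phi : config R k) (x y t : 'rV[R]_k), points phi x -> points phi y ->
    g (shift_config t phi) (x + t) (y + t) = g phi x y.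

Section processes.
Context {R : realType} {k : nat} {dO : measure_display}
  {Omega : measurableType dO} {P : probability Omega R}.
Variable Phi : {RV P >-> config R k}.
Local Open Scope ereal_scope.

Definition point_stationary :=
  {ae P, forall omega, points (Phi omega) 0%R} /\
  forall g : config R k -> 'rV[R]_k -> 'rV[R]_k -> R,
    invariant_pair_function g ->
    (forall (phi : config R k) x y, points phi x -> points phi y -> (0 <= g phi x y)%R) ->
    \int[P]_omega (\esum_(x in Phi omega) (g (Phi omega) 0%R x)%:E) =
    \int[P]_omega (\esum_(x in Phi omega) (g (Phi omega) x 0%R)%:E).

Definition metric_on (A : set 'rV[R]_k) (d : 'rV[R]_k -> 'rV[R]_k -> R) :=
  forall x y z, A x -> A y -> A z ->
    [/\ (d x y = 0%R <-> x = y), d x y = d y x & (d x z <= d x y + d y z)%R].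

(* A metric on Phi: a measurable function of the point process, compatible
   with translations, as is the Euclidean metric. *)
Definition process_metric (d : config R k -> 'rV[R]_k -> 'rV[R]_k -> R) :=
  invariant_pair_function d /\
  {ae P, forall omega, metric_on (Phi omega) (d (Phi omega))}.

Definition equivalent_to_euclidean
    (d : config R k -> 'rV[R]_k -> 'rV[R]_k -> R) :=
  exists c C : R, [/\ (0 < c)%R, (0 < C)%R &
    {ae P, forall omega, forall x y, points (Phi omega) x -> points (Phi omega) y ->
      (c * enorm (x - y) <= d (Phi omega) x y <= C * enorm (x - y))%R}].

(* An equivariant process on Phi is given by the laws [mlaw phi] of the pairs
   (phi, Z_phi), where Z_phi is the random marking of phi, for phi in an almost
   sure translation-invariant event [dom]. Being a kernel, [mlaw] leaves the
   extra randomness of the marking unspecified. *)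
Record equivariant_process {dX : measure_display} (Xi : measurableType dX) :=
  EquivariantProcess {
    dom : set (config R k) ;
    mlaw : config R k -> probability (mconfig R k Xi) R ;
    measurable_dom : measurable dom ;
    dom_shift : forall t phi, dom phi -> dom (shift_config t phi) ;
    dom_ae : {ae P, forall omega, dom (Phi omega)} ;
    mlaw_base : forall phi, dom phi ->
      {ae mlaw phi, forall m : mconfig R k Xi, base m = phi} ;
    measurable_mlaw : forall A, measurable A ->
      measurable_fun dom (mlaw ^~ A : config R k -> \bar R) ;
    mlaw_shift : forall t phi, dom phi -> forall A, measurable A ->
      mlaw (shift_config t phi) A = mlaw phi (shift_mconfig t @^-1` A) }.

Section expectation.
Context {dX : measure_display} {Xi : measurableType dX}.
Variable Z : equivariant_process Xi.

(* E[f(Phi, Z_Phi)] *)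
Definition process_expectation (f : mconfig R k Xi -> \bar R) : \bar R :=
  \int[P]_omega (\int[mlaw Z (Phi omega)]_m f m).

Definition process_as (Q : mconfig R k Xi -> Prop) : Prop :=
  {ae P, forall omega, {ae mlaw Z (Phi omega), forall m, Q m}}.

End expectation.

Definition is_weight (w : equivariant_process R) :=
  forall phi, dom w phi ->
    {ae mlaw w phi, forall m : mconfig R k R, forall x, points (base m) x -> (0 <= pmark m x)%R}.

(* w(A) *)
Definition weight_of (m : mconfig R k R) (A : set 'rV[R]_k) : \bar R :=
  \esum_(v in base m `&` A) (pmark m v)%:E.

(* An equivariant subset is a process with values in bool; its points are the
   points with mark true. *)
Definition subset_of (m : mconfig R k bool) : set 'rV[R]_k :=
  [set x | points (base m) x /\ pmark m x = true].

Definition intensity (S : equivariant_process bool) : \bar R :=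
  \int[P]_omega mlaw S (Phi omega) [set m | subset_of m 0%R].

Section dimension.
Variable d : config R k -> 'rV[R]_k -> 'rV[R]_k -> R.

Definition nball (phi : config R k) (r : R) (v : 'rV[R]_k) : set 'rV[R]_k :=
  [set x | points phi x /\ (d phi v x <= r)%R].

Definition is_covering (r : R) (S : equivariant_process bool) :=
  process_as S (fun m =>
    base m `<=` \bigcup_(v in subset_of m) nball (base m) r v).

Definition lambda (r : R) : \bar R :=
  ereal_inf [set intensity S | S in is_covering r].

End dimension.

End processes.

Section growth.
Context {R : realType}.
Implicit Type f : R -> \bar R.
Local Open Scope ereal_scope.

Definition growth_sup f : \bar R :=
  limf_esup (fun r : R => lne (f r) / (ln r)%:E) (pinfty_nbhs R).
Definition growth_inf f : \bar R :=
  limf_einf (fun r : R => lne (f r) / (ln r)%:E) (pinfty_nbhs R).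
Definition decay_sup f : \bar R := - growth_inf f.
Definition decay_inf f : \bar R := - growth_sup f.

End growth.

Section uniform_cube.
Context {R : realType}.

Definition cons_pair n (p : measurableTypeR R * n.-tuple (measurableTypeR R)) :
  n.+1.-tuple (measurableTypeR R) := [the _.-tuple _ of p.1 :: p.2].

Lemma measurable_cons_pair n : measurable_fun setT (@cons_pair n).
Proof. exact: measurable_cons. Qed.

HB.instance Definition _ n :=
  isMeasurableFun.Build _ _ _ _ (@cons_pair n) (@measurable_cons_pair n).

(* The law of n independent random variables uniform on [0, 1] *)
Fixpoint uniform_cube n : probability (n.-tuple (measurableTypeR R)) R :=
  match n with
  | 0 => \d_[tuple]
  | n'.+1 => distribution (uniform_prob (@ltr01 R) \x uniform_cube n')%E
               (@cons_pair n')
  end.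

(* If v has law [uniform_cube k] then this is a uniform point of -C_r: the
   faces of the cube have probability zero. *)
Definition neg_cube_point k (r : R) (v : k.-tuple (measurableTypeR R)) :
  'rV[R]_k := \row_i - (r * tnth v i).

(* C_r + u *)
Definition cube k (r : R) (u : 'rV[R]_k) : set 'rV[R]_k :=
  [set x | forall i, u ord0 i <= x ord0 i < u ord0 i + r].

End uniform_cube.

Section dimension_bounds.
Context {R : realType} {k : nat} {dO : measure_display}
  {Omega : measurableType dO} {P : probability Omega R}.
Variable Phi : {RV P >-> config R k}.
Variable d : config R k -> 'rV[R]_k -> 'rV[R]_k -> R.
Variable w : equivariant_process Phi R.
Local Open Scope ereal_scope.

Definition udim_sup : \bar R := decay_sup (lambda Phi d).
Definition udim_inf : \bar R := decay_inf (lambda Phi d).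

(* E[w(0) / w(C_r + U_r)], U_r being independent of (Phi, w) *)
Definition mean_cube_ratio (r : R) : \bar R :=
  process_expectation w (fun m : mconfig R k R =>
    \int[uniform_cube k]_v
      ((pmark m 0%R)%:E / weight_of m (cube r (neg_cube_point r v)))).

Definition mean_ball_ratio (r : R) : \bar R :=
  process_expectation w (fun m : mconfig R k R =>
    (pmark m 0%R)%:E / weight_of m (nball d (base m) r 0%R)).

Definition mean_ball_weight (r : R) : \bar R :=
  process_expectation w (fun m : mconfig R k R => weight_of m (nball d (base m) r 0%R)).

End dimension_bounds.

(* Main.v *)
(* Let mu(s) = E[w(0) / w(C_s + U_s)]. Transporting to the lexicographically
   first point of a cell the shares of all the points of that cell shows that
   mu(s) is the intensity of the set S_s of the first points of the cells of a
   uniformly translated grid of mesh s. If d <= C |.| then S_s is a covering of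
   radius r = C (k + 1) s, so lambda_r <= mu(s). Conversely, if c |.| <= d and R
   is any r-covering, let each point send its expected share to the points of R
   at distance at most r / c: every point sends at least its share, and receives
   in total at most a constant K depending on r / s only, because all the cells
   involved can be anchored at K points of the lattice s Z^k. Hence mu(s) is at
   most K times the intensity of R. So lambda and mu are equal up to constants,
   and mu(r) and mu(r / C') too, for each constant C'. As N_r(0) contains every
   cell of mesh r / (C (k + 1)) around 0, E[w(0) / w(N_r(0))] <= K mu(r). Finally,
   AM-GM gives E[min(w(0), 1)]^2 <= E[w(0) / w(N_r(0))] E[w(N_r(0))]. *)
From HB Require Import structures.
From mathcomp Require Import all_boot all_order all_algebra finmap.
From mathcomp Require Import all_classical all_reals all_analysis.
From mathcomp Require Import measurable_realfun.
From mathcomp Require Import ring lra zify.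
Require Import Defs.

Set Implicit Arguments.
Unset Strict Implicit.
Unset Printing Implicit Defensive.

Import Order.TTheory GRing.Theory Num.Theory.
Import numFieldNormedType.Exports.

Local Open Scope classical_set_scope.
Local Open Scope card_scope.
Local Open Scope ring_scope.
Local Open Scope ereal_scope.

(** * Sums over locally finite random sets *)

(** Point-stationarity only tests functions of the configuration, whereas [w] and a covering are
    random markings known through their conditional laws. Every transport therefore integrates the
    marks out first, and equivariance of the laws makes what remains translation-invariant. No joint
    law of [w] and a covering is ever formed: the transport between them multiplies two conditional
    means. All exact identities on cubes rest on one change of variables for the uniform offset v:
    restrict to those v for which v + a is still in [0, 1)^k, and translate by a. It exchanges the
    roles of two points of a cell; summed over integer vectors, it shows that the law of the
    uniformly translated grid is invariant under all translations. The sigma-algebras are generated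
    by counts of points, so events and evaluations are made measurable by rewriting them as sums
    over the points. AM-GM is kept with a free parameter until after the integration, since the
    expectations of the theorem may be infinite; the optimal parameter is chosen only at the end. *)

Section esum_monotone.
Context {R : realType} {T : choiceType}.
Implicit Types (A B : set T) (a : T -> \bar R).

Lemma esum_ge_term A a x : A x -> a x <= \esum_(i in A) a i.
Proof.
move=> Ax; apply: esum_ge; exists [set x]; last by rewrite fsbig_set1.
by split=> // y ->.
Qed.

Lemma subset_esum A B a : A `<=` B -> (forall i, B i -> 0 <= a i) ->
  \esum_(i in A) a i <= \esum_(i in B) a i.
Proof.
move=> AB a0; rewrite esum_mkcond [leRHS]esum_mkcond; apply: le_esum => i _.
case: ifPn => [/set_mem /AB /mem_set -> //|_]; case: ifPn => // /set_mem; exact: a0.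
Qed.

End esum_monotone.

Section counting_measure.
Context {d : measure_display} {Y : measurableType d} {R : realType}.
Implicit Types (A B : set Y) (f : Y -> \bar R).

Definition points_of A : seq Y := enum_fset (fset_set A).

(** Sums over a finite set become integrals against Dirac masses, to which the theory of kernels
    applies. *)
Definition point_measure A : {measure set Y -> \bar R} :=
  msum (fun i => \d_(nth point (points_of A) i)) (size (points_of A)).

Lemma esum_points_of A f : finite_set A -> (forall y, 0 <= f y) ->
  \esum_(y in A) f y = \sum_(y <- points_of A) f y.
Proof. by move=> finA f0; rewrite esum_fset// fsbig_finite. Qed.

Lemma integral_point_measure A f : finite_set A -> (forall y, 0 <= f y) ->
  measurable_fun setT f -> \int[point_measure A]_y f y = \esum_(y in A) f y.
Proof.
move=> finA f0 mf; rewrite ge0_integral_measure_sum//.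
rewrite esum_points_of// (big_nth point) big_mkord; apply: eq_bigr => i _.
by rewrite integral_dirac// diracT mul1e.
Qed.

Lemma esum_indic A B : finite_set A ->
  \esum_(y in A) (\1_B y)%:E = (#|` fset_set (A `&` B)|%:R)%:E :> \bar R.
Proof.
move=> finA; rewrite (eq_esum (b := fun y => if y \in B then 1 else 0)); last first.
  by move=> y _; rewrite indicE; case: ifP.
rewrite -esum_mkcondr esum_fset//; last exact: finite_setIl.
rewrite fsbig_finite/=; last exact: finite_setIl.
by rewrite sumEFin big_const_seq count_predT iter_addr_0.
Qed.

Lemma point_measureE A B : finite_set A -> measurable B ->
  point_measure A B = (#|` fset_set (A `&` B)|%:R)%:E.
Proof.
move=> finA mB; rewrite -esum_indic// -integral_point_measure//.
- by rewrite integral_indic// setIT.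
- exact/measurable_EFinP/measurable_indic.
Qed.

End counting_measure.

Section measurable_esum.
Context {d d' : measure_display} {T : measurableType d} {Y : measurableType d'}.
Context {R : realType}.
Variables (C : T -> set Y) (E : nat -> set Y).
Hypothesis mE : forall n, measurable (E n).
Hypothesis Ecover : \bigcup_n E n = setT.
Hypothesis finC : forall t n, finite_set (C t `&` E n).
Hypothesis mC : forall B n, measurable B -> measurable [set t | C t `&` B #= `I_n].
Implicit Types (f : T * Y -> \bar R).

Let F n := seqDU E n.
Let mF n : measurable (F n).
Proof. by apply: measurableD => //; exact: bigsetU_measurable. Qed.
Let finCF t n : finite_set (C t `&` F n).
Proof. by apply: sub_finite_set (finC t n) => y [Cy Fy]; split=> //; exact: subset_seqDU Fy. Qed.

Lemma esum_seqDU t (a : Y -> \bar R) : (forall y, 0 <= a y) ->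
  \esum_(y in C t) a y = \sum_(n <oo) \esum_(y in C t `&` seqDU E n) a y.
Proof.
move=> a0; rewrite -nneseries_sum_bigcup//.
  by rewrite -setI_bigcupr -seqDU_bigcup_eq Ecover setIT.
by apply: trivIset_setIl; exact: trivIset_seqDU.
Qed.

Section piece.
Variables n j : nat.

(** Emptying the set off the event of exactly [j] points bounds the mass of [kpiece t] uniformly in
    [t]. This makes [kpiece] a finite kernel, whose integrals of jointly measurable functions are
    measurable in [t]. *)
Let S t : set Y := if `[< C t `&` F n #= `I_j >] then C t `&` F n else set0.

Let finS t : finite_set (S t). Proof. by rewrite /S; case: ifP. Qed.

Let kpiece (t : T) : {measure set Y -> \bar R} := point_measure (S t).

Let mkpiece (B : set Y) : measurable B -> measurable_fun setT (kpiece ^~ B).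
Proof.
move=> mB; pose D m := [set t | C t `&` F n #= `I_j] `&`
  [set t | C t `&` (F n `&` B) #= `I_m].
have mD m : measurable (D m).
  by apply: measurableI; apply: mC => //; exact: measurableI.
(* On [D m] the piece has [j] points, [m] of them in [B]; as [m <= j], the mass of [B] is a finite
   combination of indicators. *)
have -> : kpiece ^~ B =
    (fun t => \sum_(m < j.+1) ((m%:R * \1_(D m) t)%R)%:E).
  apply/funext => t; rewrite /kpiece point_measureE// /S.
  case: asboolP => [Ej|tj]; last first.
    rewrite set0I fset_set0 cardfs0 big1// => i _.
    by rewrite indicE memNset ?mulr0// => -[].
  have /card_fset_set jE := Ej.
  have [m Em] : exists m, C t `&` F n `&` B #= `I_m.
    by apply/finite_setP; exact: finite_setIl.
  have /card_fset_set mE' := Em.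
  have mj : (m < j.+1)%N.
    rewrite ltnS -mE' -jE fsubset_leq_card// -fset_set_sub//.
      exact: finite_setIl.
  rewrite mE' (bigD1 (Ordinal mj))//= big1 ?adde0.
    rewrite indicE mem_set ?mulr1//; by split => //; rewrite /= setIA.
  move=> i /eqP im; rewrite indicE memNset ?mulr0// => -[_] /=.
  rewrite setIA => /card_fset_set; rewrite mE' => /esym ji; apply: im.
  exact: val_inj.
apply: emeasurable_sum => m; apply/measurable_EFinP.
by apply: measurable_funM => //; exact: measurable_indic.
Qed.

HB.instance Definition _ := isKernel.Build _ _ _ _ _ kpiece mkpiece.

Let kpiece_uub : measure_fam_uub kpiece.
Proof.
exists j.+1%:R => t; rewrite /kpiece point_measureE// setIT lte_fin ltr_nat ltnS.
by rewrite /S; case: asboolP => [/card_fset_set ->//|_]; rewrite fset_set0 cardfs0.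
Qed.

HB.instance Definition _ := Kernel_isFinite.Build _ _ _ _ _ kpiece kpiece_uub.

Lemma measurable_esum_piece f : measurable_fun setT f -> (forall z, 0 <= f z) ->
  measurable_fun [set t | C t `&` seqDU E n #= `I_j]
    (fun t => \esum_(y in C t `&` seqDU E n) f (t, y)).
Proof.
move=> mf f0.
apply: (@eq_measurable_fun _ _ _ _ _ (fun t => \int[kpiece t]_y f (t, y))).
  move=> t /set_mem /= tj; rewrite /kpiece integral_point_measure//.
    by rewrite /S asboolT.
  by apply/measurableT_comp => //; exact: pair1_measurable.
apply: measurable_funTS.
exact: (measurable_fun_integral_finite_kernel f kpiece).
Qed.

End piece.

(** [Y] is cut into countably many pieces meeting each [C t] in finitely many points, and then [T]
    according to the number of these points; on each part a finite kernel is integrated. *)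
Lemma measurable_esum f : measurable_fun setT f -> (forall z, 0 <= f z) ->
  measurable_fun setT (fun t => \esum_(y in C t) f (t, y)).
Proof.
move=> mf f0.
rewrite [X in measurable_fun _ X](_ : _ = (fun t => \sum_(n <oo)
    \esum_(y in C t `&` seqDU E n) f (t, y))); last first.
  by apply/funext => t; rewrite esum_seqDU.
apply: ge0_emeasurable_sum => [k x _ _|k _]; first exact: esum_ge0.
have <- : \bigcup_j [set t | C t `&` seqDU E k #= `I_j] = setT.
  apply/seteqP; split=> // t _.
  by have /finite_setP[j tj] := finCF t k; exists j.
apply/measurable_fun_bigcup => [j|j]; first exact: mC.
exact: measurable_esum_piece.
Qed.

(** An [esum] is a supremum over all finite subsets, a family too large for monotone convergence.
    Along the pieces [E n] it becomes a series of finite sums, and these commute with the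
    integral. *)
Lemma integral_esum {dZ} {Z : measurableType dZ} (mu : {measure set Z -> \bar R})
    t (a : Z -> Y -> \bar R) :
  (forall y, measurable_fun setT (a ^~ y)) -> (forall z y, 0 <= a z y) ->
  \int[mu]_z (\esum_(y in C t) a z y) = \esum_(y in C t) \int[mu]_z a z y.
Proof.
move=> ma a0; under eq_integral do rewrite esum_seqDU//.
have ae0 n z : 0 <= \esum_(y in C t `&` seqDU E n) a z y by exact: esum_ge0.
rewrite esum_seqDU; last by move=> y; exact: integral_ge0.
rewrite integral_nneseries//; last first.
  move=> n; rewrite [X in measurable_fun _ X](_ : _ =
    (fun z => \sum_(y <- points_of (C t `&` seqDU E n)) a z y)).
    exact: emeasurable_sum.
  by apply/funext => z; rewrite esum_points_of//; exact: finCF.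
apply: eq_eseriesr => n _; rewrite esum_points_of; last 2 first.
- exact: finCF.
- by move=> y; exact: integral_ge0.
under eq_integral do rewrite esum_points_of//=; try exact: finCF.
by rewrite ge0_integral_sum.
Qed.

End measurable_esum.

(** * Measurability of configurations and markings *)

Section rows.
Context {R : realType} {k : nat}.
Local Notation V := 'rV[R]_k.

Lemma measurable_coord (i : 'I_k) : measurable_fun setT (fun x : V => x ord0 i).
Proof.
move=> _ B mB; rewrite setTI; apply: sub_sigma_algebra.
by exists i, B.
Qed.

Lemma measurable_row {d} {T : measurableType d} (D : set T) (f : T -> V) :
  (forall i, measurable_fun D (fun t => f t ord0 i)) -> measurable_fun D f.
Proof.
move=> mf mD; apply: (measurability (@coordinate_sets R k)) => //.
move=> _ [_ [i [B [mB ->]] <-]].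
exact: mf.
Qed.

Lemma measurable_rowD {d} {T : measurableType d} (D : set T) (f g : T -> V) :
  measurable_fun D f -> measurable_fun D g ->
  measurable_fun D (fun t => f t + g t)%R.
Proof.
move=> mf mg; apply: measurable_row => i.
rewrite [X in measurable_fun _ X](_ : _ = (fun t => f t ord0 i + g t ord0 i)%R).
  by apply: measurable_funD; exact: (measurableT_comp (measurable_coord i)).
by apply/funext => t; rewrite mxE.
Qed.

Lemma measurable_rowN {d} {T : measurableType d} (D : set T) (f : T -> V) :
  measurable_fun D f -> measurable_fun D (fun t => - f t)%R.
Proof.
move=> mf; apply: measurable_row => i.
rewrite [X in measurable_fun _ X](_ : _ = (fun t => - f t ord0 i)%R).
  apply: measurableT_comp => //; exact: (measurableT_comp (measurable_coord i)).
by apply/funext => t; rewrite mxE.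
Qed.

Lemma measurable_rowB {d} {T : measurableType d} (D : set T) (f g : T -> V) :
  measurable_fun D f -> measurable_fun D g ->
  measurable_fun D (fun t => f t - g t)%R.
Proof. by move=> mf mg; apply: measurable_rowD => //; exact: measurable_rowN. Qed.

Lemma measurable_forall_ord {d} {T : measurableType d} n (P : 'I_n -> set T) :
  (forall i, measurable (P i)) -> measurable [set t | forall i, P i t].
Proof.
move=> mP; rewrite (_ : [set t | _] = \bigcap_(i in [set: 'I_n]) P i).
  by apply: fin_bigcap_measurable => // i _; exact: mP.
by apply/seteqP; split=> [t Pt i _|t Pt i]; exact: Pt.
Qed.

Lemma measurable_eq_row {d} {T : measurableType d} (f g : T -> V) :
  measurable_fun setT f -> measurable_fun setT g ->
  measurable [set t | f t = g t].
Proof.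
move=> mf mg.
rewrite (_ : [set t | _] = [set t | forall i, f t ord0 i = g t ord0 i]).
  apply: measurable_forall_ord => i.
  rewrite [X in measurable X](_ : _ = (fun t => f t ord0 i == g t ord0 i) @^-1` [set true]).
    rewrite -[X in measurable X]setTI.
    apply: (@measurable_fun_eqr _ _ _ setT (fun t => f t ord0 i) (fun t => g t ord0 i)) => //;
      exact: (measurableT_comp (measurable_coord i)).
  by apply/seteqP; split=> t /=; [move=> ->; rewrite eqxx|move=> /eqP].
by apply/seteqP; split=> t /= => [->//|fg]; apply/rowP.
Qed.

(** Given by coordinates, hence measurable for the coordinate sigma-algebra, and bounded, hence
    finite on configurations: these are the pieces that exhaust the space. *)
Definition box (r : R) : set V := [set x | forall i, (`|x ord0 i| <= r)%R].

Lemma measurable_box (r : R) : measurable (box r).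
Proof.
apply: measurable_forall_ord => i.
rewrite [X in measurable X](_ : _ = (fun x : V => x ord0 i) @^-1` `[(- r)%R, r]).
  by rewrite -[X in measurable X]setTI; exact: measurable_coord.
by apply/seteqP; split=> x /=; rewrite in_itv/= ler_norml.
Qed.

Lemma bounded_box (r : R) : bounded_set (box r).
Proof.
exists (Num.max r 0%R); split => [|M rM x bx]; first by rewrite num_real.
rewrite /= /Num.norm/= mx_normrE; apply/bigmax_leP; split => [|[j i] _ /=].
  by apply: le_trans (ltW rM); rewrite le_max lexx orbT.
by rewrite [j]ord1 (le_trans (bx i))// (le_trans _ (ltW rM))// le_max lexx.
Qed.

Lemma bigcup_box : \bigcup_n box n%:R = setT.
Proof.
apply/seteqP; split => // x _.
exists (Num.truncn (\sum_i `|x ord0 i|)%R).+1 => // i.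
apply: (@le_trans _ _ (\sum_i `|x ord0 i|)%R).
  by rewrite (bigD1 i)//= lerDl sumr_ge0.
by rewrite ltW// truncnS_gt.
Qed.

Lemma finite_config_box (phi : config R k) (r : R) : finite_set (phi `&` box r).
Proof. by case: phi => A lfA /=; apply: lfA; exact: bounded_box. Qed.

End rows.

Section config_sums.
Context {R : realType} {k : nat}.
Local Notation V := 'rV[R]_k.
Implicit Types phi : config R k.

Lemma measurable_config_count (B : set V) n : measurable B ->
  measurable [set phi : config R k | phi `&` B #= `I_n].
Proof. by move=> mB; apply: sub_sigma_algebra; exists B, n. Qed.

Lemma measurable_esum_config {d} {T : measurableType d} (Phi : T -> config R k)
    (f : T * V -> \bar R) :
  measurable_fun setT Phi -> measurable_fun setT f -> (forall z, 0 <= f z) ->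
  measurable_fun setT (fun t => \esum_(x in Phi t) f (t, x)).
Proof.
move=> mPhi mf f0; apply: (measurable_esum (E := fun n => box n%:R)) => //.
- by move=> n; exact: measurable_box.
- exact: bigcup_box.
- by move=> t n; exact: finite_config_box.
- move=> B n mB; rewrite -[X in measurable X]setTI.
  exact: (mPhi measurableT _ (measurable_config_count n mB)).
Qed.

Lemma integral_esum_config {d} {T : measurableType d} (mu : {measure set T -> \bar R})
    phi (a : T -> V -> \bar R) :
  (forall x, measurable_fun setT (a ^~ x)) -> (forall t x, 0 <= a t x) ->
  \int[mu]_t (\esum_(x in phi) a t x) = \esum_(x in phi) \int[mu]_t a t x.
Proof.
apply: (integral_esum (C := fun _ : unit => points phi) (E := fun n => box n%:R) _ _ mu tt) => //.
- exact: bigcup_box.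
- by move=> _ n; exact: finite_config_box.
Qed.

(** The existential ranges over uncountably many [x]; it is recovered as the positivity of the sum
    of the indicator of [D] over the points. *)
Lemma measurable_exists_point {d} {T : measurableType d} (Phi : T -> config R k)
    (D : set (T * V)) :
  measurable_fun setT Phi -> measurable D ->
  measurable [set t | exists x, points (Phi t) x /\ D (t, x)].
Proof.
move=> mPhi mD; rewrite [X in measurable X](_ : _ =
   [set t | 0 < \esum_(x in Phi t) (\1_D (t, x))%:E :> \bar R]).
  rewrite -[X in measurable X]setTI; apply: emeasurable_fun_o_infty => //.
  apply: (measurable_esum_config (f := fun z => (\1_D z)%:E)) => //.
  exact/measurable_EFinP/measurable_indic.
apply/seteqP; split=> t /=.
  move=> [x [px Dx]]; apply: (@lt_le_trans _ _ 1) => //.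
  apply: le_trans (esum_ge_term (fun x => (\1_D (t, x))%:E) px).
  by rewrite indicE mem_set.
apply: contraPP => Pt; rewrite esum1 ?ltxx// => x Px.
by rewrite indicE memNset// => Dx; apply: Pt; exists x.
Qed.

Lemma measurable_points {d} {T : measurableType d} (Phi : T -> config R k) (f : T -> V) :
  measurable_fun setT Phi -> measurable_fun setT f ->
  measurable [set t | points (Phi t) (f t)].
Proof.
move=> mPhi mf; pose D := [set p : T * V | f p.1 = p.2].
have mD : measurable D.
  by apply: measurable_eq_row => //; exact: measurableT_comp.
rewrite (_ : [set t | _] = [set t | exists x, points (Phi t) x /\ D (t, x)]).
  exact: measurable_exists_point.
by apply/seteqP; split => t /= => [pt|[x [px ->]]//]; exists (f t).
Qed.

End config_sums.

Section mconfig_sums.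
Context {R : realType} {k : nat} {d : measure_display} {Xi : measurableType d}.
Local Notation V := 'rV[R]_k.
Implicit Types m : mconfig R k Xi.

Definition pairs m : set (V * V) := [set p | points (base m) p.1 /\ points (base m) p.2].

(** The counts that generate the sigma-algebra of [mconfig] are the counts of this set, so a marking
    can be treated as a random set in the space of marked pairs and [measurable_esum] applies to
    it. *)
Definition marked_pairs m : set (V * V * Xi) :=
  (fun p => (p, mark m p.1 p.2)) @` pairs m.

Lemma marked_pairs_card m (B : set (V * V * Xi)) n :
  (marked_pairs m `&` B #= `I_n) =
  ([set p : V * V | [/\ points (base m) p.1, points (base m) p.2 &
     B (p, mark m p.1 p.2)]] #= `I_n).
Proof.
apply: card_eql; rewrite (_ : marked_pairs m `&` B =
  (fun p => (p, mark m p.1 p.2)) @` [set p : V * V | [/\ points (base m) p.1,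
     points (base m) p.2 & B (p, mark m p.1 p.2)]]).
  by apply: inj_card_eq => p q _ _ [].
apply/seteqP; split => [_ [[p [p1 p2] <-] Bp]|_ [p [p1 p2 Bp] <-]].
  by exists p.
by split=> //; exists p.
Qed.

Lemma measurable_mconfig_count (B : set (V * V * Xi)) n : measurable B ->
  measurable [set m : mconfig R k Xi | marked_pairs m `&` B #= `I_n].
Proof.
move=> mB; apply: sub_sigma_algebra; exists B, n; split => //.
by apply/funext => m /=; rewrite marked_pairs_card.
Qed.

Lemma measurable_fun_mconfig {dT} {T : measurableType dT} (D : set T)
    (f : T -> mconfig R k Xi) :
  measurable D ->
  (forall B n, measurable B ->
    measurable (D `&` [set t | marked_pairs (f t) `&` B #= `I_n])) ->
  measurable_fun D f.
Proof.
move=> mD mf; apply: (measurability (@marked_counting_sets R k d Xi)) => //.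
move=> _ [_ [B [n [mB ->]] <-]]; rewrite (_ : _ @^-1` _ =
  [set t | marked_pairs (f t) `&` B #= `I_n]); first exact: mf.
by apply/funext => t /=; rewrite marked_pairs_card.
Qed.

Lemma esum_marked_pairs m (a : V * V * Xi -> \bar R) :
  \esum_(y in marked_pairs m) a y = \esum_(p in pairs m) a (p, mark m p.1 p.2).
Proof.
apply: (reindex_esum _ _ (fun p => (p, mark m p.1 p.2))); split => //.
- by move=> p mp /=; exists p.
- by move=> p q _ _ [].
Qed.

Lemma measurable_esum_pairs {dT} {T : measurableType dT} (M : T -> mconfig R k Xi)
    (f : T * (V * V * Xi) -> \bar R) :
  measurable_fun setT M -> measurable_fun setT f -> (forall z, 0 <= f z) ->
  measurable_fun setT
    (fun t => \esum_(p in pairs (M t)) f (t, (p, mark (M t) p.1 p.2))).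
Proof.
move=> mM mf f0; under eq_fun do
  rewrite -(esum_marked_pairs _ (fun y => f (_, y))).
apply: (measurable_esum (E := fun n => [set y | box n%:R y.1.1 /\ box n%:R y.1.2])) => //.
- move=> n; apply: measurableI; rewrite -[X in measurable X]setTI.
    by apply: (measurableT_comp measurable_fst measurable_fst) => //; exact: measurable_box.
  by apply: (measurableT_comp measurable_snd measurable_fst) => //; exact: measurable_box.
- apply/seteqP; split=> // -[[x y] z] _.
  have : setT x by []. rewrite -bigcup_box => -[n _ bx].
  have : setT y by []. rewrite -bigcup_box => -[n' _ bx'].
  exists (maxn n n') => //; split=> /= i.
    by apply: le_trans (bx i) _; rewrite ler_nat leq_maxl.
  by apply: le_trans (bx' i) _; rewrite ler_nat leq_maxr.
- move=> t n; set b := base (M t).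
  have fb := finite_setX (finite_config_box b n%:R) (finite_config_box b n%:R).
  apply: sub_finite_set (finite_image (fun p => (p, mark (M t) p.1 p.2)) fb).
  by move=> _ [[p [p1 p2] <-] /= [b1 b2]]; exists p => //; split.
- move=> B n mB; rewrite -[X in measurable X]setTI.
  exact: (mM measurableT _ (measurable_mconfig_count n mB)).
Qed.

(** The mark of a point is that of a diagonal pair, so a sum over points is a sum over pairs
    weighted by the indicator of the diagonal. *)
Lemma measurable_esum_pmark {dT} {T : measurableType dT} (M : T -> mconfig R k Xi)
    (f : T * V * Xi -> \bar R) :
  measurable_fun setT M -> measurable_fun setT f -> (forall z, 0 <= f z) ->
  measurable_fun setT
    (fun t => \esum_(x in base (M t)) f (t, x, pmark (M t) x)).
Proof.
move=> mM mf f0; pose D := [set y : V * V * Xi | y.1.1 = y.1.2].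
have mD : measurable D.
  apply: measurable_eq_row => //; apply: measurableT_comp => //.
pose g (z : T * (V * V * Xi)) := (\1_D z.2)%:E * f (z.1, z.2.1.1, z.2.2).
have -> : (fun t => \esum_(x in base (M t)) f (t, x, pmark (M t) x)) =
    (fun t => \esum_(p in pairs (M t)) g (t, (p, mark (M t) p.1 p.2))).
  apply/funext => t.
  transitivity (\esum_(p in pairs (M t) `&` [set p | p.1 = p.2])
     f (t, p.1, mark (M t) p.1 p.2)).
    apply/esym; apply: (reindex_esum _ _ (fun x : V => (x, x))); split => //.
    - by move=> x y _ _ [].
    - by move=> [x y] [/= [xM yM] <-]; exists x.
  rewrite esum_mkcondr; apply: eq_esum => p _; rewrite /g indicE /=.
  have -> : ((p, mark (M t) p.1 p.2) \in D) = (p \in [set p | p.1 = p.2]).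
    by apply/idP/idP; rewrite !inE.
  by case: ifP => _; rewrite ?mul1e ?mul0e.
apply: measurable_esum_pairs => //.
  apply: emeasurable_funM.
    apply/measurable_EFinP; apply: (measurableT_comp (measurable_indic _)) => //.
  apply: measurableT_comp => //.
  apply: measurable_fun_pair; last exact: measurableT_comp.
  by apply: measurable_fun_pair => //; do 2 (apply: measurableT_comp => //).
by move=> z; rewrite /g mule_ge0// lee_fin.
Qed.

(** Points of the base in [B] are counted by the diagonal pairs with entry in [B], whatever their
    marks. *)
Lemma measurable_base : measurable_fun setT (@base R k d Xi).
Proof.
apply: (measurability (@counting_sets R k)) => //.
move=> _ [_ [B [n [mB ->]] <-]]; rewrite setTI.
pose B' := [set y : V * V * Xi | y.1.1 = y.1.2] `&` [set y | B y.1.1].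
have mB' : measurable B'.
  apply: measurableI.
    by apply: measurable_eq_row => //; apply: measurableT_comp.
  rewrite -[X in measurable X]setTI.
  by apply: (measurableT_comp (measurable_fst) (measurable_fst)).
rewrite (_ : _ @^-1` _ = [set m | marked_pairs m `&` B' #= `I_n]).
  exact: measurable_mconfig_count.
apply/funext => m /=; apply/esym; congr (is_true _).
apply: card_eql; rewrite (_ : marked_pairs m `&` B' =
    (fun x : V => (x, x, pmark m x)) @` (base m `&` B)).
  by apply: inj_card_eq => p q _ _ [].
apply/seteqP; split => [_ [[[x y] [xm ym] <-] /= [/= xy Bx]]|_ [x [xm Bx] <-]].
  by exists x => //; rewrite /pmark -xy.
by split=> //; exists (x, x).
Qed.

End mconfig_sums.

(** * Translations of configurations and markings *)

Section shifts.
Context {R : realType} {k : nat}.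
Local Notation V := 'rV[R]_k.

Lemma config_eq (phi psi : config R k) : points phi = points psi -> phi = psi.
Proof.
case: phi psi => [A lA] [B lB] /= AB; move: lA; rewrite AB => lA.
by congr Config; exact: Prop_irrelevance.
Qed.

Lemma shift_configK t (phi : config R k) : shift_config (- t) (shift_config t phi) = phi.
Proof. by apply: config_eq; apply/funext => x /=; rewrite opprK addrK. Qed.

Lemma points_shift t (phi : config R k) x :
  points (shift_config t phi) (x + t)%R = points phi x.
Proof. by rewrite /= addrK. Qed.

Lemma esum_shift_config t (phi : config R k) (a : V -> \bar R) :
  \esum_(x in shift_config t phi) a x = \esum_(x in phi) a (x + t)%R.
Proof.
apply: (reindex_esum _ _ (fun x => x + t)%R); split.
- by move=> x px; rewrite points_shift.
- by move=> x y _ _ /addIr.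
- by move=> x px; exists (x - t)%R => //; rewrite subrK.
Qed.

Context {d : measure_display} {Xi : measurableType d}.

Lemma pmark_shift t (m : mconfig R k Xi) x : pmark (shift_mconfig t m) (x + t)%R = pmark m x.
Proof. by rewrite /pmark/= addrK. Qed.

Lemma measurable_shift_mconfig t :
  measurable_fun setT (shift_mconfig t : mconfig R k Xi -> mconfig R k Xi).
Proof.
apply: measurable_fun_mconfig => // B n mB; rewrite setTI.
pose h (y : V * V * Xi) := ((y.1.1 + t)%R, (y.1.2 + t)%R, y.2).
have mh : measurable_fun setT h.
  apply: measurable_fun_pair => //; apply: measurable_fun_pair;
  by apply: measurable_rowD => //; apply: measurableT_comp.
rewrite (_ : [set m | _] = [set m | marked_pairs m `&` h @^-1` B #= `I_n]).
  by apply: measurable_mconfig_count; rewrite -[X in measurable X]setTI; exact: mh.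
apply/funext => m /=; congr (is_true _); apply: card_eql.
rewrite (_ : _ `&` B = h @` (marked_pairs m `&` h @^-1` B)).
  apply: inj_card_eq => -[[x y] z] [[x' y'] z'] _ _ [].
  by move=> /addIr -> /addIr -> ->.
apply/seteqP; split => [_ [[[x y] [/= xm ym] <-] /= Bx]|_ [_ [[[x y] [/= xm ym] <-] Bx] <-]].
  exists (x - t, y - t, mark m (x - t) (y - t))%R; last by rewrite /h/= !subrK.
  split; first by exists (x - t, y - t)%R.
  by rewrite /= /h/= !subrK.
split => //; exists (x + t, y + t)%R => /=; last by rewrite !addrK.
by rewrite /pairs/= !addrK.
Qed.

End shifts.

(** * Translations of the uniform point of the cube *)

Section lebesgue_translation.
Context {R : realType}.
Implicit Types (H : measurableTypeR R -> \bar R) (a : R).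
Local Notation mu := (@lebesgue_measure R).

Lemma lebesgue_measure_translation a (A : set R) : measurable A ->
  pushforward mu (fun x : measurableTypeR R => x + a : measurableTypeR R)%R A = mu A.
Proof.
move=> mA; apply/esym/lebesgue_measure_unique => //=; first exact: measurable_funD.
move=> mt _ [[x y]] _ <-; rewrite /pushforward.
rewrite (_ : _ @^-1` _ = [set` `](x - a)%R, (y - a)%R]]).
  by rewrite !lebesgue_measure_itv/= !lte_fin ltrD2r -!EFinD opprB addrA addrNK.
by apply/seteqP; split => z /=; rewrite !in_itv/= ltrBlDr lerBrDr.
Qed.

Lemma integral_translation a H : measurable_fun setT H -> (forall x, 0 <= H x) ->
  \int[mu]_x H (x + a)%R = \int[mu]_x H x.
Proof.
move=> mH H0; have mt : measurable_fun setT
  (fun x : measurableTypeR R => x + a : measurableTypeR R)%R by exact: measurable_funD.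
rewrite -[LHS]/(\int[mu]_(x in (fun x : measurableTypeR R => x + a)%R @^-1` setT)
  (H \o (fun x : measurableTypeR R => x + a)%R) x).
rewrite -(ge0_integral_pushforward mt)//.
by apply: eq_measure_integral => A mA _; exact: lebesgue_measure_translation.
Qed.

(** Half-open, unlike the interval of [uniform_prob]: the integer translates of [0, 1) partition the
    line, as [sum_unit_indic] requires. *)
Definition unit_indic a : \bar R := (\1_([set` `[0%R, 1%R[] : set R) a)%:E.

Lemma unit_indic_ge0 a : 0 <= unit_indic a. Proof. by rewrite lee_fin. Qed.

Lemma measurable_unit_indic {d} {T : measurableType d} (f : T -> R) :
  measurable_fun setT f -> measurable_fun setT (unit_indic \o f).
Proof.
by move=> mf; apply/measurable_EFinP; apply: measurableT_comp => //; exact: measurable_indic.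
Qed.

Lemma integral_uniform01 H : measurable_fun setT H -> (forall x, 0 <= H x) ->
  \int[uniform_prob (@ltr01 R)]_x H x = \int[mu]_x (H x * unit_indic x).
Proof.
move=> mH H0; rewrite integral_uniform// subr0 invr1 mul1e.
rewrite -integral_itv_bndo_bndc; last exact: measurable_funTS.
rewrite integral_mkcond; apply: eq_integral => x _.
by rewrite patchE /unit_indic indicE; case: ifP => _; rewrite ?mule1 ?mule0.
Qed.

(** Both sides are the Lebesgue integral of [H] over the x such that x and x + a lie in [0, 1); the
    right side takes x + a as its variable. *)
Lemma integral_uniform_transfer a H : measurable_fun setT H -> (forall x, 0 <= H x) ->
  \int[uniform_prob (@ltr01 R)]_x (H x * unit_indic (x + a)%R) =
  \int[uniform_prob (@ltr01 R)]_x (H (x - a)%R * unit_indic (x - a)%R).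
Proof.
move=> mH H0.
have mtr b : measurable_fun setT (fun x : measurableTypeR R => x + b : measurableTypeR R)%R.
  exact: measurable_funD.
have mu1 b : measurable_fun setT (fun x : measurableTypeR R => unit_indic (x + b)%R).
  exact: (measurable_unit_indic (mtr b)).
have u0 (b x : R) : 0 <= H x * unit_indic b by rewrite mule_ge0// unit_indic_ge0.
have m1 : measurable_fun setT (fun x : measurableTypeR R => H x * unit_indic (x + a)%R).
  exact: emeasurable_funM.
have m2 : measurable_fun setT
    (fun x : measurableTypeR R => H (x - a)%R * unit_indic (x - a)%R).
  by apply: emeasurable_funM => //; apply: (measurableT_comp mH (mtr (- a)%R)).
rewrite (integral_uniform01 m1 (fun x => u0 _ x)).
rewrite (integral_uniform01 m2 (fun x => u0 _ _)).
rewrite -[RHS](integral_translation a).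
- by apply: eq_integral => x _; rewrite addrK muleAC.
- apply: emeasurable_funM => //.
  by have := mu1 0%R; under eq_fun do rewrite addr0.
- by move=> x; rewrite mule_ge0// unit_indic_ge0.
Qed.

End lebesgue_translation.

Section uniform_cube_transfer.
Context {R : realType}.
Local Notation U := (measurableTypeR R).

Lemma integral_uniform_cubeS n (F : n.+1.-tuple U -> \bar R) :
  measurable_fun setT F -> (forall v, 0 <= F v) ->
  \int[uniform_cube n.+1]_v F v =
  \int[uniform_prob (@ltr01 R)]_t \int[uniform_cube n]_v F [the _.-tuple _ of t :: v].
Proof.
move=> mF F0; rewrite /= ge0_integral_distribution// fubini_tonelli1//.
  by apply: measurableT_comp => //; exact: measurable_cons_pair.
by move=> z; exact: F0.
Qed.

Definition cube_indic n (a : 'I_n -> R) (v : n.-tuple U) : \bar R :=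
  (\prod_(i < n) \1_([set` `[0%R, 1%R[] : set R) (tnth v i + a i))%R%:E.

Definition shift_tuple n (a : 'I_n -> R) (v : n.-tuple U) : n.-tuple U :=
  [tuple (tnth v i + a i)%R | i < n].

Lemma measurable_shift_tuple n (a : 'I_n -> R) : measurable_fun setT (shift_tuple a).
Proof.
apply/measurable_fun_tnthP => i.
rewrite (_ : _ \o _ = fun v => tnth v i + a i)%R; last first.
  by apply/funext => v; rewrite /= tnth_mktuple.
by apply: measurable_funD => //; exact: measurable_tnth.
Qed.

Lemma cube_indic_ge0 n (a : 'I_n -> R) v : 0 <= cube_indic a v.
Proof. by rewrite lee_fin prodr_ge0. Qed.

Lemma measurable_cube_indic n (a : 'I_n -> R) : measurable_fun setT (cube_indic a).
Proof.
apply/measurable_EFinP; apply: measurable_prod => i _.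
apply: (measurableT_comp (measurable_indic _)) => //.
by apply: measurable_funD => //; exact: measurable_tnth.
Qed.

Lemma cube_indicS n (a : 'I_n.+1 -> R) t (v : n.-tuple U) :
  cube_indic a [the _.-tuple _ of t :: v] =
  unit_indic (t + a ord0)%R * cube_indic (fun i => a (lift ord0 i)) v.
Proof.
rewrite /cube_indic big_ord_recl tnth0 EFinM; congr (_ * _%:E).
by apply: eq_bigr => i _; rewrite tnthS.
Qed.

Lemma shift_tupleS n (a : 'I_n.+1 -> R) t (v : n.-tuple U) :
  shift_tuple a [the _.-tuple _ of t :: v] =
  [the _.-tuple _ of (t + a ord0)%R :: shift_tuple (fun i => a (lift ord0 i)) v].
Proof.
apply: eq_from_tnth => i; rewrite tnth_mktuple.
case: (unliftP ord0 i) => [j ->|->]; last by rewrite !tnth0.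
by rewrite !tnthS tnth_mktuple.
Qed.

(** The one-dimensional transfer, coordinate by coordinate. The exchange of two points of a cell and
    the invariance under translations of periodic functions are both drawn from it. *)
Lemma integral_cube_transfer n (a : 'I_n -> R) (G : n.-tuple U -> \bar R) :
  measurable_fun setT G -> (forall v, 0 <= G v) ->
  \int[uniform_cube n]_v (G v * cube_indic a v) =
  \int[uniform_cube n]_v
    (G (shift_tuple (fun i => - a i)%R v) * cube_indic (fun i => - a i)%R v).
Proof.
elim: n a G => [a G mG G0|n IH a G mG G0].
  apply: eq_integral => v _; rewrite /cube_indic !big_ord0.
  by congr (G _ * _); rewrite (tuple0 v); apply/esym/tuple0.
have mI b : measurable_fun setT (@cube_indic n.+1 b) by exact: measurable_cube_indic.
pose a0 := a ord0; pose b i := a (lift ord0 i).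
have mcons t : measurable_fun setT
    (fun v : n.-tuple U => [the n.+1.-tuple _ of (t : U) :: v]).
  exact: measurable_cons.
have mGt t : measurable_fun setT (fun v : n.-tuple U => G [the _.-tuple _ of (t : U) :: v]).
  exact: measurableT_comp.
rewrite integral_uniform_cubeS; last 2 first.
- exact: emeasurable_funM.
- by move=> v; rewrite mule_ge0// cube_indic_ge0.
rewrite integral_uniform_cubeS; last 2 first.
- by apply: emeasurable_funM => //; apply: measurableT_comp => //; exact: measurable_shift_tuple.
- by move=> v; rewrite mule_ge0// cube_indic_ge0.
(* The inner integral once the induction hypothesis has moved the last n coordinates; only the first
   one is still to be transferred. *)
pose H (t : U) := \int[uniform_cube n]_v
  (G [the _.-tuple _ of t :: shift_tuple (fun i => - b i)%R v] *
   cube_indic (fun i => - b i)%R v).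
transitivity (\int[uniform_prob (@ltr01 R)]_t (H t * unit_indic (t + a0)%R)).
  apply: eq_integral => t _; under eq_integral do rewrite cube_indicS muleCA.
  rewrite ge0_integralZl//; last 3 first.
  - by apply: emeasurable_funM => //; exact: measurable_cube_indic.
  - by move=> v _; rewrite mule_ge0// cube_indic_ge0.
  - exact: unit_indic_ge0.
  by rewrite muleC (IH b).
have H0 t : 0 <= H t.
  by apply: integral_ge0 => v _; rewrite mule_ge0// cube_indic_ge0.
rewrite integral_uniform_transfer//.
  apply: eq_integral => t _; under [RHS]eq_integral do
    rewrite shift_tupleS cube_indicS muleCA.
  rewrite ge0_integralZl//; last 3 first.
  - apply: emeasurable_funM; last exact: measurable_cube_indic.
    exact: (measurableT_comp (mGt _) (measurable_shift_tuple _)).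
  - by move=> v _; rewrite mule_ge0// cube_indic_ge0.
  - exact: unit_indic_ge0.
  by rewrite muleC.
pose F (z : U * n.-tuple U) := G [the _.-tuple _ of z.1 :: shift_tuple (fun i => - b i)%R z.2] *
   cube_indic (fun i => - b i)%R z.2.
apply: (measurable_fun_fubini_tonelli_F F) => [|z].
  apply: emeasurable_funM; last first.
    by apply: measurableT_comp => //; exact: measurable_cube_indic.
  apply: measurableT_comp => //; apply: measurable_cons => //.
  by apply: measurableT_comp => //; exact: measurable_shift_tuple.
by rewrite mule_ge0// cube_indic_ge0.
Qed.

Lemma integral_uniform_unit (H : U -> \bar R) :
  measurable_fun setT H -> (forall x, 0 <= H x) ->
  \int[uniform_prob (@ltr01 R)]_x (H x * unit_indic x) =
  \int[uniform_prob (@ltr01 R)]_x H x.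
Proof.
move=> mH H0; have mu1 : measurable_fun setT (fun x : U => unit_indic x).
  exact: (measurable_unit_indic (f := fun x : U => (x : R))).
have m1 : measurable_fun setT (fun x : U => H x * unit_indic x) by exact: emeasurable_funM.
rewrite (integral_uniform01 m1) => [|x]; last by rewrite mule_ge0// unit_indic_ge0.
rewrite integral_uniform01//; apply: eq_integral => x _.
by rewrite -muleA /unit_indic indicE; case: (x \in _); rewrite ?mule1// !mule0.
Qed.

Lemma integral_cube_unit n (F : n.-tuple U -> \bar R) :
  measurable_fun setT F -> (forall v, 0 <= F v) ->
  \int[uniform_cube n]_v (F v * cube_indic (fun=> 0%R) v) = \int[uniform_cube n]_v F v.
Proof.
elim: n F => [F mF F0|n IH F mF F0].
  by apply: eq_integral => v _; rewrite /cube_indic big_ord0 mule1.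
have mI m : measurable_fun setT (@cube_indic m (fun=> 0%R)) by exact: measurable_cube_indic.
have mFt t : measurable_fun setT (fun v : n.-tuple U => F [the _.-tuple _ of (t : U) :: v]).
  by apply: measurableT_comp => //; exact: measurable_cons.
rewrite (integral_uniform_cubeS (emeasurable_funM mF (mI _))); last first.
  by move=> v; rewrite mule_ge0// cube_indic_ge0.
rewrite integral_uniform_cubeS// -[RHS]integral_uniform_unit.
- apply: eq_integral => t _; under eq_integral do rewrite cube_indicS addr0 muleCA.
  rewrite ge0_integralZl//.
  + by rewrite muleC (IH _ (mFt t)).
  + exact: (emeasurable_funM (mFt t) (mI n)).
  + by move=> v _; rewrite mule_ge0// cube_indic_ge0.
  + exact: unit_indic_ge0.
- apply: (measurable_fun_fubini_tonelli_F (fun z : U * n.-tuple U =>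
    F [the _.-tuple _ of z.1 :: z.2])) => [|z]; last exact: F0.
  by apply: measurableT_comp => //; exact: measurable_cons_pair.
- by move=> t; apply: integral_ge0 => v _; exact: F0.
Qed.

(** The faces missing from the half-open cube are null. Identities such as [corner_unit0] and
    [share0_unit] hold on the half-open cube only. *)
Lemma eq_integral_cube n (F G : n.-tuple U -> \bar R) :
  measurable_fun setT F -> (forall v, 0 <= F v) ->
  measurable_fun setT G -> (forall v, 0 <= G v) ->
  (forall v : n.-tuple U, (forall i, 0 <= (tnth v i : R) < 1)%R -> F v = G v) ->
  \int[uniform_cube n]_v F v = \int[uniform_cube n]_v G v.
Proof.
move=> mF F0 mG G0 FG; rewrite -integral_cube_unit// -[RHS]integral_cube_unit//.
apply: eq_integral => v _.
have [vI|/existsNP[i vi]] := pselect (forall i, 0 <= tnth v i < 1)%R; first by rewrite FG.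
have -> : cube_indic (fun=> 0%R) v = 0; last by rewrite !mule0.
rewrite /cube_indic (bigD1 i)//= indicE memNset ?mul0r//= in_itv/= addr0.
exact: vi.
Qed.

Lemma sum_unit_indic N (x : R) : (`|x| <= N%:R)%R ->
  (\sum_(j < N.*2.+1) \1_([set` `[0%R, 1%R[] : set R) (x + (j%:R - N%:R)) = 1 :> R)%R.
Proof.
rewrite ler_norml => /andP[Nx xN].
have Nz : (N%:R = N%:Z%:~R :> R)%R by rewrite pmulrn.
have flx1 : (Num.floor x <= N)%R.
  by rewrite -(ler_int R) -Nz; apply: le_trans xN; exact: floor_le.
have flx2 : (- N%:Z <= Num.floor x)%R by rewrite floor_ge_int rmorphN/= -Nz.
(* The translate of x that lands in [0, 1) is x minus its floor, so j - N has to be minus the floor;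
   the bound on x keeps j in range. *)
have [j jE] : exists j : nat, (j%:Z = N%:Z - Num.floor x)%R.
  by exists `|N%:Z - Num.floor x|%N; rewrite gez0_abs// subr_ge0.
have jN : (j < N.*2.+1)%N.
  by rewrite ltnS -lez_nat jE -addnn PoszD lerD2l lerNl.
have jR : (j%:R = N%:R - (Num.floor x)%:~R :> R)%R.
  by rewrite -[LHS]/((Posz j)%:~R) jE rmorphB /= -Nz.
rewrite (bigD1 (Ordinal jN))//= big1 ?addr0 => [|i /eqP ij].
  rewrite indicE mem_set//= in_itv/= jR addrAC subrr add0r subr_ge0 ltrBlDl.
  by rewrite floor_le/= -intrD1 floorD1_gt.
rewrite indicE memNset//= in_itv/= => /andP[i0 i1]; apply: ij; apply: val_inj => /=.
have : Num.floor x = (N%:Z - i%:Z)%R.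
  have E : ((N%:Z - i%:Z)%:~R = N%:R - i%:R :> R)%R by rewrite rmorphB/= -!pmulrn.
  by apply: floor_def; rewrite intrD1 E; apply/andP; split; lra.
by move=> flE; apply/eqP; rewrite -eqz_nat jE flE; apply/eqP; lia.
Qed.

(** The integer vectors of [-N, N]^n, indexed by a finite type so that sums over them are finite. *)
Definition lattice N n (f : {ffun 'I_n -> 'I_(N.*2.+1)}) (i : 'I_n) : R :=
  ((f i)%:R - N%:R)%R.

Lemma sum_cube_indic N n (a : 'I_n -> R) (v : n.-tuple U) :
  (forall i, `|a i| + 1 <= N%:R)%R -> (forall i, 0 <= tnth v i < 1)%R ->
  \sum_(f : {ffun 'I_n -> 'I_(N.*2.+1)}) cube_indic (fun i => a i + lattice f i)%R v = 1.
Proof.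
move=> aN vI; rewrite sumEFin; congr EFin.
pose u i (j : 'I_(N.*2.+1)) : R :=
  (\1_([set` `[0%R, 1%R[] : set R) (tnth v i + a i + (j%:R - N%:R)))%R.
under eq_bigr => f _ do under eq_bigr => i _ do rewrite addrA -/(u i (f i)).
rewrite -(bigA_distr_bigA u) big1// => i _; apply: sum_unit_indic.
apply: le_trans (ler_normD _ _) _; apply: le_trans (aN i); rewrite addrC lerD2l.
by have /andP[v0 /ltW v1] := vI i; rewrite ger0_norm.
Qed.

(** Reversing the ordinals negates the lattice vector. *)
Lemma sum_cube_indicN N n (a : 'I_n -> R) (v : n.-tuple U) :
  (forall i, `|a i| + 1 <= N%:R)%R -> (forall i, 0 <= tnth v i < 1)%R ->
  \sum_(f : {ffun 'I_n -> 'I_(N.*2.+1)}) cube_indic (fun i => a i - lattice f i)%R v = 1.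
Proof.
move=> aN vI; rewrite -(sum_cube_indic aN vI).
pose h (f : {ffun 'I_n -> 'I_(N.*2.+1)}) := [ffun i => rev_ord (f i)].
have hK : involutive h by move=> f; apply/ffunP => i; rewrite !ffunE rev_ordK.
rewrite (reindex_inj (inv_inj hK)); apply: eq_bigr => f _; congr EFin.
apply: eq_bigr => i _; congr (\1__ (_ + (_ + _)))%R.
rewrite /lattice ffunE /= subSS natrB; last by rewrite -ltnS.
by have -> : (N.*2%:R = N%:R + N%:R :> R)%R; [rewrite -addnn natrD|lra].
Qed.

(** The cube is cut according to the integer vector that brings v + a back into it. Each piece is
    transferred, and the transferred pieces again fill the cube. *)
Lemma integral_cube_periodic n (a : 'I_n -> R) (h : n.-tuple U -> \bar R) :
  measurable_fun setT h -> (forall v, 0 <= h v) ->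
  (forall N (f : {ffun 'I_n -> 'I_(N.*2.+1)}) v, h (shift_tuple (lattice f) v) = h v) ->
  \int[uniform_cube n]_v h (shift_tuple a v) = \int[uniform_cube n]_v h v.
Proof.
move=> mh h0 hper.
have [N aN] : exists N, forall i, (`|- a i| + 1 <= N%:R)%R.
  exists (Num.truncn (\sum_i (`|- a i| + 1))%R).+1 => i.
  apply: (@le_trans _ _ (\sum_i (`|- a i| + 1))%R); last by rewrite ltW// truncnS_gt.
  by rewrite (bigD1 i)//= lerDl sumr_ge0// => j _; rewrite addr_ge0.
have aN' i : (`|a i| + 1 <= N%:R)%R by have := aN i; rewrite normrN.
have msh b : measurable_fun setT (fun v : n.-tuple U => h (shift_tuple b v)).
  by apply: measurableT_comp => //; exact: measurable_shift_tuple.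
have hI b c v : 0 <= h (shift_tuple b v) * cube_indic c v.
  by rewrite mule_ge0// cube_indic_ge0.
have mI b c : measurable_fun setT (fun v : n.-tuple U => h (shift_tuple b v) * cube_indic c v).
  by apply: emeasurable_funM => //; exact: measurable_cube_indic.
transitivity (\sum_(f : {ffun 'I_n -> 'I_(N.*2.+1)})
   \int[uniform_cube n]_v (h (shift_tuple a v) * cube_indic (fun i => a i - lattice f i)%R v)).
  rewrite -ge0_integral_sum//; apply: eq_integral_cube => //.
  - by apply: emeasurable_sum => f.
  - by move=> v; apply: sume_ge0.
  - move=> v vI; rewrite -ge0_sume_distrr; last by move=> f _; exact: cube_indic_ge0.
    by rewrite sum_cube_indicN// mule1.
(* The transfer turns the condition that v + a - f is in the unit cube into the one that v - a + f
   is; periodicity removes f from the argument of [h]. *)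
transitivity (\sum_(f : {ffun 'I_n -> 'I_(N.*2.+1)})
   \int[uniform_cube n]_v (h v * cube_indic (fun i => - a i + lattice f i)%R v)).
  apply: eq_bigr => f _; rewrite integral_cube_transfer//; last first.
  apply: eq_integral => v _; congr (_ * _).
    rewrite -[RHS](hper N f); congr h; apply: eq_from_tnth => i.
    by rewrite !tnth_mktuple; lra.
  by rewrite /cube_indic; congr EFin; apply: eq_bigr => i _; rewrite opprB [(lattice f i - a i)%R]addrC.
rewrite -ge0_integral_sum//.
- apply: eq_integral_cube => //.
  + by apply: emeasurable_sum => f; apply: emeasurable_funM => //; exact: measurable_cube_indic.
  + by move=> v; apply: sume_ge0 => f _; rewrite mule_ge0// cube_indic_ge0.
  + move=> v vI; rewrite -ge0_sume_distrr; last by move=> f _; exact: cube_indic_ge0.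
    by rewrite sum_cube_indic// mule1.
- by move=> f; apply: emeasurable_funM => //; exact: measurable_cube_indic.
- by move=> f v _; rewrite mule_ge0// cube_indic_ge0.
Qed.

End uniform_cube_transfer.

(** * Cells, shares and first points *)

Section extended_reals.
Context {R : realType}.
Implicit Types x y : \bar R.

(** With 0^-1 = +oo, inversion is decreasing on [0, +oo], so upper rays pull back to lower rays. *)
Lemma measurable_inve {d} {T : measurableType d} (f : T -> \bar R) :
  measurable_fun setT f -> (forall t, 0 <= f t) -> measurable_fun setT (fun t => (f t)^-1).
Proof.
move=> mf f0; apply: (measurability (@ErealGenOInfty.G R)).
  exact: ErealGenOInfty.measurableE.
move=> _ [_ [r ->] <-]; rewrite setTI.
have [r0|r0] := ltP r 0%R.
  rewrite [X in measurable X](_ : _ = setT)//; apply/seteqP; split=> // t _ /=.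
  by rewrite in_itv/= andbT (@lt_le_trans _ _ 0) ?lte_fin// inve_ge0.
rewrite [X in measurable X](_ : _ = [set t | f t < r%:E^-1]).
  by rewrite -[X in measurable X]setTI; exact: emeasurable_fun_infty_o.
by apply/funext => t /=; rewrite in_itv/= andbT inve_pgt// inE/= ?lee_fin.
Qed.

End extended_reals.

Section cells.
Context {R : realType} {k : nat}.
Local Notation V := 'rV[R]_k.
Local Notation U := (measurableTypeR R).
Implicit Types (phi : config R k) (m : mconfig R k R) (s : R) (x y z : V).

Lemma measurable_cube {d} {T : measurableType d} s (f g : T -> V) :
  measurable_fun setT f -> measurable_fun setT g ->
  measurable [set t | cube s (f t) (g t)].
Proof.
move=> mf mg; apply: measurable_forall_ord => i.
have mc (h : T -> V) : measurable_fun setT h -> measurable_fun setT (fun t : T => h t ord0 i).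
  by move=> mh; exact: (measurableT_comp (measurable_coord i)).
rewrite [X in measurable X](_ : _ = (fun t => f t ord0 i <= g t ord0 i)%R @^-1` [set true] `&`
  (fun t => g t ord0 i < f t ord0 i + s)%R @^-1` [set true]); last first.
  by apply/seteqP; split=> [t /andP[/= -> ->]|t /= [-> ->]].
apply: measurableI; rewrite -[X in measurable X]setTI.
  by apply: (measurable_fun_ler (mc f mf) (mc g mg)).
apply: (measurable_fun_ltr (mc g mg) (measurable_funD (mc f mf) (measurable_cst s))) => //.
Qed.

Lemma cube_shift s t z x : cube s (z + t)%R (x + t)%R = cube s z x.
Proof.
by apply/propext; split=> h i; have := h i; rewrite !mxE addrAC lerD2r ltrD2r.
Qed.

Lemma finite_cube phi s z : finite_set (phi `&` cube s z).
Proof.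
pose r := (\sum_i (`|z ord0 i| + `|s|))%R.
apply: sub_finite_set (finite_config_box phi r) => x [px xz]; split => // i.
apply: (@le_trans _ _ (`|z ord0 i| + `|s|)%R).
  rewrite ler_norml; have /andP[l1 l2] := xz i.
  have := ler_norm (z ord0 i); have := ler_norm s.
  by have := ler_norm (- z ord0 i); rewrite normrN; lra.
by rewrite /r (bigD1 i)//= lerDl sumr_ge0// => j _; rewrite addr_ge0.
Qed.

Definition cube_in s z x : \bar R := (\1_(cube s z) x)%:E.

Lemma cube_in_shift s t z x : cube_in s (z + t)%R (x + t)%R = cube_in s z x.
Proof.
rewrite /cube_in !indicE.
suff -> : ((x + t)%R \in cube s (z + t)%R) = (x \in cube s z) by [].
by apply/idP/idP; rewrite !inE cube_shift.
Qed.

Lemma cube_in_ge0 s z x : 0 <= cube_in s z x. Proof. by rewrite lee_fin. Qed.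

Lemma measurable_cube_in {d} {T : measurableType d} s (f g : T -> V) :
  measurable_fun setT f -> measurable_fun setT g ->
  measurable_fun setT (fun t => cube_in s (f t) (g t)).
Proof.
move=> mf mg; apply/measurable_EFinP.
rewrite [X in measurable_fun _ X](_ : _ = \1_[set t | cube s (f t) (g t)]).
  by apply: measurable_indic; exact: measurable_cube.
by apply/funext => t; rewrite !indicE; congr (_%:R); apply/idP/idP; rewrite !inE.
Qed.

(** With u = v + (y - x) / s, each coordinate of [y] exceeds that of the corner of the cell by
    exactly s u. *)
Lemma cube_in_cube_indic s x y (v : k.-tuple U) : (0 < s)%R ->
  cube_in s (x + neg_cube_point s v)%R y =
  cube_indic (fun i => (y ord0 i - x ord0 i) / s)%R v.
Proof.
move=> s0; rewrite /cube_in /cube_indic; congr EFin.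
have E i : (x + neg_cube_point s v)%R ord0 i = (x ord0 i - s * tnth v i)%R by rewrite !mxE.
have Ei i : (x ord0 i - s * tnth v i <= y ord0 i < x ord0 i - s * tnth v i + s)%R =
    ((tnth v i + (y ord0 i - x ord0 i) / s)%R \in `[0%R, 1%R[).
  rewrite in_itv/=; set u := (tnth v i + _)%R.
  have -> : (y ord0 i = s * u + (x ord0 i - s * tnth v i))%R.
    by rewrite /u mulrDr [(s * (_ / s))%R]mulrCA mulfV ?gt_eqF// mulr1; lra.
  rewrite lerDr pmulr_rge0// [(_ + s)%R]addrC ltrD2r.
  by rewrite -[X in (_ < X)%R]mulr1 ltr_pM2l.
have [xy|xy] := pselect (cube s (x + neg_cube_point s v)%R y).
  rewrite indicE mem_set//= big1// => i _; rewrite indicE mem_set//=.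
  by have := xy i; rewrite E Ei.
rewrite indicE memNset//=; have /existsNP[i] := xy; rewrite E Ei => /negP yi.
by rewrite (bigD1 i)//= indicE memNset ?mul0r//; exact/negP.
Qed.

(* The coordinates [v] of the uniform point exchange the roles of [x] and [y]
   when translated by [(y - x) / s]. *)
Lemma integral_cube_exchange s x y (F : V -> \bar R) : (0 < s)%R ->
  measurable_fun setT F -> (forall z, 0 <= F z) ->
  \int[uniform_cube k]_v
    (F (x + neg_cube_point s v)%R * cube_in s (x + neg_cube_point s v)%R y) =
  \int[uniform_cube k]_v
    (F (y + neg_cube_point s v)%R * cube_in s (y + neg_cube_point s v)%R x).
Proof.
move=> s0 mF F0; pose a i := ((y ord0 i - x ord0 i) / s)%R.
have mncp z : measurable_fun setT (fun v : k.-tuple U => z + neg_cube_point s v)%R.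
  apply: measurable_rowD => //; apply: measurable_row => i.
  rewrite (_ : (fun v => _) = (fun v : k.-tuple U => - (s * tnth v i)))%R.
    by apply: measurableT_comp => //; apply: measurable_funM => //; exact: measurable_tnth.
  by apply/funext => v; rewrite mxE.
transitivity (\int[uniform_cube k]_v (F (x + neg_cube_point s v)%R * cube_indic a v)).
  apply: eq_integral => v _; congr (_ * _); exact: cube_in_cube_indic.
rewrite (integral_cube_transfer _ (G := fun v => F (x + neg_cube_point s v)%R))//; last first.
  exact: (measurableT_comp mF (mncp x)).
apply: eq_integral => v _; congr (F _ * _).
  apply/rowP => i; rewrite !mxE tnth_mktuple mulrBr opprB /a.
  by rewrite mulrCA mulfV ?gt_eqF// mulr1; lra.
rewrite cube_in_cube_indic//; congr (cube_indic _ v); apply/funext => i.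
by rewrite /a -mulNr opprB.
Qed.

Lemma measurable_neg_cube_point {d} {T : measurableType d} s (f : T -> V) (g : T -> k.-tuple U) :
  measurable_fun setT f -> measurable_fun setT g ->
  measurable_fun setT (fun t => f t + neg_cube_point s (g t))%R.
Proof.
move=> mf mg; apply: measurable_rowD => //; apply: measurable_row => i.
rewrite (_ : (fun t => _) = (fun t => - (s * tnth (g t) i)))%R.
  apply: measurableT_comp => //; apply: measurable_funM => //.
  exact: (measurableT_comp (measurable_tnth i)).
by apply/funext => v; rewrite mxE.
Qed.

(** A total version of the mark: nonnegative for every marking, and zero off the configuration,
    where marks are junk. It agrees with [pmark] on the points of a [positive_marking]. *)
Definition weight m x : R :=
  if `[< points (base m) x >] then Num.max (pmark m x) 0%R else 0%R.

Lemma weight_ge0 m x : (0 <= weight m x)%R.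
Proof. by rewrite /weight; case: asboolP => // _; rewrite le_max lexx orbT. Qed.

Lemma weight_shift t m x : weight (shift_mconfig t m) (x + t)%R = weight m x.
Proof. by rewrite /weight pmark_shift points_shift. Qed.

(** Evaluating the marking at a moving point is rewritten as a sum over all points, restricted to
    the one equal to [f t]. *)
Lemma measurable_weight {d} {T : measurableType d} (M : T -> mconfig R k R) (f : T -> V) :
  measurable_fun setT M -> measurable_fun setT f ->
  measurable_fun setT (fun t => weight (M t) (f t)).
Proof.
move=> mM mf; apply/measurable_EFinP.
pose D := [set p : T * V | f p.1 = p.2].
have mD : measurable D.
  by apply: measurable_eq_row => //; exact: measurableT_comp.
rewrite (_ : EFin \o _ = (fun t => \esum_(x in base (M t))
   ((\1_D (t, x)) * Num.max (pmark (M t) x) 0)%R%:E)).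
  apply: (@measurable_esum_pmark R k _ R _ T M (fun z : T * V * R => (\1_D z.1 * Num.max z.2 0)%R%:E)) => //.
    apply/measurable_EFinP; apply: measurable_funM.
      exact: (measurableT_comp (measurable_indic mD)).
    exact: measurable_maxr.
  by move=> z; rewrite lee_fin mulr_ge0// le_max lexx orbT.
apply/funext => t /=; rewrite /weight; case: asboolP => ft.
  rewrite -[LHS](esum_set1 (a := fun x => (Num.max (pmark (M t) x) 0%R)%:E)); last first.
    by rewrite lee_fin le_max lexx orbT.
  rewrite esum_mkcond [RHS]esum_mkcond; apply: eq_esum => x _.
  case: ifPn => [/set_mem /= ->|xft]; first by rewrite mem_set// indicE mem_set// mul1r.
  case: ifPn => // _; rewrite indicE memNset ?mul0r//= => xE.
  by move: xft => /negP; apply; apply/mem_set; exact/esym/xE.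
rewrite esum1// => x px; rewrite indicE memNset ?mul0r//= => xE.
by apply: ft; rewrite [f t]xE.
Qed.

Definition cell_weight s m z : \bar R :=
  \esum_(x in base m) ((weight m x)%:E * cube_in s z x).

Lemma cell_weight_ge0 s m z : 0 <= cell_weight s m z.
Proof. by apply: esum_ge0 => x _; rewrite mule_ge0// lee_fin// weight_ge0. Qed.

Lemma measurable_cell_weight {d} {T : measurableType d} s (M : T -> mconfig R k R) (f : T -> V) :
  measurable_fun setT M -> measurable_fun setT f ->
  measurable_fun setT (fun t => cell_weight s (M t) (f t)).
Proof.
move=> mM mf.
apply: (measurable_esum_config (Phi := fun t => base (M t))
  (f := fun p => (weight (M p.1) p.2)%:E * cube_in s (f p.1) p.2)).
- exact: (measurableT_comp (@measurable_base R k _ _)).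
- apply: emeasurable_funM.
    by apply/measurable_EFinP; apply: measurable_weight => //; exact: measurableT_comp.
  by apply: measurable_cube_in => //; exact: measurableT_comp.
- by move=> p; rewrite mule_ge0// lee_fin// weight_ge0.
Qed.

Lemma cell_weight_shift s t m z : cell_weight s (shift_mconfig t m) (z + t)%R = cell_weight s m z.
Proof.
rewrite /cell_weight (esum_shift_config t (base m)); apply: eq_esum => x _.
by rewrite weight_shift cube_in_shift.
Qed.

Lemma cell_weightE s m z :
  cell_weight s m z = \esum_(x in base m `&` cube s z) (weight m x)%:E.
Proof.
rewrite esum_mkcondr; apply: eq_esum => x _; rewrite /cube_in indicE.
by case: ifP => _; rewrite ?mule1 ?mule0.
Qed.

Lemma cell_weight_fin s m z : cell_weight s m z \is a fin_num.
Proof.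
rewrite cell_weightE esum_points_of; first by apply/sum_fin_numP => i _ _.
  exact: finite_cube.
by move=> y; rewrite lee_fin weight_ge0.
Qed.

Lemma weight_le_cell s m z x : cube s z x -> (weight m x)%:E <= cell_weight s m z.
Proof.
move=> zx; have [px|px] := pselect (points (base m) x).
  by rewrite cell_weightE; apply: (esum_ge_term (fun x => (weight m x)%:E)).
by rewrite /weight asboolF// cell_weight_ge0.
Qed.

(** In a cell of weight zero the quotient is 0 * +oo = 0, so the bounds by 1 on a share and on the
    sum of the shares have no exception. *)
Definition share s m x z : \bar R :=
  (weight m x)%:E * (cell_weight s m z)^-1 * cube_in s z x.

Lemma share_ge0 s m x z : 0 <= share s m x z.
Proof. by rewrite !mule_ge0// ?cube_in_ge0// ?inve_ge0 ?cell_weight_ge0// lee_fin weight_ge0. Qed.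

Lemma weight_div_cell s m x z : cube s z x -> (weight m x)%:E * (cell_weight s m z)^-1 <= 1.
Proof.
move=> zx; have [w0|w0] := eqVneq (weight m x) 0%R; first by rewrite w0 mul0e.
have := weight_le_cell m zx; have := cell_weight_fin s m z.
case: (cell_weight s m z) => // a _; rewrite lee_fin => wa.
have a0 : (0 < a)%R by rewrite (lt_le_trans _ wa)// lt_neqAle eq_sym w0 weight_ge0.
by rewrite inver gt_eqF// -EFinM lee_fin ler_pdivrMr// mul1r.
Qed.

Lemma share_le1 s m x z : share s m x z <= 1.
Proof.
rewrite /share /cube_in indicE.
have [zx|zx] := boolP (x \in cube s z); last by rewrite mule0.
by rewrite mule1 weight_div_cell//; exact: set_mem.
Qed.

Lemma esum_share_eq1 s m z : cell_weight s m z != 0 ->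
  \esum_(x in base m) share s m x z = 1.
Proof.
move=> W0.
set c := (cell_weight s m z)^-1; have c0 : 0 <= c by rewrite inve_ge0 cell_weight_ge0.
transitivity (c * \esum_(x in base m `&` cube s z) (weight m x)%:E); last first.
  by rewrite -cell_weightE mulVe// cell_weight_fin.
transitivity (\esum_(x in base m `&` cube s z) (c * (weight m x)%:E)).
  rewrite [RHS]esum_mkcondr; apply: eq_esum => x _; rewrite /share /cube_in indicE.
  by case: ifP => _; rewrite ?mule1 ?mule0// muleC.
have w0 x : 0 <= (weight m x)%:E by rewrite lee_fin weight_ge0.
have fc : finite_set (base m `&` cube s z) by exact: finite_cube.
rewrite !esum_points_of//; last by move=> x; exact: mule_ge0.
by rewrite ge0_sume_distrr.
Qed.

Lemma esum_share s m z : \esum_(x in base m) share s m x z <= 1.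
Proof.
have [W0|W0] := eqVneq (cell_weight s m z) 0.
  rewrite esum1// => x px; rewrite /share /cube_in indicE.
  have [zx|_] := boolP (x \in cube s z); last by rewrite mule0.
  have -> : weight m x = 0%R; last by rewrite !mul0e.
  apply/eqP; rewrite eq_le weight_ge0 andbT -lee_fin.
  by have := weight_le_cell m (set_mem zx); rewrite W0.
by rewrite esum_share_eq1.
Qed.

Lemma share_shift s t m x z : share s (shift_mconfig t m) (x + t)%R (z + t)%R = share s m x z.
Proof. by rewrite /share weight_shift cell_weight_shift cube_in_shift. Qed.

Lemma measurable_share {d} {T : measurableType d} s (M : T -> mconfig R k R) (f g : T -> V) :
  measurable_fun setT M -> measurable_fun setT f -> measurable_fun setT g ->
  measurable_fun setT (fun t => share s (M t) (f t) (g t)).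
Proof.
move=> mM mf mg; apply: emeasurable_funM; last exact: measurable_cube_in.
apply: emeasurable_funM; first by apply/measurable_EFinP; exact: measurable_weight.
by apply: measurable_inve => [|t]; [exact: measurable_cell_weight|exact: cell_weight_ge0].
Qed.

(** Any measurable, translation-invariant strict total order would serve: it selects one point of
    each nonempty cell without further randomness. *)
Definition lex_lt x y :=
  exists i : 'I_k, (x ord0 i < y ord0 i)%R /\
    forall j : 'I_k, (j < i)%N -> x ord0 j = y ord0 j.

Lemma lex_ltxx x : ~ lex_lt x x.
Proof. by move=> [i []]; rewrite ltxx. Qed.

Lemma lex_lt_trans x y z : lex_lt x y -> lex_lt y z -> lex_lt x z.
Proof.
move=> [i [xyi xyE]] [j [yzj yzE]].
have [ij|ji|/val_inj ij] := ltngtP i j.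
- exists i; split; first by rewrite -yzE.
  by move=> l li; rewrite xyE// yzE// (ltn_trans li).
- exists j; split; first by rewrite xyE.
  by move=> l lj; rewrite xyE ?yzE// (ltn_trans lj).
- exists i; split; first by rewrite (lt_trans xyi)// ij.
  by move=> l li; rewrite xyE// yzE// -ij.
Qed.

Lemma lex_lt_total x y : x <> y -> lex_lt x y \/ lex_lt y x.
Proof.
move=> xy; have : exists n, [exists i : 'I_k, (val i == n) && (x ord0 i != y ord0 i)].
  apply: contrapT => /forallNP h; apply: xy; apply/rowP => i; apply/eqP/negPn/negP => xyi.
  by apply: (h i); apply/existsP; exists i; rewrite eqxx.
case/ex_minnP => n /existsP[i /andP[/eqP <- xyi]] imin.
have E (j : 'I_k) : (j < i)%N -> x ord0 j = y ord0 j.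
  move=> ji; apply/eqP/negPn/negP => xyj.
  have := imin j; rewrite leqNgt ji; move=> /(_ _)/negP; apply => //.
  by apply/existsP; exists j; rewrite eqxx.
by move: xyi; rewrite neq_lt => /orP[xyi|yxi]; [left|right]; exists i; split => // j /E.
Qed.

Lemma lex_lt_shift t x y : lex_lt (x + t)%R (y + t)%R <-> lex_lt x y.
Proof.
split=> -[i [xy E]]; exists i; split.
- by move: xy; rewrite !mxE ltrD2r.
- by move=> j /E; rewrite !mxE => /addIr.
- by rewrite !mxE ltrD2r.
- by move=> j /E; rewrite !mxE => ->.
Qed.

Lemma measurable_lex_lt {d} {T : measurableType d} (f g : T -> V) :
  measurable_fun setT f -> measurable_fun setT g ->
  measurable [set t | lex_lt (f t) (g t)].
Proof.
move=> mf mg.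
have mc (h : T -> V) i : measurable_fun setT h -> measurable_fun setT (fun t : T => h t ord0 i).
  by move=> mh; exact: (measurableT_comp (measurable_coord i)).
rewrite (_ : [set t | _] = \bigcup_(i in [set: 'I_k])
  ([set t | f t ord0 i < g t ord0 i]%R `&`
   [set t | forall j : 'I_k, (j < i)%N -> f t ord0 j = g t ord0 j])); last first.
  by apply/seteqP; split=> t [i]; [move=> []; exists i|move=> _ []; exists i].
apply: fin_bigcup_measurable => // i _; apply: measurableI.
  rewrite [X in measurable X](_ : _ = (fun t => f t ord0 i < g t ord0 i)%R @^-1` [set true]).
    by rewrite -[X in measurable X]setTI; apply: (measurable_fun_ltr (mc f i mf) (mc g i mg)).
  by apply/seteqP; split=> t /= ->.
apply: measurable_forall_ord => j.
have [ji|ji] := boolP (j < i)%N; last first.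
  by rewrite [X in measurable X](_ : _ = setT)//; apply/seteqP; split.
rewrite [X in measurable X](_ : _ = (fun t => f t ord0 j == g t ord0 j) @^-1` [set true]).
  by rewrite -[X in measurable X]setTI; apply: (measurable_fun_eqr (mc f j mf) (mc g j mg)).
by apply/seteqP; split=> t /= => [/(_ isT)/eqP//|/eqP ->].
Qed.

Lemma lex_min (r : seq V) : r != [::] ->
  exists2 x, x \in r & forall y, y \in r -> ~ lex_lt y x.
Proof.
elim: r => // a [|b r] IH _.
  by exists a; rewrite ?mem_head// => y; rewrite inE => /eqP ->; exact: lex_ltxx.
have [x xr xmin] := IH isT.
have [ax|ax] := pselect (lex_lt a x); last first.
  exists x; first by rewrite inE xr orbT.
  by move=> y; rewrite inE => /orP[/eqP ->|/xmin].
exists a; first exact: mem_head.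
move=> y; rewrite inE => /orP[/eqP ->|yr]; first exact: lex_ltxx.
by move=> /lex_lt_trans/(_ ax); exact: xmin.
Qed.

Definition is_first s phi z x := [/\ points phi x, cube s z x &
  forall y, points phi y -> cube s z y -> ~ lex_lt y x].

Lemma is_first_ex s phi z x : points phi x -> cube s z x ->
  exists y, is_first s phi z y.
Proof.
move=> px zx; have fin := finite_cube phi s z.
have [|y] := @lex_min (points_of (phi `&` cube s z)).
  have : x \in fset_set (phi `&` cube s z) by rewrite in_fset_set// inE.
  by rewrite -[x \in _]/(x \in points_of (phi `&` cube s z)); case: (points_of _).
rewrite in_fset_set// => /set_mem [py zy] ymin; exists y; split => // u pu zu.
by apply: ymin; rewrite in_fset_set// inE.
Qed.

Lemma is_first_inj s phi z x y : is_first s phi z x -> is_first s phi z y -> x = y.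
Proof.
move=> [px zx xm] [py zy ym]; apply: contrapT => /lex_lt_total[].
  exact: ym.
exact: xm.
Qed.

Lemma is_first_shift s t phi z x :
  is_first s (shift_config t phi) (z + t)%R (x + t)%R <-> is_first s phi z x.
Proof.
rewrite /is_first points_shift cube_shift; split=> -[px zx xm]; split => // y.
  move=> py zy yx; apply: (xm (y + t)%R); rewrite ?points_shift ?cube_shift//.
  by apply/lex_lt_shift.
rewrite -[y](subrK t) points_shift cube_shift => py zy /lex_lt_shift.
exact: xm.
Qed.

(** Minimality is a universal statement over the points, hence the complement of an event covered by
    [measurable_exists_point]. *)
Lemma measurable_is_first {d} {T : measurableType d} s (Phi : T -> config R k) (f g : T -> V) :
  measurable_fun setT Phi -> measurable_fun setT f -> measurable_fun setT g ->
  measurable [set t | is_first s (Phi t) (f t) (g t)].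
Proof.
move=> mPhi mf mg; pose D := [set p : T * V | cube s (f p.1) p.2 /\ lex_lt p.2 (g p.1)].
have mD : measurable D.
  apply: measurableI.
    by apply: measurable_cube => //; exact: measurableT_comp.
  by apply: measurable_lex_lt => //; exact: measurableT_comp.
rewrite (_ : [set t | _] = [set t | points (Phi t) (g t)] `&`
  ([set t | cube s (f t) (g t)] `&` ~` [set t | exists y, points (Phi t) y /\ D (t, y)])).
  apply: measurableI; first exact: measurable_points.
  apply: measurableI; first exact: measurable_cube.
  by apply: measurableC; exact: measurable_exists_point.
apply/seteqP; split => [t [pt zt tm]|t [pt [zt /= tm]]].
  by split => //; split => // -[y [py [zy yt]]]; exact: (tm y).
by split => // y py zy yt; apply: tm; exists y.
Qed.

Definition first_in s phi z x : \bar R := (`[< is_first s phi z x >]%:R)%:E.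

Lemma first_in_ge0 s phi z x : 0 <= first_in s phi z x.
Proof. by rewrite lee_fin. Qed.

Lemma measurable_first_in {d} {T : measurableType d} s (Phi : T -> config R k) (f g : T -> V) :
  measurable_fun setT Phi -> measurable_fun setT f -> measurable_fun setT g ->
  measurable_fun setT (fun t => first_in s (Phi t) (f t) (g t)).
Proof.
move=> mPhi mf mg; apply/measurable_EFinP.
rewrite [X in measurable_fun _ X](_ : _ = \1_[set t | is_first s (Phi t) (f t) (g t)]).
  by apply: measurable_indic; exact: measurable_is_first.
apply/funext => t; rewrite indicE; congr (_%:R); congr nat_of_bool.
Qed.

Lemma first_in_shift s t phi z x :
  first_in s (shift_config t phi) (z + t)%R (x + t)%R = first_in s phi z x.
Proof. by rewrite /first_in; do 2 f_equal; congr nat_of_bool; apply: asbool_equiv_eq; exact: is_first_shift. Qed.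

Lemma esum_first_in s phi z x : points phi x -> cube s z x ->
  \esum_(y in phi) first_in s phi z y = 1.
Proof.
move=> px zx; have [y yf] := is_first_ex px zx; have [py _ _] := yf.
transitivity (\esum_(u in [set y]) (1 : \bar R)); last by rewrite esum_set1.
rewrite esum_mkcond [RHS]esum_mkcond; apply: eq_esum => u _.
have [->|uy] := eqVneq u y; first by rewrite !mem_set// /first_in asboolT.
rewrite [in RHS]memNset; last exact/eqP.
case: ifP => // _; rewrite /first_in asboolF// => uf.
by move/eqP: uy; apply; exact: is_first_inj uf yf.
Qed.

End cells.

(** * Expectations of equivariant processes and mass transport *)

Section integral_ae.
Local Open Scope ring_scope.

Lemma ae_imp {d} {T : measurableType d} {R : realType} (mu : {measure set T -> \bar R})
    (A B : T -> Prop) :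
  {ae mu, forall x, A x} -> (forall x, A x -> B x) -> {ae mu, forall x, B x}.
Proof. by move=> [N [mN N0 AN]] AB; exists N; split => // x nB; apply: AN => /AB. Qed.

Lemma ae_imp2 {d} {T : measurableType d} {R : realType} (mu : {measure set T -> \bar R})
    (A B C : T -> Prop) :
  {ae mu, forall x, A x} -> {ae mu, forall x, B x} -> (forall x, A x -> B x -> C x) ->
  {ae mu, forall x, C x}.
Proof.
move=> [N [mN N0 AN]] [N' [mN' N0' BN]] ABC; exists (N `|` N'); split.
- exact: measurableU.
- by apply: null_set_setU.
- move=> x nC; have [Nx|Nx] := pselect (N x); [by left|right; apply: BN => Bx].
  by apply: nC; apply: ABC => //; apply: contrapT => /AN.
Qed.

Local Open Scope ereal_scope.
Context {d} {T : measurableType d} {R : realType} (mu : {measure set T -> \bar R}).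
Implicit Types f g : T -> \bar R.

Import HBNNSimple.

(* No measurability is assumed: the integral of a nonnegative function is a
   supremum over the simple functions below it. *)
Lemma le_integral_ae f g : (forall x, 0 <= f x) -> (forall x, 0 <= g x) ->
  {ae mu, forall x, f x <= g x} -> \int[mu]_x f x <= \int[mu]_x g x.
Proof.
move=> f0 g0 [N [mN muN fgN]]; rewrite ge0_integralTE//.
apply: ge_ereal_sup => _ [h /= hf <-].
have mNC : measurable (~` N) by exact: measurableC.
have -> : sintegral mu h = \int[mu]_x (proj_nnsfun h mNC x)%:E.
  rewrite -integralT_nnsfun (ge0_negligible_integral mN)//=.
  - rewrite setTD integral_mkcond; apply: eq_integral => x _.
    rewrite patchE /proj_nnsfun/= mindicE/= in_setC.
    by case: (x \in N); rewrite ?mulr0// mulr1.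
  - exact/measurable_EFinP.
  - by move=> x _; rewrite lee_fin.
rewrite integralT_nnsfun [leRHS]ge0_integralTE//; apply: ereal_sup_ubound.
exists (proj_nnsfun h mNC) => //= x; rewrite mindicE/= in_setC.
have [xN|xN] := boolP (x \in N); first by rewrite mulr0.
rewrite mulr1; apply: (le_trans (hf x)); apply: contrapT => fg.
by move/negP: xN; apply; rewrite inE; apply: fgN.
Qed.

Lemma eq_integral_ae f g : (forall x, 0 <= g x) ->
  {ae mu, forall x, f x = g x} -> \int[mu]_x f x = \int[mu]_x g x.
Proof.
move=> g0 fg.
(* [integralE] will split the left side into positive and negative parts; this gives the right side
   the same shape, with 0 as negative part. *)
have -> : \int[mu]_x g x = \int[mu]_x g x - \int[mu]_x (cst 0 x).
  by rewrite integral0 sube0.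
have pos : {ae mu, forall x, f^\+ x = g x}.
  by apply: (ae_imp fg) => x fgx; rewrite funeposE fgx max_l.
have neg : {ae mu, forall x, f^\- x = cst 0 x}.
  by apply: (ae_imp fg) => x fgx; rewrite funenegE fgx max_r// leeNl oppe0.
rewrite integralE; congr (_ - _); apply/eqP; rewrite eq_le; apply/andP; split;
  apply: le_integral_ae => //.
- by apply: (ae_imp pos) => x ->.
- by apply: (ae_imp pos) => x ->.
- by apply: (ae_imp neg) => x ->.
- by apply: (ae_imp neg) => x ->.
Qed.

End integral_ae.

Section equivariant_processes.
Context {R : realType} {k : nat} {dO : measure_display}
  {Omega : measurableType dO} {P : probability Omega R}.
Variable Phi : {RV P >-> config R k}.
Local Notation V := 'rV[R]_k.

Lemma measurable_Phi : measurable_fun setT Phi.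
Proof. exact: measurable_funPT. Qed.

Section law.
Context {dX : measure_display} {Xi : measurableType dX}.
Variable Z : equivariant_process Phi Xi.

(* [mlaw Z] made measurable outside of [dom Z]. *)
Definition law (phi : config R k) : probability (mconfig R k Xi) R :=
  if `[< dom Z phi >] then mlaw Z phi else [the probability _ _ of \d_point].

Lemma lawE phi : dom Z phi -> law phi = mlaw Z phi.
Proof. by rewrite /law => dphi; rewrite asboolT. Qed.

Lemma measurable_law A : measurable A -> measurable_fun setT (law ^~ A : config R k -> \bar R).
Proof.
move=> mA; have mD := measurable_dom Z.
rewrite -(setUv (dom Z)); apply/measurable_funU => //; first exact: measurableC.
split.
  apply: (@eq_measurable_fun _ _ _ _ _ (mlaw Z ^~ A)); last exact: measurable_mlaw.
  by move=> phi /set_mem dphi; rewrite lawE.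
apply: (@eq_measurable_fun _ _ _ _ _ (cst (\d_(point : mconfig R k Xi) A))) => //.
by move=> phi /set_mem ndphi; rewrite /law asboolF.
Qed.

Section law_kernel.
Context {d} {T : measurableType d}.
Variables (F : T -> config R k) (mF : measurable_fun setT F).

Let klaw (t : T) : {measure set (mconfig R k Xi) -> \bar R} := law (F t).

Let mklaw A : measurable A -> measurable_fun setT (klaw ^~ A).
Proof. by move=> mA; apply: (measurableT_comp (measurable_law mA)). Qed.

HB.instance Definition _ := isKernel.Build _ _ _ _ _ klaw mklaw.

Let klaw_uub : measure_fam_uub klaw.
Proof.
exists 2%R => t; apply: (@le_lt_trans _ _ 1); last by rewrite lte_fin ltr1n.
exact: (@probability_le1 _ _ _ (law (F t))).
Qed.

HB.instance Definition _ := Kernel_isFinite.Build _ _ _ _ _ klaw klaw_uub.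

Lemma measurable_integral_law (f : T * mconfig R k Xi -> \bar R) :
  measurable_fun setT f -> (forall z, 0 <= f z) ->
  measurable_fun setT (fun t => \int[law (F t)]_m f (t, m)).
Proof. move=> mf f0; exact: (measurable_fun_integral_finite_kernel f klaw). Qed.

End law_kernel.

Lemma integral_law_cst phi (r : R) : \int[law phi]_m cst r%:E m = r%:E.
Proof.
rewrite integral_cst// [X in _ * X](_ : _ = 1) ?mule1//.
exact: (@probability_setT _ _ _ (law phi)).
Qed.

(** [process_expectation] taken with [law], which is measurable everywhere; [process_expectationE]
    compares the two through the full measure of [dom Z]. *)
Definition mean (g : mconfig R k Xi -> \bar R) : \bar R :=
  \int[P]_omega \int[law (Phi omega)]_m g m.

Lemma mean_ge0 g : (forall m, 0 <= g m) -> 0 <= mean g.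
Proof. by move=> g0; apply: integral_ge0 => om _; exact: integral_ge0. Qed.

Lemma process_as_law (Q : mconfig R k Xi -> Prop) : process_as Z Q ->
  {ae P, forall omega, {ae law (Phi omega), forall m, Q m}}.
Proof.
by move=> asQ; apply: (ae_imp2 asQ (dom_ae Z)) => om oQ od; rewrite lawE.
Qed.

Lemma process_expectationE f g : (forall m, 0 <= g m) ->
  process_as Z (fun m => f m = g m) -> process_expectation Z f = mean g.
Proof.
move=> g0 fg; apply: eq_integral_ae => [om|]; first exact: integral_ge0.
apply: (ae_imp2 (dom_ae Z) fg) => om od oQ.
by rewrite lawE//; exact: eq_integral_ae.
Qed.

Lemma le_mean f g : (forall m, 0 <= f m) -> (forall m, 0 <= g m) ->
  process_as Z (fun m => f m <= g m) -> mean f <= mean g.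
Proof.
move=> f0 g0 /process_as_law fg; apply: le_integral_ae => [om|om|]; try exact: integral_ge0.
by apply: (ae_imp fg) => om oQ; exact: le_integral_ae.
Qed.

Lemma eq_mean f g : (forall m, 0 <= f m) -> (forall m, 0 <= g m) ->
  process_as Z (fun m => f m = g m) -> mean f = mean g.
Proof.
by move=> f0 g0 fg; apply/eqP; rewrite eq_le; apply/andP; split; apply: le_mean => //;
  apply: (ae_imp fg) => om a; apply: (ae_imp a) => m ->.
Qed.

Lemma process_as_and (Q1 Q2 : mconfig R k Xi -> Prop) :
  process_as Z Q1 -> process_as Z Q2 -> process_as Z (fun m => Q1 m /\ Q2 m).
Proof.
move=> as1 as2; by apply: (ae_imp2 as1 as2) => om a1 a2; apply: (ae_imp2 a1 a2) => m h1 h2; split.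
Qed.

Lemma process_as_base (A : config R k -> Prop) :
  {ae P, forall omega, A (Phi omega)} -> process_as Z (fun m => A (base m)).
Proof.
move=> asA; apply: (ae_imp2 asA (dom_ae Z)) => om oA od.
by apply: (ae_imp (mlaw_base od)) => m ->.
Qed.

Lemma measurable_mean_inner (g : mconfig R k Xi -> \bar R) :
  measurable_fun setT g -> (forall m, 0 <= g m) ->
  measurable_fun setT (fun omega => \int[law (Phi omega)]_m g m).
Proof.
move=> mg g0; apply: (measurable_integral_law measurable_Phi (f := fun z => g z.2)) => //.
exact: measurableT_comp.
Qed.

Lemma meanD f g : measurable_fun setT f -> (forall m, 0 <= f m) ->
  measurable_fun setT g -> (forall m, 0 <= g m) ->
  mean (f \+ g) = mean f + mean g.
Proof.
move=> mf f0 mg g0; rewrite /mean -ge0_integralD//; try exact: measurable_mean_inner.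
- by apply: eq_integral => om _; rewrite ge0_integralD.
- by move=> om _; exact: integral_ge0.
- by move=> om _; exact: integral_ge0.
Qed.

Lemma meanZ (c : R) f : (0 <= c)%R -> measurable_fun setT f -> (forall m, 0 <= f m) ->
  mean (fun m => c%:E * f m) = c%:E * mean f.
Proof.
move=> c0 mf f0; rewrite /mean -ge0_integralZl_EFin//; last 2 first.
- by move=> om _; exact: integral_ge0.
- exact: measurable_mean_inner.
by apply: eq_integral => om _; rewrite ge0_integralZl_EFin.
Qed.

Lemma integral_law_shift t phi (g : mconfig R k Xi -> \bar R) : dom Z phi ->
  measurable_fun setT g -> (forall m, 0 <= g m) ->
  \int[law (shift_config t phi)]_m g m = \int[law phi]_m g (shift_mconfig t m).
Proof.
move=> dphi mg g0; rewrite !lawE//; last exact: dom_shift.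
have ms := @measurable_shift_mconfig R k _ Xi t.
rewrite -[RHS]/(\int[mlaw Z phi]_(m in shift_mconfig t @^-1` setT) (g \o shift_mconfig t) m).
rewrite -(ge0_integral_pushforward ms)//.
by apply: eq_measure_integral => A mA _; exact: mlaw_shift.
Qed.

Lemma dom_shiftE t phi : dom Z (shift_config t phi) <-> dom Z phi.
Proof.
split; last exact: dom_shift.
by move=> /(dom_shift (- t)); rewrite shift_configK.
Qed.

End law.

Hypothesis Phi_stationary : point_stationary Phi.

(** [point_stationary] tests real-valued functions; finiteness of [g] lets [fine] turn it into one
    without changing the sums. *)
Lemma mass_transport (g : config R k * V * V -> \bar R) :
  measurable_fun setT g -> (forall z, 0 <= g z) -> (forall z, g z \is a fin_num) ->
  (forall t phi x y, points phi x -> points phi y ->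
    g (shift_config t phi, (x + t)%R, (y + t)%R) = g (phi, x, y)) ->
  \int[P]_omega (\esum_(x in Phi omega) g (Phi omega, 0%R, x)) =
  \int[P]_omega (\esum_(x in Phi omega) g (Phi omega, x, 0%R)).
Proof.
move=> mg g0 gfin gshift.
have := Phi_stationary.2 (fun phi x y => fine (g (phi, x, y))).
have E a b (phi : config R k) : \esum_(x in phi) (fine (g (a phi x, b phi x)))%:E =
    \esum_(x in phi) g (a phi x, b phi x) by apply: eq_esum => x _; rewrite fineK.
under eq_integral do rewrite (E (fun phi _ => (phi, 0%R)) (fun _ x => x)).
under [X in _ -> _ -> _ = X]eq_integral do rewrite (E (fun phi x => (phi, x)) (fun _ _ => 0%R)).
apply.
  split.
    apply: measurable_funTS; apply: measurableT_comp => //.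
    rewrite (_ : (fun p => _) = g)//; by apply/funext => -[[]].
  by move=> phi x y t px py; rewrite gshift.
by move=> phi x y px py; rewrite fine_ge0.
Qed.

(** Integrating the marks out for a fixed configuration leaves a function to which [mass_transport]
    applies: equivariance of the laws makes it invariant, the bound by 1 makes it finite, and the
    indicator of [dom Z] preserves invariance where the laws are not equivariant. *)
Lemma mass_transport_process {dX} {Xi : measurableType dX} (Z : equivariant_process Phi Xi)
    (G : mconfig R k Xi * V * V -> \bar R) :
  measurable_fun setT G -> (forall z, 0 <= G z) -> (forall z, G z <= 1) ->
  (forall t m x y, G (shift_mconfig t m, (x + t)%R, (y + t)%R) = G (m, x, y)) ->
  mean Z (fun m => \esum_(x in base m) G (m, 0%R, x)) =
  mean Z (fun m => \esum_(x in base m) G (m, x, 0%R)).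
Proof.
move=> mG G0 G1 Gshift.
pose g (z : config R k * V * V) : \bar R :=
  (\1_(dom Z) z.1.1)%:E * \int[law Z z.1.1]_m G (m, z.1.2, z.2).
have mG' : measurable_fun setT (fun p : (config R k * V * V) * mconfig R k Xi =>
    G (p.2, p.1.1.2, p.1.2)).
  apply: measurableT_comp => //.
  apply: measurable_fun_pair; last exact: measurableT_comp.
  apply: measurable_fun_pair => //; do 2 (apply: measurableT_comp => //).
have int1 phi x y : \int[law Z phi]_m G (m, x, y) <= 1.
  apply: (@le_trans _ _ (\int[law Z phi]_m cst 1 m)).
    by apply: le_integral_ae => //; apply: aeW.
  rewrite integral_cst// mul1e; exact: (@probability_le1 _ _ _ (law Z phi)).
have mG2 x y : measurable_fun setT (fun m => G (m, x, y)).
  by apply: measurableT_comp => //; do 2 apply: measurable_fun_pair => //.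
have g0 z : 0 <= g z by rewrite /g mule_ge0// ?lee_fin//; exact: integral_ge0.
rewrite /mean; have E (a b : V -> V) : \int[P]_omega \int[law Z (Phi omega)]_m
    (\esum_(x in base m) G (m, a x, b x)) =
    \int[P]_omega (\esum_(x in Phi omega) g (Phi omega, a x, b x)).
  apply/esym; apply: eq_integral_ae => [om|].
    by apply: integral_ge0 => m _; exact: esum_ge0.
  apply: (ae_imp (dom_ae Z)) => om od.
  rewrite /g /= indicE mem_set//; under eq_esum do rewrite mul1e.
  rewrite -integral_esum_config//; apply: eq_integral_ae.
    by move=> m; exact: esum_ge0.
  by rewrite lawE//; apply: (ae_imp (mlaw_base od)) => m ->.
apply: (eq_trans (E (fun _ => 0%R) id)); apply: (eq_trans _ (esym (E id (fun _ => 0%R)))).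
apply: (@mass_transport g) => //.
- apply: emeasurable_funM; last first.
    apply: (@measurable_integral_law _ _ Z _ _ (fun z : config R k * V * V => z.1.1) _
      (fun p => G (p.2, p.1.1.2, p.1.2))) => //.
    exact: (measurableT_comp measurable_fst measurable_fst).
  apply/measurable_EFinP; apply: (measurableT_comp (measurable_indic (measurable_dom Z))).
  by apply: measurableT_comp.
- move=> [[phi x] y]; rewrite ge0_fin_numE// (@le_lt_trans _ _ 1)// ?ltry// /g/=.
  by rewrite -[leRHS]mule1 lee_pmul// ?lee_fin//; exact: integral_ge0.
- move=> t phi x y px py; rewrite /g /=.
  have [dphi|ndphi] := pselect (dom Z phi); last first.
    by rewrite !indicE !memNset ?mul0e// => /dom_shiftE.
  rewrite !indicE !mem_set//; last exact: dom_shift.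
  congr (_ * _); rewrite integral_law_shift//; apply: eq_integral => m _.
  exact: Gshift.
Qed.

End equivariant_processes.

Lemma ge0_esumZl {R : realType} {T : choiceType} (A : set T) (c : R) (a : T -> \bar R) :
  (0 <= c)%R -> (forall x, 0 <= a x) ->
  \esum_(x in A) (c%:E * a x) = c%:E * \esum_(x in A) a x.
Proof.
move=> c0 a0.
(* This inequality holds for every nonnegative factor; the reverse one is its instance with factor
   [c^-1] and summand [c%:E * a x]. *)
have le (b : R) (f : T -> \bar R) : (0 <= b)%R -> (forall x, 0 <= f x) ->
    \esum_(x in A) (b%:E * f x) <= b%:E * \esum_(x in A) f x.
  move=> b0 f0; apply: ge_ereal_sup => _ [X [finX XA] <-].
  rewrite fsbig_finite//= -ge0_sume_distrr// lee_wpmul2l//.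
  by apply: esum_ge; exists X => //; rewrite fsbig_finite.
have [->|cn0] := eqVneq c 0%R.
  by rewrite mul0e esum1// => x _; rewrite mul0e.
have c_gt0 : (0 < c)%R by rewrite lt_neqAle eq_sym cn0.
apply/eqP; rewrite eq_le le//= -lee_pdivlMl//.
apply: le_trans (le c^-1%R _ _ _) => [||x]; last 2 first.
- by rewrite invr_ge0.
- by rewrite mule_ge0.
by apply: le_esum => x _; rewrite muleA -EFinM mulVf// mul1e.
Qed.

(** * Lower bound for the intensity of a covering *)

Section integral_cell_ratio.
Context {R : realType} {k : nat}.
Local Notation V := 'rV[R]_k.
Local Notation U := (measurableTypeR R).
Implicit Types (m : mconfig R k R) (s : R) (x : V).

Definition cell_ratio s m x : \bar R :=
  \int[uniform_cube k]_v share s m x (x + neg_cube_point s v)%R.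

Lemma cell_ratio_ge0 s m x : 0 <= cell_ratio s m x.
Proof. by apply: integral_ge0 => v _; exact: share_ge0. Qed.

Lemma measurable_share_shift s m x y :
  measurable_fun setT (fun v : k.-tuple U => share s m x (y + neg_cube_point s v)%R).
Proof. by apply: measurable_share => //; exact: measurable_neg_cube_point. Qed.

Lemma integral_uniform_cube_le1 (f : k.-tuple U -> \bar R) : (forall v, 0 <= f v) ->
  (forall v, f v <= 1) -> \int[uniform_cube k]_v f v <= 1.
Proof.
move=> f0 f1; apply: (@le_trans _ _ (\int[uniform_cube k]_v cst 1 v)).
  by apply: le_integral_ae => //; exact: aeW.
by rewrite integral_cst// mul1e; exact: probability_le1.
Qed.

Lemma cell_ratio_le1 s m x : cell_ratio s m x <= 1.
Proof.
by apply: integral_uniform_cube_le1 => v; [exact: share_ge0|exact: share_le1].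
Qed.

Lemma measurable_cell_ratio {d} {T : measurableType d} s (M : T -> mconfig R k R) (f : T -> V) :
  measurable_fun setT M -> measurable_fun setT f ->
  measurable_fun setT (fun t => cell_ratio s (M t) (f t)).
Proof.
move=> mM mf; apply: (measurable_fun_fubini_tonelli_F
  (fun z : T * k.-tuple U => share s (M z.1) (f z.1) (f z.1 + neg_cube_point s z.2)%R)).
  apply: measurable_share; [exact: measurableT_comp|exact: measurableT_comp|].
  by apply: measurable_neg_cube_point => //; exact: measurableT_comp.
by move=> z; exact: share_ge0.
Qed.

Lemma cell_ratio_shift s t m x : cell_ratio s (shift_mconfig t m) (x + t)%R = cell_ratio s m x.
Proof. by apply: eq_integral => v _; rewrite addrAC share_shift. Qed.

(* Every cell contains exactly one point of the lattice [s Z^k], which is used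
   to make the cells independent of [x]. *)
Lemma cell_ratio_le_lattice s rho N m x : (0 < s)%R -> (rho / s + 1 <= N%:R)%R ->
  box rho x -> cell_ratio s m x <=
  \sum_(f : {ffun 'I_k -> 'I_(N.*2.+1)})
    \int[uniform_cube k]_v share s m x ((\row_i (s * lattice f i)) + neg_cube_point s v)%R.
Proof.
move=> s0 Nrho bx; pose y (f : {ffun 'I_k -> 'I_(N.*2.+1)}) : V := (\row_i (s * lattice f i))%R.
have msh : measurable_fun setT (share s m x).
  by apply: measurable_share.
have mc z y' : measurable_fun setT (fun v : k.-tuple U => cube_in s (z + neg_cube_point s v)%R y').
  by apply: measurable_cube_in => //; exact: measurable_neg_cube_point.
have c0 f v : 0 <= share s m x (x + neg_cube_point s v)%R *
    cube_in s (x + neg_cube_point s v)%R (y f).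
  by rewrite mule_ge0// ?share_ge0// cube_in_ge0.
have mf f : measurable_fun setT (fun v : k.-tuple U => share s m x (x + neg_cube_point s v)%R *
    cube_in s (x + neg_cube_point s v)%R (y f)).
  by apply: emeasurable_funM => //; exact: measurable_share_shift.
have -> : cell_ratio s m x = \sum_f \int[uniform_cube k]_v
    (share s m x (x + neg_cube_point s v)%R * cube_in s (x + neg_cube_point s v)%R (y f)).
  rewrite -ge0_integral_sum//; apply: eq_integral_cube.
  - exact: measurable_share_shift.
  - by move=> v; exact: share_ge0.
  - by apply: emeasurable_sum => f.
  - by move=> v; apply: sume_ge0 => f _.
  - move=> v vI; rewrite -ge0_sume_distrr; last by move=> f _; exact: cube_in_ge0.
    have -> : \sum_f cube_in s (x + neg_cube_point s v)%R (y f) =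
        \sum_(f : {ffun 'I_k -> 'I_(N.*2.+1)}) cube_indic (fun i => - x ord0 i / s + lattice f i)%R v.
      apply: eq_bigr => f _; rewrite cube_in_cube_indic//; congr (cube_indic _ v).
      by apply/funext => i; rewrite mxE mulrBl mulrAC mulfV ?gt_eqF// mul1r mulNr addrC.
    rewrite sum_cube_indic ?mule1// => i; apply: le_trans Nrho; rewrite lerD2r.
    by rewrite mulNr normrN normrM normfV (gtr0_norm s0) ler_pM2r ?invr_gt0//; exact: bx.
(* The exchange turns a cell drawn around [x] and containing [y f] into a cell drawn around [y f]
   and containing [x]; dropping the last condition only increases the integral. *)
apply: lee_sum => f _; rewrite integral_cube_exchange//; last first.
  by move=> z; exact: share_ge0.
apply: le_integral_ae => [v|v|]; last apply: aeW => v.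
- by rewrite mule_ge0// ?share_ge0// cube_in_ge0.
- exact: share_ge0.
- rewrite /cube_in indicE; case: (_ \in _); rewrite ?mule1// mule0; exact: share_ge0.
Qed.

(** For each lattice point the shares in the cell anchored there sum to at most 1, so the bound is
    the number of lattice points. *)
Lemma esum_cell_ratio_box s rho N m : (0 < s)%R -> (rho / s + 1 <= N%:R)%R ->
  \esum_(x in base m) (cell_ratio s m x * (\1_(box rho) x)%:E) <=
  (#|{ffun 'I_k -> 'I_(N.*2.+1)}|%:R)%:E.
Proof.
move=> s0 Nrho.
pose I x (f : {ffun 'I_k -> 'I_(N.*2.+1)}) := \int[uniform_cube k]_v
   share s m x ((\row_i (s * lattice f i)) + neg_cube_point s v)%R.
have I0 x f : 0 <= I x f by apply: integral_ge0 => v _; exact: share_ge0.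
apply: (@le_trans _ _ (\esum_(x in base m) \sum_f I x f)).
  apply: le_esum => x _; rewrite indicE; have [bx|_] := boolP (x \in box rho).
    by rewrite mule1; apply: (cell_ratio_le_lattice (rho := rho)) => //; exact: set_mem.
  by rewrite mule0 sume_ge0.
rewrite esum_sum; last by move=> x f _ _; exact: I0.
apply: (@le_trans _ _ (\sum_(f : {ffun 'I_k -> 'I_(N.*2.+1)}) 1)); last first.
  by rewrite sumEFin big_const iter_addr_0.
apply: lee_sum => f _; rewrite /I -integral_esum_config.
- by apply: integral_uniform_cube_le1 => v; [apply: esum_ge0 => x _; exact: share_ge0|exact: esum_share].
- by move=> x; exact: measurable_share_shift.
- by move=> v x; exact: share_ge0.
Qed.

End integral_cell_ratio.

Section esum_box.
Context {R : realType} {k : nat}.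
Local Notation V := 'rV[R]_k.
Variables (phi : set V) (rho : R) (f : V -> \bar R).
Hypothesis f_ge0 : forall x, 0 <= f x.

Lemma le_esum_box (c : \bar R) : 0 <= c -> c \is a fin_num ->
  1 <= \esum_(x in phi) (f x * (\1_(box rho) x)%:E) ->
  c <= \esum_(x in phi) (c * f x * (\1_(box rho) (0 - x)%R)%:E).
Proof.
move=> c0 cfin f1.
rewrite (eq_esum (b := fun x => (fine c)%:E * (f x * (\1_(box rho) x)%:E))).
  rewrite ge0_esumZl ?fine_ge0//; last by move=> x; rewrite mule_ge0// lee_fin.
  by rewrite fineK// -[X in X <= _]mule1 lee_wpmul2l.
move=> x _; rewrite fineK// muleA; congr (_ * _).
rewrite !indicE; congr (_%:R%:E); congr nat_of_bool.
by apply/idP/idP => /set_mem bx; apply/mem_set => i; have := bx i; rewrite sub0r mxE normrN.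
Qed.

(** Mass received by the origin: now [c] is its probability of belonging to the covering, and [f]
    the mean shares of the points. *)
Lemma esum_box_le (c K : \bar R) : 0 <= c -> c \is a fin_num ->
  \esum_(x in phi) (f x * (\1_(box rho) x)%:E) <= K ->
  \esum_(x in phi) (f x * c * (\1_(box rho) (x - 0)%R)%:E) <= K * c.
Proof.
move=> c0 cfin fK.
rewrite (eq_esum (b := fun x => (fine c)%:E * (f x * (\1_(box rho) x)%:E))).
  rewrite ge0_esumZl ?fine_ge0//; last by move=> x; rewrite mule_ge0// lee_fin.
  by rewrite fineK// muleC lee_wpmul2r.
by move=> x _; rewrite fineK// subr0 muleA [f x * c]muleC.
Qed.

End esum_box.

Section point_mean.
Context {R : realType} {k : nat} {dO : measure_display}
  {Omega : measurableType dO} {P : probability Omega R}.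
Variable Phi : {RV P >-> config R k}.
Context {dX : measure_display} {Xi : measurableType dX}.
Variable Z : equivariant_process Phi Xi.
Local Notation V := 'rV[R]_k.
Variable f : mconfig R k Xi -> V -> \bar R.
Hypothesis f_ge0 : forall m x, 0 <= f m x.
Hypothesis f_le1 : forall m x, f m x <= 1.
Hypothesis mf : measurable_fun setT (fun p : mconfig R k Xi * V => f p.1 p.2).
Hypothesis f_shift : forall t m x, f (shift_mconfig t m) (x + t)%R = f m x.

(** The conditional expectation of [f] at [x] given the configuration, set to 0 off [dom Z] so as to
    be invariant and measurable everywhere. *)
Definition point_mean (phi : config R k) (x : V) : \bar R :=
  (\1_(dom Z) phi)%:E * \int[law Z phi]_m f m x.

Lemma point_meanE phi x : dom Z phi -> point_mean phi x = \int[law Z phi]_m f m x.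
Proof. by move=> dphi; rewrite /point_mean indicE mem_set// mul1e. Qed.

Lemma point_mean_ge0 phi x : 0 <= point_mean phi x.
Proof. by rewrite mule_ge0// ?lee_fin//; exact: integral_ge0. Qed.

Lemma point_mean_le1 phi x : point_mean phi x <= 1.
Proof.
apply: (@le_trans _ _ (1 * 1)); last by rewrite mule1.
apply: lee_pmul; rewrite ?lee_fin//; first exact: integral_ge0.
apply: (@le_trans _ _ (\int[law Z phi]_m cst 1 m)).
  by apply: le_integral_ae => //; exact: aeW.
by rewrite integral_cst// mul1e; exact: probability_le1.
Qed.

Lemma point_mean_fin phi x : point_mean phi x \is a fin_num.
Proof.
rewrite ge0_fin_numE; last exact: point_mean_ge0.
by apply: le_lt_trans (point_mean_le1 _ _) _; rewrite ltry.
Qed.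

Lemma measurable_integrand x : measurable_fun setT (f ^~ x).
Proof. exact: (measurableT_comp mf (pair2_measurable x)). Qed.

Lemma point_mean_shift t phi x :
  point_mean (shift_config t phi) (x + t)%R = point_mean phi x.
Proof.
have [dphi|ndphi] := pselect (dom Z phi); last first.
  by rewrite /point_mean !indicE !memNset ?mul0e// => /dom_shiftE.
rewrite !point_meanE//; last exact: dom_shift.
rewrite integral_law_shift//; last exact: measurable_integrand.
by apply: eq_integral => m _; exact: f_shift.
Qed.

Lemma measurable_point_mean {d} {T : measurableType d} (F : T -> config R k) (h : T -> V) :
  measurable_fun setT F -> measurable_fun setT h ->
  measurable_fun setT (fun t => point_mean (F t) (h t)).
Proof.
move=> mF mh; apply: emeasurable_funM.
  apply/measurable_EFinP; apply: (measurableT_comp (measurable_indic (measurable_dom Z))).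
  exact: mF.
apply: (measurable_integral_law Z mF (f := fun p => f p.2 (h p.1))) => //.
apply: (@measurableT_comp _ _ _ _ _ _ (fun p : mconfig R k Xi * V => f p.1 p.2) _
  (fun p : T * mconfig R k Xi => (p.2, h p.1))) => //.
by apply: measurable_fun_pair => //; exact: measurableT_comp.
Qed.

Lemma esum_point_mean phi (A : set V) : dom Z phi ->
  \esum_(x in phi) (point_mean phi x * (\1_A x)%:E) =
  \int[law Z phi]_m \esum_(x in base m) (f m x * (\1_A x)%:E).
Proof.
move=> dphi.
have fA0 m x : 0 <= f m x * (\1_A x)%:E by rewrite mule_ge0// lee_fin.
transitivity (\int[law Z phi]_m (\esum_(x in phi) (f m x * (\1_A x)%:E))).
  rewrite integral_esum_config//.
    apply: eq_esum => x _; rewrite point_meanE// ge0_integralZr//.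
      exact: measurable_integrand.
  by move=> x; apply: emeasurable_funM => //; exact: measurable_integrand.
apply: eq_integral_ae => [m|]; first exact: esum_ge0.
by rewrite lawE//; apply: (ae_imp (mlaw_base dphi)) => m ->.
Qed.

End point_mean.

Section covering_lower_bound.
Context {R : realType} {k : nat} {dO : measure_display}
  {Omega : measurableType dO} {P : probability Omega R}.
Variable Phi : {RV P >-> config R k}.
Local Notation V := 'rV[R]_k.
Hypothesis Phi_stationary : point_stationary Phi.

Lemma measurable_subset_of {d} {T : measurableType d} (M : T -> mconfig R k bool) (f : T -> V) :
  measurable_fun setT M -> measurable_fun setT f ->
  measurable [set t | subset_of (M t) (f t)].
Proof.
move=> mM mf; pose D := [set z : T * V * bool | f z.1.1 = z.1.2] `&` [set z | z.2 = true].
have mD : measurable D.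
  apply: measurableI.
    apply: measurable_eq_row; last exact: (measurableT_comp measurable_snd measurable_fst).
    exact: (measurableT_comp mf (measurableT_comp measurable_fst measurable_fst)).
  rewrite -[X in measurable X]setTI.
  by apply: (measurable_snd measurableT [set true]).
rewrite [X in measurable X](_ : _ =
   [set t | 0 < \esum_(x in base (M t)) (\1_D (t, x, pmark (M t) x))%:E :> \bar R]).
  rewrite -[X in measurable X]setTI; apply: emeasurable_fun_o_infty => //.
  apply: (measurable_esum_pmark (f := fun z => (\1_D z)%:E)) => //.
  exact/measurable_EFinP/measurable_indic.
apply/seteqP; split=> t /=.
  move=> [pt mt]; apply: (@lt_le_trans _ _ 1) => //.
  apply: le_trans (esum_ge_term (fun x => (\1_D (t, x, pmark (M t) x))%:E) pt).
  by rewrite indicE mem_set.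
apply: contraPP => nt; rewrite esum1 ?ltxx// => x px.
rewrite indicE memNset// => -[/= fx mx]; apply: nt.
by rewrite /subset_of/= fx.
Qed.

Definition selected (m : mconfig R k bool) (x : V) : \bar R := (`[< subset_of m x >]%:R)%:E.

Lemma selected_ge0 m x : 0 <= selected m x. Proof. by rewrite lee_fin. Qed.

Lemma selected_le1 m x : selected m x <= 1.
Proof. by rewrite /selected lee_fin; case: (`[< _ >]). Qed.

Lemma measurable_selected {d} {T : measurableType d} (M : T -> mconfig R k bool) (f : T -> V) :
  measurable_fun setT M -> measurable_fun setT f ->
  measurable_fun setT (fun t => selected (M t) (f t)).
Proof.
move=> mM mf; apply/measurable_EFinP.
rewrite [X in measurable_fun _ X](_ : _ = \1_[set t | subset_of (M t) (f t)]).
  by apply: measurable_indic; exact: measurable_subset_of.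
by apply/funext => t; rewrite indicE; congr (_%:R); congr nat_of_bool.
Qed.

Lemma selected_shift t m x : selected (shift_mconfig t m) (x + t)%R = selected m x.
Proof.
rewrite /selected; do 2 f_equal; congr nat_of_bool; apply: asbool_equiv_eq.
rewrite -[subset_of m x]/(points (base m) x /\ pmark m x = true).
by rewrite -(points_shift t) -(pmark_shift t).
Qed.

Lemma intensityE (S : equivariant_process Phi bool) :
  intensity S = mean S (fun m => selected m 0%R).
Proof.
apply: eq_integral_ae => [om|]; first by apply: integral_ge0 => m _; exact: selected_ge0.
apply: (ae_imp (dom_ae S)) => om od; rewrite lawE//.
transitivity (\int[mlaw S (Phi om)]_m (\1_[set m | subset_of m 0%R] m)%:E); last first.
  by apply: eq_integral => m _; rewrite /selected indicE.
rewrite integral_indic ?setIT//.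
exact: (measurable_subset_of (M := id) (f := cst 0%R)).
Qed.

Lemma enorm_ge_coord (x : V) i : (`|x ord0 i| <= enorm x)%R.
Proof.
rewrite -sqrtr_sqr /enorm ler_wsqrtr// (bigD1 i)//= lerDl sumr_ge0// => j _.
exact: sqr_ge0.
Qed.

Variable d : config R k -> V -> V -> R.
Variables (c : R) (c_gt0 : (0 < c)%R).
Hypothesis d_lower : {ae P, forall omega, forall x y, points (Phi omega) x ->
  points (Phi omega) y -> (c * enorm (x - y) <= d (Phi omega) x y)%R}.
Variable w : equivariant_process Phi R.

(** Some point of the covering is within distance r of the origin; the lower metric bound puts it in
    the box of radius r / c, where it alone contributes 1 to the sum. *)
Lemma covering_near_origin r (S : equivariant_process Phi bool) phi :
  dom S phi ->
  (forall x y, points phi x -> points phi y -> (c * enorm (x - y) <= d phi x y)%R) ->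
  points phi 0%R ->
  {ae law S phi, forall m, base m `<=` \bigcup_(v in subset_of m) nball d (base m) r v} ->
  1 <= \int[law S phi]_m \esum_(x in base m) (selected m x * (\1_(box (r / c)) x)%:E).
Proof.
move=> dS dl p0 cov.
apply: (@le_trans _ _ (\int[law S phi]_m cst 1 m)).
  by rewrite integral_law_cst.
apply: le_integral_ae => // [m|].
  by apply: esum_ge0 => x _; rewrite mule_ge0 ?selected_ge0// lee_fin.
have mb : {ae law S phi, forall m, base m = phi} by rewrite lawE//; exact: mlaw_base.
apply: (ae_imp2 cov mb) => m cm bm.
have p0' : points (base m) 0%R by rewrite bm.
have [v [pv vS] [_ dv]] := cm 0%R p0'.
apply: le_trans (esum_ge_term _ pv).
rewrite /selected asboolT//.
rewrite mul1e indicE mem_set// => i.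
rewrite ler_pdivlMr// mulrC (le_trans _ dv)//.
rewrite bm in pv *; rewrite (le_trans _ (dl _ _ pv p0))//.
by rewrite subr0 ler_pM2l// enorm_ge_coord.
Qed.

(* In the mass transport each point [x] sends its expected share of the weight
   of its cell to every point [y] of the covering which is close to [x]. *)
Lemma mean_cell_ratio_le_intensity s r N (S : equivariant_process Phi bool) :
  (0 < s)%R -> (r / c / s + 1 <= N%:R)%R -> is_covering d r S ->
  mean w (fun m => cell_ratio s m 0%R) <=
  (#|{ffun 'I_k -> 'I_(N.*2.+1)}|%:R)%:E * intensity S.
Proof.
move=> s0 Nr Scov; set K : R := #|_|%:R; pose rho := (r / c)%R.
have Kbox (m : mconfig R k R) : \esum_(x in base m) (cell_ratio s m x * (\1_(box rho) x)%:E) <= K%:E.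
  exact: esum_cell_ratio_box.
have K0 : (0 <= K)%R by rewrite /K.
clearbody K.
have sel0 om : 0 <= \int[law S (Phi om)]_m selected m 0%R.
  by apply: integral_ge0 => m _; exact: selected_ge0.
have -> : K%:E * intensity S =
    \int[P]_omega (K%:E * \int[law S (Phi omega)]_m selected m 0%R).
  rewrite intensityE ge0_integralZl_EFin//.
  apply: measurable_mean_inner; last by move=> m; exact: selected_ge0.
  exact: (measurable_selected (M := id) (f := cst 0%R)).
have mcr : measurable_fun setT (fun p : mconfig R k R * V => cell_ratio s p.1 p.2).
  exact: measurable_cell_ratio.
have msel : measurable_fun setT (fun p : mconfig R k bool * V => selected p.1 p.2).
  exact: measurable_selected.
(* [w] and [S] come with separate conditional laws. The product of these two means depends on the
   configuration only, and no coupling is required. *)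
pose a := point_mean w (cell_ratio s); pose b := point_mean S selected.
have a0 : forall phi x, 0 <= a phi x := point_mean_ge0 w (@cell_ratio_ge0 _ _ s).
have b0 : forall phi x, 0 <= b phi x := point_mean_ge0 S selected_ge0.
have afin : forall phi x, a phi x \is a fin_num.
  by apply: point_mean_fin; [exact: cell_ratio_ge0|exact: cell_ratio_le1].
have bfin : forall phi x, b phi x \is a fin_num.
  by apply: point_mean_fin; [exact: selected_ge0|exact: selected_le1].
have ma d' (T : measurableType d') (F : T -> config R k) (h : T -> V) :
    measurable_fun setT F -> measurable_fun setT h -> measurable_fun setT (fun t => a (F t) (h t)).
  exact: (measurable_point_mean w (@cell_ratio_ge0 _ _ s) mcr).
have mb d' (T : measurableType d') (F : T -> config R k) (h : T -> V) :
    measurable_fun setT F -> measurable_fun setT h -> measurable_fun setT (fun t => b (F t) (h t)).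
  exact: (measurable_point_mean S selected_ge0 msel).
have a_shift : forall t phi x, a (shift_config t phi) (x + t)%R = a phi x.
  exact: (point_mean_shift w (@cell_ratio_ge0 _ _ s) mcr (@cell_ratio_shift _ _ s)).
have b_shift : forall t phi x, b (shift_config t phi) (x + t)%R = b phi x.
  exact: (point_mean_shift S selected_ge0 msel selected_shift).
have aE : forall phi x, dom w phi -> a phi x = \int[law w phi]_m cell_ratio s m x.
  exact: point_meanE.
have bE : forall phi x, dom S phi -> b phi x = \int[law S phi]_m selected m x.
  exact: point_meanE.
have a_sum : forall phi A, dom w phi -> \esum_(x in phi) (a phi x * (\1_A x)%:E) =
    \int[law w phi]_m \esum_(x in base m) (cell_ratio s m x * (\1_A x)%:E).
  exact: (esum_point_mean (@cell_ratio_ge0 _ _ s) mcr).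
have b_sum : forall phi A, dom S phi -> \esum_(x in phi) (b phi x * (\1_A x)%:E) =
    \int[law S phi]_m \esum_(x in base m) (selected m x * (\1_A x)%:E).
  exact: (esum_point_mean selected_ge0 msel).
clearbody a b.
pose g (z : config R k * V * V) : \bar R :=
  a z.1.1 z.1.2 * b z.1.1 z.2 * (\1_(box rho) (z.1.2 - z.2)%R)%:E.
have g0 z : 0 <= g z.
  apply: mule_ge0; last by rewrite lee_fin.
  by apply: mule_ge0; [exact: a0|exact: b0].
have mfst : measurable_fun setT (fun z : config R k * V * V => z.1.1).
  exact: (measurableT_comp measurable_fst measurable_fst).
have msnd : measurable_fun setT (fun z : config R k * V * V => z.1.2).
  exact: (measurableT_comp measurable_snd measurable_fst).
have MT : \int[P]_omega (\esum_(x in Phi omega) g (Phi omega, 0%R, x)) =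
  \int[P]_omega (\esum_(x in Phi omega) g (Phi omega, x, 0%R)).
  apply: (mass_transport Phi_stationary _ g0).
  - apply: emeasurable_funM; first apply: emeasurable_funM.
    + exact: ma mfst msnd.
    + exact: mb mfst measurable_snd.
    + apply/measurable_EFinP; apply: (measurableT_comp (measurable_indic (measurable_box rho))).
      by apply: measurable_rowB => //.
  - by move=> [[phi x] y]; rewrite fin_numM// fin_numM.
  - move=> t phi x y px py; rewrite /g /=.
    have -> : (x + t - (y + t) = x - y)%R by rewrite opprD addrACA subrr addr0.
    by rewrite a_shift b_shift.
(* Sent mass: at least one point of the covering is expected in the box, so the origin sends at
   least its own mean share. *)
apply: (@le_trans _ _ (\int[P]_omega (\esum_(x in Phi omega) g (Phi omega, 0%R, x)))).
  apply: le_integral_ae.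
  - by move=> om; apply: integral_ge0 => m _; exact: cell_ratio_ge0.
  - by move=> om; exact: esum_ge0.
  apply: (ae_imp2 (ae_imp2 (process_as_law Scov) d_lower (fun om x y => conj x y))
    (ae_imp2 (ae_imp2 (dom_ae w) (dom_ae S) (fun om x y => conj x y)) Phi_stationary.1
      (fun om x y => conj x y))) => om [cov dl] [[dw dS] p0].
  apply: (@le_trans _ _ (a (Phi om) 0%R)); first by rewrite (aE _ _ dw).
  apply: le_esum_box; [exact: b0|exact: a0|exact: afin|].
  rewrite (b_sum (Phi om) (box rho) dS).
  have covS : {ae law S (Phi om), forall m, base m `<=` \bigcup_(v in subset_of m) nball d (base m) r v}.
    exact: cov.
  exact: (covering_near_origin dS dl p0 covS).
rewrite [leLHS]MT.
apply: le_integral_ae.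
- by move=> om; exact: esum_ge0.
- by move=> om; apply: mule_ge0; [rewrite lee_fin|exact: sel0].
apply: (ae_imp2 (dom_ae w) (dom_ae S)) => om dw dS.
(* Received mass: the mean shares in the box add up to at most [K], and all of them are multiplied
   by the same [b] at the origin. *)
apply: (@le_trans _ _ (K%:E * b (Phi om) 0%R)); last by rewrite (bE _ _ dS).
apply: (@esum_box_le _ _ (Phi om) rho (a (Phi om)) (a0 _) (b (Phi om) 0%R) K%:E); [exact: b0|exact: bfin|].
rewrite (a_sum (Phi om) (box rho) dw).
apply: (@le_trans _ _ (\int[law w (Phi om)]_m cst K%:E m)); last first.
  by rewrite integral_law_cst.
apply: le_integral_ae => [m|m|].
- by apply: esum_ge0 => x _; rewrite mule_ge0 ?cell_ratio_ge0// lee_fin.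
- by rewrite lee_fin.
- exact: aeW.
Qed.

End covering_lower_bound.

(** * The grid covering *)

Section first_share.
Context {R : realType} {k : nat}.
Local Notation V := 'rV[R]_k.
Local Notation U := (measurableTypeR R).
Implicit Types (m : mconfig R k R) (s : R) (x y : V).

Lemma first_in_le1 s phi z x : first_in s phi z x <= 1 :> \bar R.
Proof. by rewrite /first_in lee_fin; case: (`[< _ >]). Qed.

Lemma first_in_cube s (phi : config R k) z x :
  first_in s phi z x * cube_in s z x = first_in s phi z x.
Proof.
rewrite /first_in /cube_in indicE; case: asboolP => [[_ zx _]|_]; last by rewrite mul0e.
by rewrite mem_set// mule1.
Qed.

(* In the mass transport each point [x] sends its share of the weight of its cell
   to the first point of that cell. *)
Definition first_share s m x y : \bar R :=
  \int[uniform_cube k]_v (share s m x (x + neg_cube_point s v)%R *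
    first_in s (base m) (x + neg_cube_point s v)%R y).

Lemma share_first_ge0 s m x y z : 0 <= share s m x z * first_in s (base m) z y.
Proof. by rewrite mule_ge0 ?share_ge0 ?first_in_ge0. Qed.

Lemma measurable_share_first {d} {T : measurableType d} s (M : T -> mconfig R k R) (f g h : T -> V) :
  measurable_fun setT M -> measurable_fun setT f -> measurable_fun setT g ->
  measurable_fun setT h ->
  measurable_fun setT (fun t => share s (M t) (f t) (h t) * first_in s (base (M t)) (h t) (g t)).
Proof.
move=> mM mf mg mh; apply: emeasurable_funM; first exact: measurable_share.
apply: measurable_first_in => //.
exact: (measurableT_comp (@measurable_base R k _ _)).
Qed.

Lemma first_share_ge0 s m x y : 0 <= first_share s m x y.
Proof. by apply: integral_ge0 => v _; exact: share_first_ge0. Qed.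

Lemma first_share_le1 s m x y : first_share s m x y <= 1.
Proof.
apply: integral_uniform_cube_le1 => v; first exact: share_first_ge0.
apply: (@le_trans _ _ (1 * 1)); last by rewrite mule1.
by apply: lee_pmul; rewrite ?share_ge0 ?first_in_ge0 ?share_le1 ?first_in_le1.
Qed.

Lemma first_share_shift s t m x y :
  first_share s (shift_mconfig t m) (x + t)%R (y + t)%R = first_share s m x y.
Proof.
apply: eq_integral => v _.
have -> : (x + t + neg_cube_point s v = x + neg_cube_point s v + t)%R by rewrite addrAC.
by rewrite share_shift first_in_shift.
Qed.

Lemma measurable_first_share s :
  measurable_fun setT (fun z : mconfig R k R * V * V => first_share s z.1.1 z.1.2 z.2).
Proof.
have m1 : measurable_fun setT (fun p : (mconfig R k R * V * V) * k.-tuple U => p.1.1.1).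
  exact: (measurableT_comp measurable_fst (measurableT_comp measurable_fst measurable_fst)).
have m2 : measurable_fun setT (fun p : (mconfig R k R * V * V) * k.-tuple U => p.1.1.2).
  exact: (measurableT_comp measurable_snd (measurableT_comp measurable_fst measurable_fst)).
have m3 : measurable_fun setT (fun p : (mconfig R k R * V * V) * k.-tuple U => p.1.2).
  exact: (measurableT_comp measurable_snd measurable_fst).
apply: (measurable_fun_fubini_tonelli_F
  (fun p : (mconfig R k R * V * V) * k.-tuple U =>
    share s p.1.1.1 p.1.1.2 (p.1.1.2 + neg_cube_point s p.2)%R *
    first_in s (base p.1.1.1) (p.1.1.2 + neg_cube_point s p.2)%R p.1.2)).
  apply: (measurable_share_first s m1 m2 m3).
  exact: measurable_neg_cube_point.
by move=> p; exact: share_first_ge0.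
Qed.

(** A cell containing [x] is nonempty and has exactly one first point, so the whole share is passed
    on; for the other cells the share is already 0. *)
Lemma esum_first_share_out s m x : points (base m) x ->
  \esum_(y in base m) first_share s m x y = cell_ratio s m x.
Proof.
move=> px; rewrite -integral_esum_config.
- apply: eq_integral => v _; set z := (x + _)%R.
  rewrite -(fineK (x := share s m x z)); last first.
    by rewrite ge0_fin_numE ?share_ge0// (le_lt_trans (share_le1 _ _ _ _))// ltry.
  rewrite ge0_esumZl ?fine_ge0 ?share_ge0//; last by move=> ?; exact: first_in_ge0.
  have [zx|zx] := pselect (cube s z x); first by rewrite (esum_first_in px zx) mule1.
  by rewrite /share /cube_in indicE memNset// mule0 mul0e.
- move=> y; apply: measurable_share_first => //.
  exact: measurable_neg_cube_point.
- by move=> v y; exact: share_first_ge0.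
Qed.

(** The exchange anchors all cells at [y]. When [y] is the first point of such a cell it collects
    all the shares, which sum to 1 because the positive weight of [y] makes the weight of the cell
    nonzero. *)
Lemma esum_first_share_in s m y : (0 < s)%R -> points (base m) y -> (0 < weight m y)%R ->
  \esum_(x in base m) first_share s m x y =
  \int[uniform_cube k]_v first_in s (base m) (y + neg_cube_point s v)%R y.
Proof.
move=> s0 py wy.
have mz x : measurable_fun setT (fun v : k.-tuple U => x + neg_cube_point s v)%R.
  exact: measurable_neg_cube_point.
have E x : first_share s m x y = \int[uniform_cube k]_v
    (share s m x (y + neg_cube_point s v)%R *
     first_in s (base m) (y + neg_cube_point s v)%R y).
  pose F z := share s m x z * first_in s (base m) z y.
  transitivity (\int[uniform_cube k]_v (F (x + neg_cube_point s v)%R *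
     cube_in s (x + neg_cube_point s v)%R y)).
    by apply: eq_integral => v _; rewrite /F -[RHS]muleA first_in_cube.
  rewrite integral_cube_exchange//.
  - apply: eq_integral => v _; rewrite /F muleAC /share; congr (_ * _).
    by rewrite /cube_in indicE; case: (_ \in _); rewrite ?mule1 ?mule0.
  - exact: (measurable_share_first s (M := cst m) (f := cst x) (g := cst y) (h := id)).
  - by move=> z; exact: share_first_ge0.
under eq_esum do rewrite E.
rewrite -integral_esum_config.
- apply: eq_integral => v _; set z := (y + _)%R.
  rewrite (eq_esum (b := fun x => (fine (first_in s (base m) z y))%:E * share s m x z)); last first.
    by move=> x _; rewrite muleC /first_in.
  rewrite ge0_esumZl; last 2 first.
  - by rewrite fine_ge0// first_in_ge0.
  - by move=> x; exact: share_ge0.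
  rewrite /first_in; case: asboolP => [[_ zy _]|_]; last by rewrite mul0e.
  rewrite esum_share_eq1 ?mule1//; apply/eqP => W0.
  by have := weight_le_cell m zy; rewrite W0 lee_fin leNgt wy.
- move=> x; exact: (@measurable_share_first _ _ s (cst m) (cst x) (cst y) _ (measurable_cst _)
    (measurable_cst _) (measurable_cst _) (mz y)).
- by move=> v x; exact: share_first_ge0.
Qed.

End first_share.

Lemma process_as_imp {R : realType} {k : nat} {dO} {Omega : measurableType dO} {P : probability Omega R}
    {Phi : {RV P >-> config R k}} {dX} {Xi : measurableType dX} (Z : equivariant_process Phi Xi)
    (Q1 Q2 : mconfig R k Xi -> Prop) :
  (forall m, Q1 m -> Q2 m) -> process_as Z Q1 -> process_as Z Q2.
Proof. by move=> QQ as1; apply: (ae_imp as1) => om a1; exact: (ae_imp a1 QQ). Qed.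

Section grid_intensity.
Context {R : realType} {k : nat} {dO : measure_display}
  {Omega : measurableType dO} {P : probability Omega R}.
Variable Phi : {RV P >-> config R k}.
Hypothesis Phi_stationary : point_stationary Phi.
Variable w : equivariant_process Phi R.
Hypothesis w_pos : process_as w (fun m : mconfig R k R => (0 < pmark m 0)%R).

(** The weight has disappeared on the right: this is why every weight positive at the origin yields
    the same exponents. Positivity enters through [esum_first_share_in]. *)
Lemma mean_cell_ratioE s : (0 < s)%R ->
  mean w (fun m => cell_ratio s m 0) =
  \int[P]_om \int[uniform_cube k]_v first_in s (Phi om) (0 + neg_cube_point s v)%R 0%R.
Proof.
move=> s0.
have H0 : process_as w (fun m => points (base m) 0%R).
  exact: (process_as_base (A := fun phi => points phi 0%R) w Phi_stationary.1).
pose I (phi : config R k) := \int[uniform_cube k]_v first_in s phi (0 + neg_cube_point s v)%R 0%R.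
have I0 phi : 0 <= I phi by apply: integral_ge0 => v _; exact: first_in_ge0.
transitivity (mean w (fun m => \esum_(x in base m) first_share s m 0%R x)).
  apply: eq_mean.
  - by move=> m; exact: cell_ratio_ge0.
  - by move=> m; apply: esum_ge0 => x _; exact: first_share_ge0.
  - by move: H0; apply: process_as_imp => m pm; rewrite (esum_first_share_out s pm).
rewrite (mass_transport_process Phi_stationary w (measurable_first_share s)).
- transitivity (mean w (fun m => I (base m))).
    apply: eq_mean.
    + by move=> m; apply: esum_ge0 => x _; exact: first_share_ge0.
    + by move=> m; exact: I0.
    + move: (process_as_and H0 w_pos); apply: process_as_imp => m [pm wm].
      by rewrite /= (esum_first_share_in s0 pm)// /weight asboolT//= lt_max wm.
  have fI phi : I phi = (fine (I phi))%:E.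
    rewrite fineK// ge0_fin_numE// (@le_lt_trans _ _ 1) ?ltry//.
    by apply: integral_uniform_cube_le1 => v; [exact: first_in_ge0|exact: first_in_le1].
  apply: eq_integral_ae => [om|]; first exact: I0.
  apply: (ae_imp (dom_ae w)) => om domw.
  rewrite -/(I (Phi om)) fI -(integral_law_cst w (Phi om)).
  apply: eq_integral_ae => [m|]; first by rewrite /= -fI.
  by rewrite lawE//; apply: (ae_imp (mlaw_base domw)) => m -> /=; rewrite -fI.
- by move=> z; exact: first_share_ge0.
- by move=> z; exact: first_share_le1.
- by move=> *; exact: first_share_shift.
Qed.

End grid_intensity.

Lemma measurable_indic_comp {d d'} {T : measurableType d} {T' : measurableType d'} {R : realType}
    (A : set T') (f : T -> T') : measurable A -> measurable_fun setT f ->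
  measurable_fun setT (fun t => (\1_A (f t))%:E : \bar R).
Proof.
move=> mA mf; apply/measurable_EFinP.
apply: (@measurable_indic _ _ R setT (f @^-1` A)).
by rewrite -[X in measurable X]setTI; exact: mf.
Qed.

(** * The uniformly translated grid *)

Section grid.
Context {R : realType} {k : nat}.
Local Notation V := 'rV[R]_k.
Local Notation U := (measurableTypeR R).
Implicit Types (s : R) (v : k.-tuple U) (x y : V) (phi : config R k).

(** Lower corner of the cell of [x] in the grid s (Z^k - v). *)
Definition corner s v x : V :=
  \row_i (s * ((Num.floor (x ord0 i / s + tnth v i))%:~R - tnth v i))%R.

Lemma corner_cube s v x : (0 < s)%R -> cube s (corner s v x) x.
Proof.
move=> s0 i; rewrite mxE.
have -> : x ord0 i = (s * (x ord0 i / s + tnth v i - tnth v i))%R.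
  by rewrite addrK mulrC divfK ?gt_eqF.
rewrite addrK -[X in (_ < _ + X)%R]mulr1 -mulrDr !(ler_pM2l, ltr_pM2l)//.
rewrite [(s * _ / s)%R]mulrAC divff ?gt_eqF// mul1r.
by have /andP[l1 l2] := floor_itv (x ord0 i / s + tnth v i)%R; move: l1 l2; rewrite intrD; lra.
Qed.

Lemma corner_eq s v x y : (0 < s)%R -> cube s (corner s v x) y -> corner s v y = corner s v x.
Proof.
move=> s0 xy; apply/rowP => i; rewrite !mxE; congr (_ * (_%:~R - _))%R.
apply: floor_def; move: (xy i); rewrite mxE intrD.
set q := (Num.floor _)%:~R%R; set u := tnth v i : R.
rewrite -[X in (_ < _ + X)%R]mulr1 -mulrDr -ler_pdivlMl// -ltr_pdivrMl// [(_^-1 * _)%R]mulrC.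
by lra.
Qed.

(** A translation by t only moves the offset of the grid by t / s; with the periodicity
    [corner_lattice], a uniform offset yields a translation-invariant law. *)
Lemma corner_shift s v x t : (0 < s)%R ->
  corner s v (x + t)%R = (corner s (shift_tuple (fun i => t ord0 i / s)%R v) x + t)%R.
Proof.
move=> s0; apply/rowP => i; rewrite !mxE /shift_tuple tnth_mktuple.
rewrite mulrDl addrAC -addrA; set q := (Num.floor _)%:~R%R.
have -> : t ord0 i = (s * (t ord0 i / s))%R by rewrite mulrC divfK ?gt_eqF.
rewrite [(s * _ / s)%R]mulrAC divff ?gt_eqF// mul1r. set u := tnth v i : R. by lra.
Qed.

Lemma corner_lattice s N (f : {ffun 'I_k -> 'I_(N.*2.+1)}) v x :
  corner s (shift_tuple (lattice f) v) x = corner s v x.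
Proof.
apply/rowP => i; rewrite !mxE /shift_tuple tnth_mktuple /lattice.
have -> : ((f i)%:R - N%:R)%R = ((f i)%:Z - N%:Z)%:~R :> R by rewrite intrB.
by rewrite addrA floorDrz ?intr_int// intrKfloor intrD; set u := tnth v i : R; lra.
Qed.

(** The link with the cubes of the theorem: in the random grid the cell of the origin is C_s +
    U_s. *)
Lemma corner_unit0 s v : (0 < s)%R -> (forall i, (0 <= (tnth v i : R) < 1)%R) ->
  corner s v 0%R = neg_cube_point s v.
Proof.
move=> s0 vI; apply/rowP => i; rewrite !mxE mul0r add0r.
by rewrite (floor_def (m := 0)) ?sub0r ?mulrN// add0r vI.
Qed.

Lemma measurable_corner s {d} {T : measurableType d} (f : T -> V) (g : T -> k.-tuple U) :
  measurable_fun setT f -> measurable_fun setT g ->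
  measurable_fun setT (fun t => corner s (g t) (f t)).
Proof.
move=> mf mg; apply: measurable_row => i; rewrite [X in measurable_fun _ X](_ : _ =
  (fun t : T => s * ((Num.floor (f t ord0 i / s + tnth (g t) i))%:~R - tnth (g t) i))%R); last first.
  by apply/funext => t; rewrite mxE.
have mg' : measurable_fun setT (fun t => tnth (g t) i : R).
  exact: (measurableT_comp (measurable_tnth i) mg).
apply: measurable_funM => //; apply: measurable_funB => //.
apply: (measurableT_comp (f := fun y : R => (Num.floor y)%:~R%R : R)).
  apply: nondecreasing_measurable => // y z yz.
  by rewrite ler_int; exact: le_floor.
apply: measurable_funD => //; apply: measurable_funM => //.
exact: (measurableT_comp (measurable_coord i) mf).
Qed.

(** [subset_of] reads the diagonal marks only, so a pair is simply given the mark of its first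
    point. *)
Definition grid_mark s phi v : mconfig R k bool :=
  MConfig phi (fun x _ => `[< is_first s phi (corner s v x) x >]).

Lemma grid_mark_shift s phi v t : (0 < s)%R -> grid_mark s (shift_config t phi) v =
  shift_mconfig t (grid_mark s phi (shift_tuple (fun i => t ord0 i / s)%R v)).
Proof.
move=> s0; rewrite /grid_mark /shift_mconfig /=; congr MConfig.
apply/funext => x; apply/funext => _.
have {1 2}-> : x = (x - t + t)%R by rewrite subrK.
rewrite corner_shift//; apply: asbool_equiv_eq; exact: is_first_shift.
Qed.

Lemma grid_mark_lattice s phi N (f : {ffun 'I_k -> 'I_(N.*2.+1)}) v :
  grid_mark s phi (shift_tuple (lattice f) v) = grid_mark s phi v.
Proof.
rewrite /grid_mark; congr MConfig.
by apply/funext => x; apply/funext => _; rewrite corner_lattice.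
Qed.

(** Counting events become level sets of sums over points. An infinite [A] is excluded by a subset
    with more than [n] elements. *)
Lemma card_eq_esum {T : choiceType} (A : set T) n :
  A #= `I_n <-> \esum_(x in A) 1 = n%:R%:E :> \bar R.
Proof.
have finE (B : set T) m : B #= `I_m -> \esum_(x in B) 1 = m%:R%:E :> \bar R.
  move=> Bm; have fB : finite_set B by apply/finite_setP; exists m.
  rewrite esum_fset// fsbig_finite//= -(card_fset_set Bm) sumEFin big_const_seq count_predT.
  by rewrite iter_addr_0.
split; first exact: finE.
move=> An; have [/finite_setP[m Am]|infA] := pselect (finite_set A).
  by have := finE _ _ Am; rewrite An => -[] /eqP; rewrite eqr_nat => /eqP ->.
have [B BA Bn] := @infinite_set_fset _ A n.+1 infA.
have := subset_esum (a := fun=> 1 : \bar R) BA (fun _ _ => lee01).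
rewrite An (finE _ #|` B|); last by apply/card_eq_fsetP.
by rewrite lee_fin ler_nat leqNgt Bn.
Qed.

Lemma measurable_grid_mark {d} {T : measurableType d} s (Phi : T -> config R k)
    (g : T -> k.-tuple U) :
  measurable_fun setT Phi -> measurable_fun setT g ->
  measurable_fun setT (fun t => grid_mark s (Phi t) (g t)).
Proof.
move=> mPhi mg; apply: measurable_fun_mconfig => // B n mB; rewrite setTI.
pose b (z : T * V * V) := (\1_B (z.1.2, z.2, mark (grid_mark s (Phi z.1.1) (g z.1.1)) z.1.2 z.2))%:E : \bar R.
have b0 z : 0 <= b z by rewrite lee_fin.
have mq : measurable_fun setT (fun z : T * V * V =>
    ((z.1.2, z.2), mark (grid_mark s (Phi z.1.1) (g z.1.1)) z.1.2 z.2)).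
  have m1 : measurable_fun setT (fun z : T * V * V => z.1.1) by exact: measurableT_comp.
  have m2 : measurable_fun setT (fun z : T * V * V => z.1.2) by exact: measurableT_comp.
  apply: measurable_fun_pair; first exact: measurable_fun_pair.
  apply: (measurable_fun_bool true); rewrite setTI.
  rewrite (_ : _ @^-1` _ = [set z | is_first s (Phi z.1.1)
      (corner s (g z.1.1) z.1.2) z.1.2]).
    apply: measurable_is_first => //; first exact: (measurableT_comp mPhi m1).
    by apply: measurable_corner => //; exact: (measurableT_comp mg m1).
  by apply/seteqP; split => z /= => [/asboolP|fz]; last exact/asboolP.
have mb : measurable_fun setT b.
  exact: (measurable_indic_comp mB mq).
rewrite (_ : [set t | _] = (fun t => \esum_(x in Phi t) \esum_(y in Phi t) b (t, x, y)) @^-1` [set n%:R%:E]).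
  rewrite -[X in measurable X]setTI.
  apply: (measurable_esum_config (f := fun z : T * V => \esum_(y in Phi z.1) b (z, y))) => //.
    by apply: measurable_esum_config => //; exact: measurableT_comp.
  by move=> z; exact: esum_ge0.
apply/seteqP; suff E t : (marked_pairs (grid_mark s (Phi t) (g t)) `&` B #= `I_n) <->
   \esum_(x in Phi t) \esum_(y in Phi t) b (t, x, y) = n%:R%:E by split => t /E.
rewrite marked_pairs_card card_eq_esum esum_esum//=.
rewrite [X in X = _ <-> _](_ : _ = \esum_(p in Phi t `*`` (fun=> Phi t)) b (t, p.1, p.2)) //.
rewrite (_ : [set p | _] = (Phi t `*`` (fun=> Phi t)) `&`
  [set p | B (p, mark (grid_mark s (Phi t) (g t)) p.1 p.2)]); last first.
  by apply/seteqP; split => p /= => [[]|[[]]].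
rewrite esum_mkcondr; apply: eq_esum => -[x y] _; rewrite /b indicE/=.
case: ifPn => [/set_mem h|/negP h]; first by rewrite mem_set.
by rewrite memNset// => h'; apply: h; exact/mem_set.
Qed.

Variable s : R.
Hypothesis s0 : (0 < s)%R.

Lemma measurable_grid_mark1 phi : measurable_fun setT (grid_mark s phi).
Proof. exact: (@measurable_grid_mark _ _ s (cst phi) id). Qed.

HB.instance Definition _ phi :=
  isMeasurableFun.Build _ _ _ _ (grid_mark s phi) (measurable_grid_mark1 phi).

Definition grid_law phi : probability (mconfig R k bool) R :=
  [the probability _ _ of distribution (uniform_cube k) (grid_mark s phi)].

Lemma grid_lawE phi A : measurable A ->
  grid_law phi A = \int[uniform_cube k]_v (\1_A (grid_mark s phi v))%:E.
Proof.
move=> mA; rewrite -[LHS]/(uniform_cube k (grid_mark s phi @^-1` A)).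
rewrite -[X in uniform_cube k X]setIT -integral_indic//.
by rewrite -[X in measurable X]setTI; exact: measurable_grid_mark1.
Qed.

(** An almost sure statement needs a measurable null set, here for [base m = phi]. Equality with
    [phi] amounts to countably many memberships and the absence of points outside [phi]. *)
Lemma measurable_singleton_config phi : measurable [set phi].
Proof.
have mphi : measurable (points phi) by exact: (measurable_points (Phi := cst phi) (f := id)).
rewrite (_ : [set phi] = \bigcap_n \bigcap_(x in phi `&` box n%:R) [set psi | points psi x] `&`
   ~` [set psi : config R k | exists x, points psi x /\ (~` points phi) x]).
  apply: measurableI; last first.
    apply: measurableC; apply: (measurable_exists_point (Phi := id)
      (D := [set z | (~` points phi) z.2])) => //.
    rewrite -[X in measurable X]setTI; apply: (@measurable_snd _ _ (config R k) V) => //.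
    exact: measurableC.
  apply: bigcapT_measurable => n; apply: fin_bigcap_measurable.
    exact: finite_config_box.
  by move=> x _; apply: (measurable_points (Phi := id) (f := cst x)).
apply/seteqP; split=> [_ ->|psi [psi1 psi2]].
  by split => [n _ x []//|[x [px]]].
apply: config_eq; apply/seteqP; split => x px.
  by apply: contrapT => npx; apply: psi2; exists x.
have : setT x by []. rewrite -bigcup_box => -[n _ bx]; exact: (psi1 n I x).
Qed.

Lemma grid_law_base phi : {ae grid_law phi, forall m : mconfig R k bool, base m = phi}.
Proof.
exists (~` [set m | base m = phi]); split => //.
  apply: measurableC; rewrite -[X in measurable X]setTI.
  by exact: (@measurable_base R k _ bool measurableT _ (measurable_singleton_config phi)).
rewrite -[LHS]/(uniform_cube k (grid_mark s phi @^-1` _)) (_ : _ @^-1` _ = set0) ?measure0//.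
by apply/seteqP; split => // v /=; apply.
Qed.

Lemma measurable_grid_law A : measurable A ->
  measurable_fun setT (grid_law ^~ A : config R k -> \bar R).
Proof.
move=> mA; under eq_fun do rewrite grid_lawE//.
apply: (measurable_fun_fubini_tonelli_F (fun p : config R k * k.-tuple U =>
  (\1_A (grid_mark s p.1 p.2))%:E)) => //.
by apply: (measurable_indic_comp mA); exact: measurable_grid_mark.
Qed.

(** [grid_mark_shift] absorbs the translation into the offset, which may leave the unit cube; as the
    marking is periodic in the offset, its law is unchanged. *)
Lemma grid_law_shift t phi A : measurable A ->
  grid_law (shift_config t phi) A = grid_law phi (shift_mconfig t @^-1` A).
Proof.
move=> mA; have mtA : measurable (shift_mconfig t @^-1` A : set (mconfig R k bool)).
  by rewrite -[X in measurable X]setTI; exact: measurable_shift_mconfig.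
rewrite !grid_lawE//; under eq_integral do rewrite grid_mark_shift//.
apply: (@integral_cube_periodic R k (fun i => t ord0 i / s)%R
  (fun v => (\1_A (shift_mconfig t (grid_mark s phi v)))%:E)).
- apply: (measurable_indic_comp mA).
  apply: (measurableT_comp (f := shift_mconfig t)); first exact: measurable_shift_mconfig.
  exact: measurable_grid_mark1.
- by move=> v.
- by move=> N f v; rewrite grid_mark_lattice.
Qed.

(** The factor k + 1 is a crude substitute for the square root of k that stays positive when k =
    0. *)
Lemma box_enorm r x : (0 <= r)%R -> box r x -> (enorm x <= k.+1%:R * r)%R.
Proof.
move=> r0 xr; have K0 : (0 <= k.+1%:R * r)%R by rewrite mulr_ge0.
rewrite -[leRHS]ger0_norm// -sqrtr_sqr; apply: ler_wsqrtr.
apply: (@le_trans _ _ (\sum_(i < k) r ^+ 2)%R).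
  by apply: ler_sum => i _; rewrite -[leLHS]real_normK ?num_real// ler_pXn2r ?nnegrE.
rewrite sumr_const card_ord -[X in (X <= _)%R]mulr_natl exprMn ler_wpM2r ?sqr_ge0// -natrX ler_nat.
by rewrite -mulnn mulSn (leq_trans (leqnSn k)) ?leq_addr.
Qed.

End grid.

Section grid_covering.
Context {R : realType} {k : nat} {dO : measure_display}
  {Omega : measurableType dO} {P : probability Omega R}.
Variable Phi : {RV P >-> config R k}.
Local Notation V := 'rV[R]_k.
Variable s : R.
Hypothesis s0 : (0 < s)%R.

Definition grid_process : equivariant_process Phi bool :=
  @EquivariantProcess R k _ _ P Phi _ bool setT (grid_law s) measurableT
    (fun _ _ _ => I) (aeW _ (fun _ => I)) (fun phi _ => grid_law_base s phi)
    (fun A mA => measurable_grid_law s mA) (fun t phi _ A mA => grid_law_shift s0 t phi mA).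

Lemma intensity_grid : intensity grid_process =
  \int[P]_om \int[uniform_cube k]_v first_in s (Phi om) (0 + neg_cube_point s v)%R 0%R.
Proof.
apply: eq_integral => om _; rewrite [LHS]grid_lawE; last first.
  exact: (measurable_subset_of (M := id) (f := cst 0%R)).
apply: eq_integral_cube.
- apply: measurable_indic_comp; last exact: measurable_grid_mark1.
  exact: (measurable_subset_of (M := id) (f := cst 0%R)).
- by move=> v.
- apply: (@measurable_first_in _ _ _ _ s (cst (Phi om))
    (fun v => 0 + neg_cube_point s v)%R (cst 0%R)) => //.
  exact: measurable_neg_cube_point.
- by move=> v; exact: first_in_ge0.
move=> v vI; rewrite add0r -(corner_unit0 s0 vI) /first_in indicE.
congr (_%:R%:E); congr nat_of_bool; apply/idP/idP.
  by move=> /set_mem[].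
move=> h; rewrite mem_set//; split => //.
by move/asboolP : h => -[].
Qed.

Lemma grid_covering phi : {ae grid_law s phi, forall m : mconfig R k bool,
  base m = phi /\ forall x, points phi x -> exists y, points phi y /\
     (subset_of m y /\ box s (y - x)%R)}.
Proof.
(* The covering property is written as a countable intersection over the points of [phi], to have a
   measurable complement. Its preimage under [grid_mark] will be empty: every cell containing a
   point has a first point. *)
have mQ : measurable (\bigcap_n \bigcap_(x in phi `&` box n%:R)
   [set m : mconfig R k bool | exists y, points phi y /\ (subset_of m y /\ box s (y - x)%R)]).
  apply: bigcapT_measurable => n; apply: fin_bigcap_measurable; first exact: finite_config_box.
  move=> x _; apply: (measurable_exists_point (Phi := cst phi)
    (D := [set z : mconfig R k bool * V | subset_of z.1 z.2 /\ box s (z.2 - x)%R])) => //.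
  apply: measurableI; first exact: measurable_subset_of.
  rewrite -[X in measurable X]setTI.
  apply: (measurable_rowB (f := snd) (g := cst x)) => //; exact: measurable_box.
have aeQ : {ae grid_law s phi, forall m, (\bigcap_n \bigcap_(x in phi `&` box n%:R)
   [set m : mconfig R k bool | exists y, points phi y /\ (subset_of m y /\ box s (y - x)%R)]) m}.
  exists (~` (\bigcap_n \bigcap_(x in phi `&` box n%:R)
   [set m : mconfig R k bool | exists y, points phi y /\ (subset_of m y /\ box s (y - x)%R)])).
  split => //; first exact: measurableC.
  rewrite -[LHS]/(uniform_cube k (grid_mark s phi @^-1` _)) (_ : _ @^-1` _ = set0) ?measure0//.
  apply/seteqP; split => // v; apply => n _ x [px _] /=.
  have [y fy] := is_first_ex px (corner_cube v x s0).
  have [py zy _] := fy; exists y; split => //; split.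
    by split => //; apply/asboolP; rewrite (corner_eq s0 zy).
  move=> i; have := zy i; have := corner_cube v x s0 i; rewrite !mxE.
  set a := (s * _)%R; rewrite ler_norml; clearbody a; lra.
apply: (ae_imp2 (grid_law_base s phi) aeQ) => m bm mx; split => // x px.
by have : setT x by []; rewrite -bigcup_box => -[n _ bx]; exact: (mx n I x).
Qed.

Variable d : config R k -> V -> V -> R.

Lemma is_covering_grid (C r : R) : (0 < C)%R -> (C * (k.+1%:R * s) <= r)%R ->
  {ae P, forall om, forall x y, points (Phi om) x -> points (Phi om) y ->
    (d (Phi om) x y <= C * enorm (x - y))%R} ->
  is_covering d r grid_process.
Proof.
move=> C0 sr dC; apply: (ae_imp dC) => om dCom.
apply: (ae_imp (grid_covering (Phi om))) => m [-> mx] x px.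
have [y [py [my yx]]] := mx x px; exists y => //; split => //.
apply: le_trans (dCom _ _ py px) _; apply: le_trans sr.
by rewrite ler_pM2l//; apply: box_enorm => //; exact: ltW.
Qed.

Lemma lambda_le_mean_cell_ratio (w : equivariant_process Phi R) (C r : R) :
  point_stationary Phi ->
  process_as w (fun m : mconfig R k R => (0 < pmark m 0)%R) ->
  (0 < C)%R -> (C * (k.+1%:R * s) <= r)%R ->
  {ae P, forall om, forall x y, points (Phi om) x -> points (Phi om) y ->
    (d (Phi om) x y <= C * enorm (x - y))%R} ->
  lambda Phi d r <= mean w (fun m => cell_ratio s m 0%R).
Proof.
move=> Pst wp C0 sr dC; rewrite (mean_cell_ratioE Pst wp s0) -intensity_grid.
apply: ereal_inf_lbound; exists grid_process => //.
exact: (is_covering_grid C0 sr dC).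
Qed.

End grid_covering.

(** * Growth and decay *)

Section growth_comparison.
Context {R : realType}.

(** An error below every e is allowed because a constant factor K becomes the term ln K / ln r after
    the division by ln r. *)
Lemma le_limf_esup (F : set_system R) (f g : R -> \bar R) : Filter F ->
  (forall e : R, (0 < e)%R -> \forall x \near F, f x <= g x + e%:E) ->
  limf_esup f F <= limf_esup g F.
Proof.
move=> FF fg; apply/lee_addgt0Pr => e e0; rewrite -leeBlDr//.
rewrite [leRHS]limf_esupE; apply: le_ereal_inf_tmp => _ [A FA <-]; rewrite leeBlDr//.
apply: (@le_trans _ _ (ereal_sup (f @` (A `&` [set x | f x <= g x + e%:E])))).
  rewrite limf_esupE; apply: ereal_inf_lbound.
  by exists (A `&` [set x | f x <= g x + e%:E]) => //; apply: filterI => //; exact: fg.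
apply: ge_ereal_sup => _ [x [Ax /= fx] <-]; apply: le_trans fx _.
by rewrite leeD2r//; apply: ereal_sup_ubound; exists x.
Qed.

Lemma le_limf_einf (F : set_system R) (f g : R -> \bar R) : Filter F ->
  (forall e : R, (0 < e)%R -> \forall x \near F, f x <= g x + e%:E) ->
  limf_einf f F <= limf_einf g F.
Proof.
move=> FF fg; rewrite /limf_einf leeN2; apply: le_limf_esup => e e0.
apply: filterS (fg e e0) => x; rewrite leeNl oppeD ?fin_num_adde_defl// oppeK.
by rewrite leeBlDr.
Qed.

Lemma le_lne (x y : \bar R) : x <= y -> lne x <= lne y.
Proof.
move=> xy; have [x0|x0] := leP x 0; first by rewrite le0_lneNy// leNye.
rewrite lee_lne ?in_itv//= ?leey ?andbT; first exact: ltW.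
by rewrite ltW// (lt_le_trans x0).
Qed.

Lemma lneV_ge0 (x : \bar R) : 0 <= x -> lne x^-1 = - lne x.
Proof.
case: x => [x| |]//; last by rewrite invey /= lexx.
rewrite lee_fin le_eqVlt => /predU1P[<-|x0]; first by rewrite inve0 /= lexx.
by rewrite inver gt_eqF// lneV.
Qed.

Lemma lne_quotient_le (K r : R) (f g : \bar R) : (0 < K)%R -> (1 < r)%R -> 0 <= g ->
  f <= K%:E * g ->
  lne f / (ln r)%:E <= lne g / (ln r)%:E + (ln K / ln r)%:E.
Proof.
move=> K0 r1 g0 fg; have lr : (0 < ln r)%R by rewrite ln_gt0.
rewrite inver gt_eqF// EFinM -muleDl//; last by rewrite fin_num_adde_defl.
apply: lee_wpmul2r; first by rewrite lee_fin invr_ge0 ltW.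
apply: le_trans (le_lne fg) _.
move: g0; rewrite le_eqVlt => /predU1P[<-|g0].
  by rewrite mule0 /= lexx.
rewrite lneM ?in_itv/= ?leey ?andbT ?lte_fin//.
by rewrite [(K <= 0)%R]leNgt K0 addeC.
Qed.

Lemma near_lne_quotient (K : R) (f g : R -> \bar R) : (0 < K)%R ->
  (forall r, 0 <= g r) -> (forall r, (0 < r)%R -> f r <= K%:E * g r) ->
  forall e : R, (0 < e)%R -> \forall r \near pinfty_nbhs R,
    lne (f r) / (ln r)%:E <= lne (g r) / (ln r)%:E + e%:E.
Proof.
(* Beyond this threshold ln r exceeds |ln K| / e, and r > 1 makes ln r positive. *)
move=> K0 g0 fg e e0; exists (Num.max 1 (expR (`|ln K| / e)))%R.
split; first exact: num_real.
move=> r; rewrite gt_max => /andP[r1 rK].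
have r0 : (0 < r)%R by apply: lt_trans r1.
apply: le_trans (lne_quotient_le K0 r1 (g0 r) (fg r r0)) _.
rewrite leeD2l// lee_fin ler_pdivrMr ?ln_gt0// (le_trans (ler_norm _))//.
rewrite mulrC -ler_pdivrMr// ltW// -(expRK (`|ln K| / e)%R) ltr_ln ?posrE//.
exact: expR_gt0.
Qed.

Lemma growth_sup_le (K : R) (f g : R -> \bar R) : (0 < K)%R ->
  (forall r, 0 <= g r) -> (forall r, (0 < r)%R -> f r <= K%:E * g r) ->
  growth_sup f <= growth_sup g.
Proof. by move=> K0 g0 fg; apply: le_limf_esup; exact: (near_lne_quotient K0). Qed.

Lemma growth_inf_le (K : R) (f g : R -> \bar R) : (0 < K)%R ->
  (forall r, 0 <= g r) -> (forall r, (0 < r)%R -> f r <= K%:E * g r) ->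
  growth_inf f <= growth_inf g.
Proof. by move=> K0 g0 fg; apply: le_limf_einf; exact: (near_lne_quotient K0). Qed.

Lemma growth_inve (f : R -> \bar R) : (forall r, 0 <= f r) ->
  (fun r : R => lne (f r)^-1 / (ln r)%:E) = \- (fun r : R => lne (f r) / (ln r)%:E).
Proof. by move=> f0; apply/funext => r; rewrite lneV_ge0// mulNe. Qed.

(** Decay as growth of the inverse is the form to which [mean_ball_ratio_inve] applies. *)
Lemma decay_supE (f : R -> \bar R) : (forall r, 0 <= f r) ->
  decay_sup f = growth_sup (fun r => (f r)^-1).
Proof. by move=> f0; rewrite /growth_sup growth_inve// limf_esupN. Qed.

Lemma decay_infE (f : R -> \bar R) : (forall r, 0 <= f r) ->
  decay_inf f = growth_inf (fun r => (f r)^-1).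
Proof. by move=> f0; rewrite /growth_inf growth_inve// limf_einfN. Qed.

(** AM-GM gives the square root of h, which is at least h as h <= 1; expanding the square of u - h
    avoids the root. *)
Lemma amgm_real (h a u : R) : (0 <= h)%R -> (h <= 1)%R -> (h <= a)%R -> (0 < u)%R ->
  (h <= (a / u + u) / 2)%R.
Proof.
move=> h0 h1 ha u0.
have : (h / u <= a / u)%R by rewrite ler_pM2r ?invr_gt0.
suff : (2 * h <= h / u + u)%R by lra.
have : ((h / u + u) * u = h + u ^+ 2)%R by rewrite mulrDl divfK ?gt_eqF// expr2.
move=> e; rewrite -(ler_pM2r u0) e.
have := sqr_ge0 (u - h)%R; rewrite sqrrB; nra.
Qed.

(** Optimising over t amounts to c^2 <= A B, as Cauchy-Schwarz would give; the form with A^-1 also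
    covers infinite values. *)
Lemma inve_le_of_amgm (c : R) (A B : \bar R) : (0 < c)%R -> 0 <= A -> 0 <= B ->
  (forall t : R, (0 < t)%R -> c%:E <= (t / 2)%:E * A + (t^-1 / 2)%:E * B) ->
  A^-1 <= (c ^- 2)%:E * B.
Proof.
move=> c0; have K0 : (0 < c ^- 2)%R by rewrite invr_gt0 exprn_gt0.
case: B => [b| |]//; last by move=> _ _ _; rewrite gt0_muley ?leey.
case: A => [a| |]//; last first.
  by move=> _ b0 _; rewrite invey mule_ge0// lee_fin ltW.
rewrite !lee_fin => a0 b0 H.
have {}H t : (0 < t)%R -> (c <= t / 2 * a + t^-1 / 2 * b)%R.
  by move=> /H; rewrite lee_fin.
have a_gt0 : (0 < a)%R.
  rewrite lt_neqAle a0 andbT eq_sym; apply/eqP => a00.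
  (* If A were 0, this t would make the only remaining term smaller than c. *)
  have t0 : (0 < b / c + 1)%R by rewrite ltr_pwDr// divr_ge0// ltW.
  have bt : (b / (b / c + 1) < c)%R.
    by rewrite ltr_pdivrMr// mulrDr mulr1 mulrC divfK ?gt_eqF// ltrDl.
  by have := H _ t0; rewrite a00 mulr0 add0r mulrAC [(_ * b)%R]mulrC; lra.
rewrite inver gt_eqF// -EFinM lee_fin -[a^-1%R]mul1r ler_pdivrMr//.
rewrite mulrAC -mulrA mulrC ler_pdivlMr ?exprn_gt0// mul1r.
(* With this t the term in A is c / 2, which leaves c / 2 for the term in B. *)
have t0 : (0 < c / a)%R by exact: divr_gt0.
have := H _ t0; rewrite [(c / a / 2 * a)%R]mulrAC divfK ?gt_eqF// invf_div.
move=> h; have {}h : (c / 2 <= a / c / 2 * b)%R by lra.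
have : (c / 2 * c <= a / c / 2 * b * c)%R by rewrite ler_pM2r.
have -> : (a / c / 2 * b * c = a * b / 2)%R by field; rewrite gt_eqF.
rewrite expr2; lra.
Qed.

Lemma integral_prob_gt0 {d} {T : measurableType d} (mu : probability T R) (f : T -> \bar R) :
  measurable_fun setT f -> (forall x, 0 <= f x) -> {ae mu, forall x, 0 < f x} ->
  0 < \int[mu]_x f x.
Proof.
move=> mf f0 fae; rewrite lt_neqAle integral_ge0// andbT; apply/eqP => /esym I0.
have /(ae_eq_integral_abs mu measurableT mf) f00 : \int[mu]_x `|f x| = 0.
  by rewrite -[RHS]I0; apply: eq_integral => x _; rewrite gee0_abs.
have : {ae mu, forall x, False}.
  by apply: (ae_imp2 fae f00) => x fx /(_ I) fx0; move: fx; rewrite fx0 ltxx.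
case=> A [mA A0 sA]; have AT : A = setT by apply/seteqP; split => // x _; exact: sA.
by move: A0; rewrite AT probability_setT => /eqP; rewrite onee_eq0.
Qed.

End growth_comparison.

Lemma lee_inve {R : realType} (x y : \bar R) : 0 <= x -> x <= y -> y^-1 <= x^-1.
Proof. by move=> x0 xy; rewrite lee_pV2 ?inE// (le_trans x0). Qed.

(** * Cubes and balls *)

Section good_markings.
Context {R : realType} {k : nat} {dO : measure_display}
  {Omega : measurableType dO} {P : probability Omega R}.
Variable Phi : {RV P >-> config R k}.
Local Notation V := 'rV[R]_k.
Local Notation U := (measurableTypeR R).
Variable d : config R k -> V -> V -> R.
Variable w : equivariant_process Phi R.
Hypothesis Phi_stationary : point_stationary Phi.
Hypothesis d_metric : process_metric Phi d.
Hypothesis w_weight : is_weight w.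
Hypothesis w_pos : process_as w (fun m : mconfig R k R => (0 < pmark m 0)%R).
Implicit Types (m : mconfig R k R) (s r : R).

Definition positive_marking m :=
  [/\ points (base m) 0%R, (0 < pmark m 0)%R &
      forall x, points (base m) x -> (0 <= pmark m x)%R].

Lemma process_as_positive : process_as w positive_marking.
Proof.
have p0 : process_as w (fun m => points (base m) 0%R).
  exact: (process_as_base (A := fun phi => points phi 0%R) w Phi_stationary.1).
have pw : process_as w (fun m => forall x, points (base m) x -> (0 <= pmark m x)%R).
  by apply: (ae_imp (dom_ae w)) => om domw; exact: (w_weight domw).
by apply: process_as_imp (process_as_and p0 (process_as_and w_pos pw)) => m [? []].
Qed.

Lemma weight_pmark m x : positive_marking m -> points (base m) x -> weight m x = pmark m x.
Proof. by move=> [_ _ mp] px; rewrite /weight asboolT// max_l// mp. Qed.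

Lemma weight_ofE m A : positive_marking m ->
  weight_of m A = \esum_(x in base m `&` A) (weight m x)%:E.
Proof. by move=> mp; apply: eq_esum => x [px _]; rewrite weight_pmark. Qed.

(** [d] is measurable on pairs of points of the configuration only; with membership built in, the
    set is measurable in the whole space. *)
Definition close_pairs r : set (config R k * V * V) :=
  [set p | points p.1.1 p.1.2 /\ points p.1.1 p.2] `&`
  (fun p => d p.1.1 p.1.2 p.2) @^-1` [set x | (x <= r)%R].

Lemma measurable_pair_points : measurable [set p : config R k * V * V |
  points p.1.1 p.1.2 /\ points p.1.1 p.2].
Proof.
apply: measurableI.
  apply: (measurable_points (Phi := fun p : config R k * V * V => p.1.1) (f := fun p => p.1.2));
  exact: measurableT_comp.
apply: (measurable_points (Phi := fun p : config R k * V * V => p.1.1) (f := fun p => p.2)).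
  exact: measurableT_comp.
exact: measurable_snd.
Qed.

Lemma measurable_close_pairs r : measurable (close_pairs r).
Proof.
have [[md _] _] := d_metric; apply: md; first exact: measurable_pair_points.
by rewrite (_ : [set x | (x <= r)%R] = `]-oo, r]%classic)//; apply/seteqP; split => x;
   rewrite /= in_itv.
Qed.

Definition ball_weight r m : \bar R :=
  \esum_(x in base m) ((weight m x)%:E * (\1_(close_pairs r) (base m, 0%R, x))%:E).

Lemma ball_weight_ge0 r m : 0 <= ball_weight r m.
Proof. by apply: esum_ge0 => x _; rewrite mule_ge0// lee_fin// weight_ge0. Qed.

Lemma measurable_ball_weight r : measurable_fun setT (ball_weight r).
Proof.
apply: (measurable_esum_config (Phi := @base R k _ _) (f := fun p : mconfig R k R * V =>
   (weight p.1 p.2)%:E * (\1_(close_pairs r) (base p.1, 0%R, p.2))%:E)).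
- exact: measurable_base.
- apply: emeasurable_funM.
    by apply/measurable_EFinP; exact: measurable_weight.
  apply: (measurable_indic_comp (measurable_close_pairs r)).
  apply: measurable_fun_pair => //; apply: measurable_fun_pair => //.
  exact: (measurableT_comp (@measurable_base R k _ _)).
- by move=> p; rewrite mule_ge0// lee_fin// weight_ge0.
Qed.

Lemma ball_weightE r m : positive_marking m ->
  weight_of m (nball d (base m) r 0%R) = ball_weight r m.
Proof.
move=> mp; rewrite weight_ofE// esum_mkcondr; apply: eq_esum => x px.
have [p0 _ _] := mp; rewrite indicE; case: ifPn => [/set_mem[_ dx]|/negP nx].
  by rewrite mem_set ?mule1.
rewrite memNset ?mule0// => -[[_ _] dx]; apply: nx; apply/mem_set; split => //.
Qed.

Definition ball_ratio r m : \bar R := (weight m 0%R)%:E / ball_weight r m.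

Lemma ball_ratio_ge0 r m : 0 <= ball_ratio r m.
Proof. by rewrite mule_ge0// ?inve_ge0 ?ball_weight_ge0// lee_fin weight_ge0. Qed.

Lemma measurable_ball_ratio r : measurable_fun setT (ball_ratio r).
Proof.
apply: emeasurable_funM.
  by apply/measurable_EFinP; apply: (measurable_weight (f := cst 0%R)).
apply: measurable_inve; last exact: ball_weight_ge0.
exact: measurable_ball_weight.
Qed.

Lemma mean_ball_weightE r : mean_ball_weight d w r = mean w (ball_weight r).
Proof.
apply: process_expectationE; first exact: ball_weight_ge0.
by apply: process_as_imp process_as_positive => m mp; rewrite ball_weightE.
Qed.

Lemma mean_ball_ratioE r : mean_ball_ratio d w r = mean w (ball_ratio r).
Proof.
apply: process_expectationE; first exact: ball_ratio_ge0.
apply: process_as_imp process_as_positive => m mp.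
by rewrite ball_weightE// /ball_ratio weight_pmark//; case: mp.
Qed.

Lemma cube_neg_cube_point0 s (v : k.-tuple U) : (0 < s)%R ->
  (forall i, (0 <= (tnth v i : R) < 1)%R) -> cube s (neg_cube_point s v) 0%R.
Proof.
move=> s0 vI i; rewrite !mxE; have /andP[v0 v1] := vI i.
have su : (s * tnth v i < s)%R by rewrite -[ltRHS]mulr1 ltr_pM2l.
have su0 : (0 <= s * tnth v i)%R by rewrite mulr_ge0// ltW.
by move: su su0; set a := (s * _)%R; lra.
Qed.

Lemma share0_unit s m (v : k.-tuple U) : (0 < s)%R ->
  (forall i, (0 <= (tnth v i : R) < 1)%R) ->
  share s m 0%R (0 + neg_cube_point s v)%R =
  (weight m 0%R)%:E / cell_weight s m (neg_cube_point s v).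
Proof.
move=> s0 vI; rewrite add0r /share /cube_in indicE mem_set ?mule1//.
exact: cube_neg_cube_point0.
Qed.

Lemma measurable_cell_quotient s m : measurable_fun setT (fun v : k.-tuple U =>
  (weight m 0%R)%:E / cell_weight s m (neg_cube_point s v)).
Proof.
apply: emeasurable_funM => //; apply: measurable_inve; last first.
  by move=> v; exact: cell_weight_ge0.
apply: (@measurable_cell_weight _ _ _ _ s (cst m) (neg_cube_point s)) => //.
rewrite [X in measurable_fun _ X](_ : _ = fun v => 0 + neg_cube_point s v)%R.
  exact: measurable_neg_cube_point.
by apply/funext => v; rewrite add0r.
Qed.

Lemma mean_cube_ratioE s : (0 < s)%R ->
  mean_cube_ratio w s = mean w (fun m => cell_ratio s m 0%R).
Proof.
move=> s0; apply: process_expectationE => [m|]; first exact: cell_ratio_ge0.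
apply: process_as_imp process_as_positive => m mp.
transitivity (\int[uniform_cube k]_v
    ((weight m 0%R)%:E / cell_weight s m (neg_cube_point s v))).
  apply: eq_integral => v _; rewrite weight_ofE// -cell_weightE weight_pmark//.
  by case: mp.
apply: eq_integral_cube.
- exact: measurable_cell_quotient.
- by move=> v; rewrite mule_ge0 ?inve_ge0 ?cell_weight_ge0// lee_fin weight_ge0.
- exact: measurable_share_shift.
- by move=> v; exact: share_ge0.
- by move=> v vI; rewrite share0_unit.
Qed.

(** The growth comparisons ask for this at every real [r], whereas [mean_cube_ratioE] requires a
    positive mesh; the quotients are therefore bounded directly. *)
Lemma mean_cube_ratio_ge0 r : 0 <= mean_cube_ratio w r.
Proof.
rewrite (_ : mean_cube_ratio w r = mean w (fun m => \int[uniform_cube k]_v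
    ((weight m 0%R)%:E / cell_weight r m (neg_cube_point r v)))).
  apply: mean_ge0 => m; apply: integral_ge0 => v _.
  by rewrite mule_ge0 ?inve_ge0 ?cell_weight_ge0// lee_fin weight_ge0.
apply: process_expectationE => [m|].
  apply: integral_ge0 => v _.
  by rewrite mule_ge0 ?inve_ge0 ?cell_weight_ge0// lee_fin weight_ge0.
apply: process_as_imp process_as_positive => m mp.
by apply: eq_integral => v _; rewrite weight_ofE// -cell_weightE weight_pmark//; case: mp.
Qed.

Lemma ball_ratio_le_cell_ratio (C r s : R) m : positive_marking m -> (0 < C)%R -> (0 < s)%R ->
  (C * (k.+1%:R * s) <= r)%R ->
  (forall x y, points (base m) x -> points (base m) y ->
     (d (base m) x y <= C * enorm (x - y))%R) ->
  ball_ratio r m <= cell_ratio s m 0%R.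
Proof.
move=> mp C0 s0 sr dC; have [p0 _ _] := mp.
have cell_ball z : cube s z 0%R -> cell_weight s m z <= ball_weight r m.
  move=> z0; apply: le_esum => x px; rewrite lee_wpmul2l ?lee_fin ?weight_ge0//.
  rewrite indicE; have [/set_mem zx|//] := boolP (x \in cube s z).
  rewrite indicE mem_set//; split => //=.
  apply: le_trans (dC _ _ p0 px) _; apply: le_trans sr; rewrite ler_pM2l//.
  apply: box_enorm; first exact: ltW.
  by move=> i; have := z0 i; have := zx i; rewrite !mxE ler_norml; lra.
have share_ball (v : k.-tuple U) : (forall i, (0 <= (tnth v i : R) < 1)%R) ->
    ball_ratio r m <= share s m 0%R (0 + neg_cube_point s v)%R.
  move=> vI; rewrite share0_unit// /ball_ratio lee_wpmul2l ?lee_fin ?weight_ge0//.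
  apply: lee_inve; first exact: cell_weight_ge0.
  by apply: cell_ball; exact: cube_neg_cube_point0.
(* [share_ball] holds on the half-open cube only. The maximum with the ball ratio changes nothing
   there and makes the inequality true everywhere. *)
rewrite /cell_ratio (eq_integral_cube
  (G := fun v => maxe (share s m 0%R (0 + neg_cube_point s v)%R) (ball_ratio r m))).
- apply: (@le_trans _ _ (\int[uniform_cube k]_v cst (ball_ratio r m) v)).
    by rewrite integral_cst// [X in _ * X]probability_setT mule1.
  apply: ge0_le_integral => //.
  + by move=> v _; exact: ball_ratio_ge0.
  + by apply: measurable_maxe => //; exact: measurable_share_shift.
  + by move=> v _; rewrite le_max lexx orbT.
- exact: measurable_share_shift.
- by move=> v; exact: share_ge0.
- by apply: measurable_maxe => //; exact: measurable_share_shift.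
- by move=> v; rewrite le_max share_ge0.
- by move=> v vI; rewrite max_l// share_ball.
Qed.

Lemma mean_ball_ratio_le (C r s : R) : (0 < C)%R -> (0 < s)%R -> (C * (k.+1%:R * s) <= r)%R ->
  {ae P, forall om, forall x y, points (Phi om) x -> points (Phi om) y ->
    (d (Phi om) x y <= C * enorm (x - y))%R} ->
  mean_ball_ratio d w r <= mean w (fun m => cell_ratio s m 0%R).
Proof.
move=> C0 s0 sr dC; rewrite mean_ball_ratioE; apply: le_mean.
- exact: ball_ratio_ge0.
- by move=> m; exact: cell_ratio_ge0.
pose A (phi : config R k) := forall x y, points phi x -> points phi y ->
  (d phi x y <= C * enorm (x - y))%R.
have asA : process_as w (fun m => A (base m)) by exact: process_as_base.
apply: process_as_imp (process_as_and process_as_positive asA) => m [mp mA].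
exact: (ball_ratio_le_cell_ratio mp C0 s0 sr mA).
Qed.

(** E[w(0)] may be infinite. The cap at 1 gives a finite constant, still positive as w(0) > 0, and
    provides the bound h <= 1 of [amgm_real]. *)
Definition capped_weight m : \bar R := (Num.min (weight m 0%R) 1%R)%:E.

Lemma capped_weight_ge0 m : 0 <= capped_weight m.
Proof. by rewrite lee_fin le_min weight_ge0 ler01. Qed.

Lemma measurable_capped_weight : measurable_fun setT capped_weight.
Proof.
apply/measurable_EFinP; apply: measurable_minr => //.
exact: (measurable_weight (f := cst 0%R)).
Qed.

Lemma mean_capped_weight_gt0 : 0 < mean w capped_weight.
Proof.
apply: integral_prob_gt0.
- by apply: measurable_mean_inner; [exact: measurable_capped_weight|exact: capped_weight_ge0].
- by move=> om; apply: integral_ge0 => m _; exact: capped_weight_ge0.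
apply: (ae_imp (process_as_law process_as_positive)) => om mp.
apply: integral_prob_gt0.
- exact: measurable_capped_weight.
- exact: capped_weight_ge0.
apply: (ae_imp mp) => m {}mp; rewrite lte_fin lt_min ltr01 andbT weight_pmark//; by case: mp.
Qed.

Lemma capped_weight_le r m (t : R) : (0 < t)%R ->
  capped_weight m <= (t / 2)%:E * ball_ratio r m + (t^-1 / 2)%:E * ball_weight r m.
Proof.
move=> t0; rewrite /ball_ratio /capped_weight; have := ball_weight_ge0 r m.
set a := weight m 0%R; have a0 : (0 <= a)%R by exact: weight_ge0.
have t20 : (0 < t / 2)%R by rewrite divr_gt0.
have ti0 : (0 < t^-1 / 2)%R by rewrite divr_gt0 ?invr_gt0.
have h0 : (0 <= Num.min a 1)%R by rewrite le_min a0 ler01.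
have h1 : (Num.min a 1 <= 1)%R by rewrite ge_min lexx orbT.
have ha : (Num.min a 1 <= a)%R by rewrite ge_min lexx.
case: (ball_weight r m) => [N| |]//; last first.
  by rewrite invey mule0 mule0 add0e gt0_muley ?leey.
rewrite lee_fin le_eqVlt => /predU1P[<-|N0].
  (* A ball of weight 0 has ratio +oo, unless the origin has weight 0, and then the left side is
     0. *)
  rewrite inve0 mule0 adde0; move: a0; rewrite le_eqVlt => /predU1P[<-|a0].
    by rewrite mul0e mule0 lee_fin ge_min lexx.
  by rewrite gt0_muley ?lte_fin// gt0_muley ?leey.
rewrite inver gt_eqF// -!EFinM -EFinD lee_fin.
(* AM-GM is taken at u = N / t, with N the weight of the ball. *)
have := amgm_real h0 h1 ha (divr_gt0 N0 t0).
set lhs := Num.min a 1%R; clearbody lhs.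
have -> : ((a / (N / t) + N / t) / 2 = t / 2 * (a / N) + t^-1 / 2 * N)%R; last by [].
by field; rewrite !gt_eqF.
Qed.

Lemma mean_amgm r (t : R) : (0 < t)%R ->
  mean w capped_weight <= (t / 2)%:E * mean_ball_ratio d w r + (t^-1 / 2)%:E * mean_ball_weight d w r.
Proof.
move=> t0; rewrite mean_ball_ratioE mean_ball_weightE.
have t20 : (0 <= t / 2)%R by rewrite divr_ge0 ?ltW.
have ti0 : (0 <= t^-1 / 2)%R by rewrite divr_ge0 ?invr_ge0 ?ltW.
rewrite -!meanZ//; last 4 first.
- exact: measurable_ball_weight.
- exact: ball_weight_ge0.
- exact: measurable_ball_ratio.
- exact: ball_ratio_ge0.
rewrite -meanD.
- apply: le_mean.
  + exact: capped_weight_ge0.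
  + by move=> m; rewrite adde_ge0// mule_ge0 ?ball_ratio_ge0 ?ball_weight_ge0.
  + by apply: aeW => om; apply: aeW => m; exact: capped_weight_le.
- by apply: emeasurable_funM => //; exact: measurable_ball_ratio.
- by move=> m; rewrite mule_ge0 ?ball_ratio_ge0.
- by apply: emeasurable_funM => //; exact: measurable_ball_weight.
- by move=> m; rewrite mule_ge0 ?ball_weight_ge0.
Qed.

Lemma mean_ball_ratio_inve : exists2 K : R, (0 < K)%R &
  forall r, (mean_ball_ratio d w r)^-1 <= K%:E * mean_ball_weight d w r.
Proof.
have h0 := mean_capped_weight_gt0.
have hfin : mean w capped_weight \is a fin_num.
  rewrite ge0_fin_numE ?ltW// (@le_lt_trans _ _ 1) ?ltry//.
  apply: (@le_trans _ _ (\int[P]_om cst 1 om)); last first.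
    by rewrite integral_cst// [X in _ * X]probability_setT mule1.
  apply: le_integral_ae => [om|om|]; last apply: aeW => om.
  - by apply: integral_ge0 => m _; exact: capped_weight_ge0.
  - exact: lee01.
  rewrite -(integral_law_cst w (Phi om)); apply: le_integral_ae => [m|m|].
  - exact: capped_weight_ge0.
  - by rewrite lee_fin.
  - by apply: aeW => m; rewrite lee_fin ge_min lexx orbT.
pose c := fine (mean w capped_weight).
have c0 : (0 < c)%R by rewrite fine_gt0// h0 ltey_eq hfin.
exists (c ^- 2)%R; first by rewrite invr_gt0 exprn_gt0.
move=> r; apply: inve_le_of_amgm => //.
- by rewrite mean_ball_ratioE; apply: mean_ge0; exact: ball_ratio_ge0.
- by rewrite mean_ball_weightE; apply: mean_ge0; exact: ball_weight_ge0.
- by move=> t t0; rewrite fineK//; exact: mean_amgm.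
Qed.

End good_markings.

Theorem theorem5p13 (R : realType) (k : nat)
    (dO : measure_display) (Omega : measurableType dO) (P : probability Omega R)
    (Phi : {RV P >-> config R k})
    (d : config R k -> 'rV[R]_k -> 'rV[R]_k -> R)
    (Phi_stationary : point_stationary Phi)
    (d_metric : process_metric Phi d)
    (d_equiv : equivalent_to_euclidean Phi d)
    (w : equivariant_process Phi R)
    (w_weight : is_weight w)
    (w_pos : process_as w (fun m : mconfig R k R => (0 < pmark m 0)%R)) :
  [/\ udim_sup Phi d = decay_sup (mean_cube_ratio w),
      decay_sup (mean_cube_ratio w) <= decay_sup (mean_ball_ratio d w) &
      decay_sup (mean_ball_ratio d w) <= growth_sup (mean_ball_weight d w)] /\
  [/\ udim_inf Phi d = decay_inf (mean_cube_ratio w),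
      decay_inf (mean_cube_ratio w) <= decay_inf (mean_ball_ratio d w) &
      decay_inf (mean_ball_ratio d w) <= growth_inf (mean_ball_weight d w)].
Proof.
have [c [C [c0 C0 dcC]]] := d_equiv.
have dc : {ae P, forall om, forall x y, points (Phi om) x -> points (Phi om) y ->
    (c * enorm (x - y) <= d (Phi om) x y)%R}.
  by apply: (ae_imp dcC) => om h x y px py; have /andP[] := h x y px py.
have dC : {ae P, forall om, forall x y, points (Phi om) x -> points (Phi om) y ->
    (d (Phi om) x y <= C * enorm (x - y))%R}.
  by apply: (ae_imp dcC) => om h x y px py; have /andP[] := h x y px py.
pose C' := (C * k.+1%:R)%R; have C'0 : (0 < C')%R by rewrite mulr_gt0.
pose mu (s : R) := mean w (fun m => cell_ratio s m 0%R).
have muE s : (0 < s)%R -> mean_cube_ratio w s = mu s.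
  by move=> s0; exact: (mean_cube_ratioE Phi_stationary w_weight w_pos s0).
have lambda_ge0 r : 0 <= lambda Phi d r.
  by apply: le_ereal_inf_tmp => _ [S _ <-]; rewrite intensityE; apply: mean_ge0 => m;
    exact: selected_ge0.
have lambda_mu r s : (0 < s)%R -> (C' * s <= r)%R -> lambda Phi d r <= mu s.
  move=> s0 sr; apply: (lambda_le_mean_cell_ratio s0 Phi_stationary w_pos C0 _ dC).
  by rewrite mulrA.
(* The number of lattice points depends on r and s through q only, so one constant serves at all
   scales. *)
have mu_lambda (q : R) : exists2 K : R, (0 < K)%R &
    forall r s, (0 < s)%R -> (r / s = q)%R -> mu s <= K%:E * lambda Phi d r.
  pose N := (Num.truncn (q / c + 1)%R).+1.
  pose K : R := #|{ffun 'I_k -> 'I_(N.*2.+1)}|%:R.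
  have K0 : (0 < K)%R.
    by rewrite ltr0n; apply/card_gt0P; exists [ffun=> ord0].
  exists K => // r s s0 rs; rewrite -lee_pdivrMl//.
  apply: le_ereal_inf_tmp => _ [S Scov <-]; rewrite lee_pdivrMl//.
  apply: (mean_cell_ratio_le_intensity Phi_stationary c0 dc w s0 _ Scov).
  by rewrite mulrAC rs ltW// truncnS_gt.
(* The quotient 1 compares [mu] and [lambda] at the same scale; C' * C' is the quotient of C' r by r
   / C', used to change the scale of [mu]. *)
have [K1 K10 mu_lam1] := mu_lambda 1%R.
have [K2 K20 mu_lam2] := mu_lambda (C' * C')%R.
(* The change of scale passes through [lambda] at radius C' r, the radius for which the grid of mesh
   r is a covering. *)
have mu_scale r : (0 < r)%R -> mu (r / C')%R <= K2%:E * mu r.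
  move=> r0; apply: (@le_trans _ _ (K2%:E * lambda Phi d (C' * r)%R)).
    apply: mu_lam2; first exact: divr_gt0.
    by rewrite invf_div; field; rewrite !gt_eqF.
  by rewrite lee_pmul2l//; apply: lambda_mu.
have lam_cube r : (0 < r)%R -> lambda Phi d r <= K2%:E * mean_cube_ratio w r.
  move=> r0; rewrite muE//; apply: le_trans (mu_scale _ r0).
  by apply: lambda_mu; [exact: divr_gt0|rewrite mulrC divfK ?gt_eqF].
have cube_lam r : (0 < r)%R -> mean_cube_ratio w r <= K1%:E * lambda Phi d r.
  by move=> r0; rewrite muE//; apply: mu_lam1 => //; rewrite divff ?gt_eqF.
have ball_cube r : (0 < r)%R -> mean_ball_ratio d w r <= K2%:E * mean_cube_ratio w r.
  move=> r0; rewrite muE//; apply: le_trans (mu_scale _ r0).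
  apply: (mean_ball_ratio_le Phi_stationary w_weight w_pos C0 _ _ dC).
    exact: divr_gt0.
  by rewrite mulrA -/C' mulrC divfK ?gt_eqF.
have cube_ge0 r : 0 <= mean_cube_ratio w r by exact: mean_cube_ratio_ge0.
have ball_ge0 r : 0 <= mean_ball_ratio d w r.
  rewrite (mean_ball_ratioE d Phi_stationary w_weight w_pos).
  by apply: mean_ge0 => m; exact: ball_ratio_ge0.
have weight_ge0 r : 0 <= mean_ball_weight d w r.
  rewrite (mean_ball_weightE d Phi_stationary w_weight w_pos).
  by apply: mean_ge0 => m; exact: ball_weight_ge0.
have [K3 K30 inv_ball] := mean_ball_ratio_inve Phi_stationary d_metric w_weight w_pos.
split; split.
- rewrite /udim_sup /decay_sup; congr (- _); apply/eqP; rewrite eq_le.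
  by rewrite (growth_inf_le K20 cube_ge0 lam_cube) (growth_inf_le K10 lambda_ge0 cube_lam).
- by rewrite leeN2 (growth_inf_le K20 cube_ge0 ball_cube).
- rewrite decay_supE//; by apply: (growth_sup_le K30 weight_ge0) => r _; exact: inv_ball.
- rewrite /udim_inf /decay_inf; congr (- _); apply/eqP; rewrite eq_le.
  by rewrite (growth_sup_le K20 cube_ge0 lam_cube) (growth_sup_le K10 lambda_ge0 cube_lam).
- by rewrite leeN2 (growth_sup_le K20 cube_ge0 ball_cube).
- rewrite decay_infE//; by apply: (growth_inf_le K30 weight_ge0) => r _; exact: inv_ball.
Qed.
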